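(* Let $S$ be a log-linearly slowly decreasing function of local bounded variation on $[0,\infty)$ whose Laplace transform converges on $\Re e\, s>1$. Let $U(s)=\Re e\,\mathcal{L}\{\mathrm{d}S;s\}$, where $\mathcal{L}\{\mathrm{d}S;s\}=\int_{0^-}^{\infty}e^{-sx}\,\mathrm{d}S(x)$ for $\Re e\, s>1$. Suppose that $U$ has $L^{1}_{loc}$-boundary behavior on $1+i(\mathbb{R}\setminus\{0\})$, and that there is some $\lambda>0$ such that one of the following three conditions holds: (B.1) there is $c\geq 0$ such that $U(\sigma+it)\geq -c$ for all $t\in(-\lambda,\lambda)$ and $\sigma\in(1,2]$; (B.2) $\sup_{1<\sigma<2}\int_{-\lambda}^{\lambda}|U(\sigma+it)|\,\mathrm{d}t<\infty$; (B.3) there are $g\in L^{1}(-\lambda,\lambda)$ and $k\in\mathbb{N}$ such that $U(\sigma+it)\geq g(t)$ for a.e. $t\in(-\lambda,\lambda)$ and all $\sigma\in(1,2]$, and $U(\sigma+it)=O((\sigma-1)^{-k})$ for $t\in(-\lambda,\lambda)$ and $\sigma\in(1,2]$. Then $S(x)\sim a e^{x}$ as $x\to\infty$, where $a=\lim_{\sigma\to1^{+}}(\sigma-1)U(\sigma)$.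
   Context: A function $S$ is called log-linearly slowly decreasing (at $\infty$) if for each $\varepsilon>0$ there are $h,x_0>0$ such that $\frac{S(y)-S(x)}{e^{x}}\geq-\varepsilon$ for all $x\leq y\leq x+h$ and $x\geq x_0$. Functions of local bounded variation are normalized to be right continuous. A harmonic function $U$ on $\Re e\, s>1$ has $L^{1}_{loc}$-boundary behavior on $1+i(\mathbb{R}\setminus\{0\})$ if there is $f\in L^{1}_{loc}(\mathbb{R}\setminus\{0\})$ such that for every bounded closed interval $I\subset\mathbb{R}\setminus\{0\}$ one has $\lim_{\sigma\to1^{+}}\int_I|U(\sigma+it)-f(t)|\,\mathrm{d}t=0$. *)

(* Defs.v *)
From HB Require Import structures.
From mathcomp Require Import all_boot all_order all_algebra.
From mathcomp Require Import all_classical all_reals all_analysis.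
Set Implicit Arguments. Unset Strict Implicit. Unset Printing Implicit Defensive.
Import Order.TTheory GRing.Theory Num.Theory.
Import numFieldNormedType.Exports.
Local Open Scope classical_set_scope.
Local Open Scope ring_scope.

Section Defs.
Variable R : realType.
Implicit Types (f g : R -> R) (a b I : R).

Definition RS_sum f g a b (s : seq R) (xi : nat -> R) : R :=
  \sum_(0 <= i < size s)
     f (xi i) * (g (nth b (a :: s) i.+1) - g (nth b (a :: s) i)).

Definition RS_integral f g a b I : Prop :=
  forall e : R, 0 < e -> exists d : R, 0 < d /\
    forall (s : seq R) (xi : nat -> R),
      itv_partition a b s ->
      (forall i : nat, (i < size s)%N ->
         nth b (a :: s) i <= xi i <= nth b (a :: s) i.+1) ->
      (forall i : nat, (i < size s)%N ->
         nth b (a :: s) i.+1 - nth b (a :: s) i < d) ->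
      `| RS_sum f g a b s xi - I | < e.

Definition RS_improper f g a I : Prop :=
  forall e : R, 0 < e -> exists T0 : R, forall T : R, T0 <= T ->
    exists J : R, RS_integral f g a T J /\ `| J - I | < e.

(** S extended by 0 on (-oo,0): integrating with respect to [ext0 S] over
    [-1, T] gives the Stieltjes integral int_{0^-}^T (jump at 0 included). *)
Definition ext0 (S : R -> R) : R -> R := fun x => if x < 0 then 0 else S x.

(** real and imaginary parts of e^{-(sigma + i t) x} *)
Definition kerRe (sigma t : R) : R -> R := fun x => expR (- sigma * x) * cos (t * x).
Definition kerIm (sigma t : R) : R -> R := fun x => - (expR (- sigma * x) * sin (t * x)).

Definition log_linearly_slowly_decreasing (S : R -> R) : Prop :=
  forall eps : R, 0 < eps -> exists h x0 : R, [/\ 0 < h, 0 < x0 &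
    forall x y : R, x0 <= x -> x <= y -> y <= x + h ->
      (S y - S x) / expR x >= - eps].

Definition loc_BV_nonneg (S : R -> R) : Prop :=
  forall b : R, 0 < b -> bounded_variation 0 b S.

(** right continuity on [0, oo) (normalization) *)
Definition right_continuous_nonneg (S : R -> R) : Prop :=
  forall x0 : R, 0 <= x0 -> S x @[x --> x0^'+] --> S x0.

End Defs.

(* Main.v *)
Require Import Defs.
From HB Require Import structures.
From mathcomp Require Import all_boot all_order all_algebra.
From mathcomp Require Import all_classical all_reals all_analysis.
From mathcomp Require Import measurable_realfun ring lra.
Set Implicit Arguments.
Unset Strict Implicit.
Unset Printing Implicit Defensive.
Import Order.TTheory GRing.Theory Num.Theory.
Import numFieldNormedType.Exports.
Local Open Scope classical_set_scope.
Local Open Scope ring_scope.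

(* Write tau(x) = S(x) e^{-x}. Integration by parts turns the Stieltjes transform
   into U(sigma + it) = int_0^oo S(x) e^{-sigma x} (sigma cos tx + t sin tx) dx.
   Testing U on (0, M] against (1 - t/M) Re(e^{itu} / (sigma + it)) yields the
   Fejer mean of S(x) e^{-sigma x} at u, plus a term with kernel concentrated at
   -u, which is O(1/u). Only t > 0 occurs since U is even in t.

   First, at a near-maximum of |S(x) e^{-sigma x}| slow decrease makes the Fejer
   mean comparable with the maximum, so sup |S(x) e^{-sigma x}| is bounded by
   1 + int_0^M |U(sigma + it)| dt. Each of (B.1)-(B.3) makes that integral bounded
   as sigma -> 1+: under (B.2) directly, and under a lower bound by an integrable
   function because the identity at u = 0 controls int_0^b U from above.
   Hence tau is bounded.

   Next, let sigma -> 1+ along a sequence for which the mass of U near t = 0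
   converges. The boundary function f is integrable at 0, so the limit of the
   tested U is a constant plus an oscillatory integral of f, which tends to 0 as
   u -> oo by the Riemann-Lebesgue lemma. Thus the Fejer means of tau converge,
   for every M >= 1, to one constant, and letting M grow, boundedness and slow
   decrease upgrade this to convergence of tau itself. *)

(** * Real integrals, Fubini and calculus *)

(** Only the real part of L{dS; s} = s L{S; s} is controlled, so the factor s cannot simply be
    divided out. For real parts, 2 Re F Re G = Re(F G) + Re(F conj G): with G = e^{itu}/s the first
    product is free of s and carries the frequency x - u, while the second keeps the unimodular
    factor s / conj s and carries x + u. Since x and u are nonnegative, the second product is never
    resonant for large u.

    The a priori bound is a loop: the supremum is bounded by the mass of |U|, and under a one-sided
    bound the mass is bounded by data away from 0 plus a small multiple of the supremum. The loop
    closes because both are finite at each fixed sigma > 1; this rests on S(x) = O(e^{sigma x}),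
    extracted from convergence of the transform at t = 0 by a Gronwall-type argument.

    The limit of (sigma - 1) U(sigma) is not known beforehand. A cluster value of the mass near 0
    fixes the constant, because the Fejer means of tau do not depend on sigma; the Abelian direction
    then identifies it. *)

Section real_integrals.
Context {d} {T : measurableType d} {R : realType}.
Variable nu : {measure set T -> \bar R}.
Implicit Types (D : set T) (f g : T -> R).

Lemma integrable_le D f g : measurable D -> measurable_fun D f ->
  nu.-integrable D (EFin \o g) -> (forall x, D x -> `|f x| <= g x) ->
  nu.-integrable D (EFin \o f).
Proof.
move=> mD mf ig fg; apply: le_integrable ig => //; first exact/measurable_EFinP.
move=> x Dx; rewrite /= lee_fin (le_trans (fg _ Dx))//.
by rewrite ler_norm.
Qed.

Lemma integrable_measurable D f : nu.-integrable D (EFin \o f) ->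
  measurable_fun D f.
Proof. by move=> /measurable_int/measurable_EFinP. Qed.

Lemma integrableRZ D r f : measurable D -> nu.-integrable D (EFin \o f) ->
  nu.-integrable D (EFin \o (fun x => r * f x)).
Proof. by move=> mD fi; apply: (integrableZl mD r fi). Qed.

Lemma integrableRD D f g : measurable D -> nu.-integrable D (EFin \o f) ->
  nu.-integrable D (EFin \o g) ->
  nu.-integrable D (EFin \o (fun x => f x + g x)).
Proof. by move=> mD fi gi; apply: (integrableD mD fi gi). Qed.

Lemma integrableRB D f g : measurable D -> nu.-integrable D (EFin \o f) ->
  nu.-integrable D (EFin \o g) ->
  nu.-integrable D (EFin \o (fun x => f x - g x)).
Proof. by move=> mD fi gi; apply: (integrableB mD fi gi). Qed.

Lemma integrable_mul_bounded D f g (B : R) : measurable D ->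
  nu.-integrable D (EFin \o f) -> measurable_fun D g ->
  (forall x, D x -> `|g x| <= B) ->
  nu.-integrable D (EFin \o (fun x => f x * g x)).
Proof.
move=> mD fi mg gB; apply: (integrable_le (g := fun x => B * `|f x|)) => //.
- by apply: measurable_funM => //; exact: integrable_measurable.
- by apply: integrableRZ => //; exact: integrable_norm.
- by move=> x Dx; rewrite normrM mulrC ler_wpM2r// gB.
Qed.

Lemma normr_Rintegral_le D f g : measurable D -> measurable_fun D f ->
  nu.-integrable D (EFin \o g) -> (forall x, D x -> `|f x| <= g x) ->
  `|\int[nu]_(x in D) f x| <= \int[nu]_(x in D) g x.
Proof.
move=> mD mf ig fg; have fi := integrable_le mD mf ig fg.
apply: (le_trans (le_normr_Rintegral mD fi)); apply: le_Rintegral => //.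
exact: integrable_norm.
Qed.

Lemma ae_imp (P Q : T -> Prop) : {ae nu, forall x, P x} ->
  (forall x, P x -> Q x) -> {ae nu, forall x, Q x}.
Proof. by move=> aP PQ; exact: filterS aP. Qed.

Lemma le_Rintegral_ae D f g : measurable D -> nu.-integrable D (EFin \o f) ->
  nu.-integrable D (EFin \o g) -> {ae nu, forall x, D x -> f x <= g x} ->
  \int[nu]_(x in D) f x <= \int[nu]_(x in D) g x.
Proof.
move=> mD fi gi fg; rewrite -subr_ge0 -RintegralB//.
have hi := integrableRB mD gi fi.
have mh := integrable_measurable hi.
(* The difference is nonnegative only almost everywhere; replacing it by its modulus makes it
   nonnegative everywhere without changing the integral. *)
rewrite (_ : \int[nu]_(x in D) _ = \int[nu]_(x in D) `|g x - f x|).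
  exact: Rintegral_ge0.
congr fine; apply: ae_eq_integral => //.
- exact/measurable_EFinP.
- by apply/measurable_EFinP; exact: measurableT_comp.
- by apply: filterS fg => x fgx Dx; rewrite ger0_norm ?subr_ge0// fgx.
Qed.

Lemma Rintegral_subset_le D f : measurable D -> nu.-integrable setT (EFin \o f) ->
  (forall x, 0 <= f x) -> \int[nu]_(x in D) f x <= \int[nu]_x f x.
Proof.
move=> mD fi f0; have fiD : nu.-integrable D (EFin \o f) by exact: integrableS fi.
rewrite Rintegral_mkcond; apply: le_Rintegral => //.
- by rewrite -restrict_EFin; apply/(integrable_mkcond _ _).1.
- by move=> x _; rewrite patchE; case: ifPn.
Qed.

Lemma EFin_Rintegral D f : measurable D -> nu.-integrable D (EFin \o f) ->
  (\int[nu]_(x in D) f x)%:E = (\int[nu]_(x in D) (f x)%:E)%E.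
Proof. by move=> mD fi; rewrite fineK//; exact: integrable_fin_num. Qed.

Lemma cvg_Rintegral_dominated D (f_ : nat -> T -> R) f g : measurable D ->
  (forall n, measurable_fun D (f_ n)) ->
  nu.-integrable D (EFin \o g) ->
  (forall x, D x -> f_ n x @[n --> \oo] --> f x) ->
  (forall n x, D x -> `|f_ n x| <= g x) ->
  \int[nu]_(x in D) f_ n x @[n --> \oo] --> \int[nu]_(x in D) f x.
Proof.
move=> mD mf ig ff fg.
have mlim : measurable_fun D f by apply: (measurable_fun_cvg mf) => x Dx; exact: ff.
have fi : nu.-integrable D (EFin \o f).
  apply: (integrable_le _ _ ig) => // x Dx.
  have h : `|f_ n x| @[n --> \oo] --> `|f x| by apply: cvg_norm; exact: ff.
  rewrite -(cvg_lim _ h)//.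
  apply: limr_le; first by apply/cvg_ex; exists `|f x|.
  by apply: nearW => n; exact: fg.
apply: fine_cvg; rewrite EFin_Rintegral//.
apply: (@dominated_cvg _ _ _ nu D mD (fun n => EFin \o f_ n) (EFin \o f) (EFin \o g)) => //.
- by move=> n; exact/measurable_EFinP.
- by move=> x Dx; apply: cvg_EFin; [exact: nearW|exact: ff].
Qed.

End real_integrals.

(** * Fubini on a measurable rectangle *)

Section fubini_rectangle.
Context {d1 d2} {T1 : measurableType d1} {T2 : measurableType d2} {R : realType}.
Variable m1 : {sigma_finite_measure set T1 -> \bar R}.
Variable m2 : {sigma_finite_measure set T2 -> \bar R}.
Implicit Types (A : set T1) (B : set T2) (F : T1 * T2 -> R).
Implicit Types (a : T1 -> R) (b : T2 -> R).

(** The rectangle enters through indicators, so that Fubini on the whole product applies. Tonelli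
    reduces integrability to the product of the integrals of |a| and |b|. *)
Lemma integrable_rectangle A B F a b :
  measurable A -> measurable B -> measurable_fun setT F ->
  m1.-integrable A (EFin \o a) -> m2.-integrable B (EFin \o b) ->
  (forall x y, A x -> B y -> `|F (x, y)| <= a x * b y) ->
  (m1 \x m2)%E.-integrable setT (EFin \o (fun z : T1 * T2 => \1_A z.1 * \1_B z.2 * F z)).
Proof.
move=> mA mB mF ia ib Fab.
have mG : measurable_fun setT (fun z : T1 * T2 => \1_A z.1 * \1_B z.2 * F z).
  apply: measurable_funM => //; apply: measurable_funM.
    have mi : measurable_fun setT (\1_A : T1 -> R) by exact: measurable_indic.
    exact: (measurableT_comp mi measurable_fst).
  have mi : measurable_fun setT (\1_B : T2 -> R) by exact: measurable_indic.
  exact: (measurableT_comp mi measurable_snd).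
apply/integrable12ltyP; first exact/measurable_EFinP.
have ia' := integrable_norm ia; have ib' := integrable_norm ib.
have bfin : (\int[m2]_(y in B) `|b y|%:E < +oo)%E.
  by have /integrableP[_] := ib'; under eq_integral do rewrite /= normr_id.
pose b0 := fine (\int[m2]_(y in B) `|b y|%:E)%E.
have b0E : (b0%:E = \int[m2]_(y in B) `|b y|%:E)%E.
  by rewrite fineK// ge0_fin_numE// integral_ge0// => y _; rewrite lee_fin.
have mb : measurable_fun B (fun y => `|b y|).
  by apply: (integrable_measurable ib').
have key x : (\int[m2]_y `|(\1_A x * \1_B y * F (x, y))%:E| <=
    (\1_A x * `|a x| * b0)%:E)%E.
  rewrite EFinM b0E -ge0_integralZl//; last exact/measurable_EFinP.
  rewrite [leRHS]integral_mkcond; apply: ge0_le_integral => //.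
  - apply: measurableT_comp => //; apply/measurable_EFinP.
    exact: (measurableT_comp mG (pair1_measurable x)).
  - apply/(measurable_restrictT _ _).1 => //; apply: measurable_funeM.
    exact/measurable_EFinP.
  - move=> y _; rewrite patchE/= !indicE; case: ifPn => yB; rewrite ?mulr0 ?mul0r ?normr0//.
    case: (boolP (x \in A)) => xA; rewrite ?mul0r ?normr0 ?mul0e ?lee_fin ?mulr_ge0//.
    rewrite /= !mul1r (le_trans (Fab _ _ (set_mem xA) (set_mem yB)))// -normrM.
    exact: ler_norm.
have ma : measurable_fun A (fun x => `|a x|) by apply: (integrable_measurable ia').
apply: (@le_lt_trans _ _ (\int[m1]_x (\1_A x * `|a x| * b0)%:E)%E).
  apply: ge0_le_integral => //.
  - by move=> x _; exact: integral_ge0.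
  - apply: (measurable_fun_fubini_tonelli_F (fun z : T1 * T2 => `|(\1_A z.1 * \1_B z.2 * F z)%:E|%E)) => //.
    exact/measurableT_comp/measurable_EFinP.
  - apply/measurable_EFinP; apply: measurable_funM => //.
    rewrite [X in measurable_fun _ X](_ : _ = (fun x => `|a x|) \_ A).
      exact/(measurable_restrictT _ _).1.
    by apply/funext => x; rewrite patchE indicE; case: ifPn; rewrite ?mul1r ?mul0r.
  - by move=> x _; exact: key.
rewrite [X in (X < _)%E](_ : _ = \int[m1]_(x in A) (b0 * `|a x|)%:E)%E.
  by have /integrable_lty := integrableRZ b0 mA ia'; apply.
rewrite [RHS]integral_mkcond; apply: eq_integral => x _; rewrite patchE indicE.
by case: ifPn => _; rewrite ?mul1r ?mul0r// mulrC.
Qed.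

Lemma Rfubini_rectangle A B F a b :
  measurable A -> measurable B -> measurable_fun setT F ->
  m1.-integrable A (EFin \o a) -> m2.-integrable B (EFin \o b) ->
  (forall x y, A x -> B y -> `|F (x, y)| <= a x * b y) ->
  \int[m1]_(x in A) \int[m2]_(y in B) F (x, y) =
  \int[m2]_(y in B) \int[m1]_(x in A) F (x, y).
Proof.
move=> mA mB mF ia ib Fab.
have iG := integrable_rectangle mA mB mF ia ib Fab.
have mFx x : measurable_fun setT (fun y => F (x, y)).
  exact: (measurableT_comp mF (pair1_measurable x)).
have mFy y : measurable_fun setT (fun x => F (x, y)).
  exact: (measurableT_comp mF (pair2_measurable y)).
have iFx x : A x -> m2.-integrable B (EFin \o (fun y => F (x, y))).
  move=> Ax; apply: (integrable_le (nu := m2) (g := fun y => a x * b y)) => //.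
  - exact: measurable_funS (mFx x).
  - exact: integrableRZ.
  - by move=> y By; exact: Fab.
have iFy y : B y -> m1.-integrable A (EFin \o (fun x => F (x, y))).
  move=> By; apply: (integrable_le (nu := m1) (g := fun x => b y * a x)) => //.
  - exact: measurable_funS (mFy y).
  - exact: integrableRZ.
  - by move=> x Ax; rewrite mulrC; exact: Fab.
have := Fubini iG => /(congr1 fine) E.
have L : fine (\int[m1]_x \int[m2]_y (EFin \o (fun z : T1 * T2 => (\1_A z.1 * \1_B z.2 * F z)%R)) (x, y))%E
   = \int[m1]_(x in A) \int[m2]_(y in B) F (x, y).
  rewrite [RHS]Rintegral_mkcond; congr fine; apply: eq_integral => x _.
  rewrite patchE; case: ifPn => xA; last first.
    by rewrite integral0_eq// => y _ /=; rewrite indicE (negbTE xA) !mul0r.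
  rewrite EFin_Rintegral//; last exact/iFx/set_mem.
  rewrite [RHS]integral_mkcond; apply: eq_integral => y _ /=; rewrite patchE !indicE xA mul1r.
  by case: ifPn; rewrite ?mul1r ?mul0r.
rewrite -L E [RHS]Rintegral_mkcond; congr fine; apply: eq_integral => y _.
rewrite patchE; case: ifPn => yB; last first.
  by rewrite integral0_eq// => x _ /=; rewrite !indicE (negbTE yB) mulr0 !mul0r.
rewrite EFin_Rintegral//; last exact/iFy/set_mem.
rewrite [RHS]integral_mkcond; apply: eq_integral => x _ /=; rewrite patchE !indicE yB mulr1.
by case: ifPn; rewrite ?mul1r ?mul0r.
Qed.

Lemma measurable_Rintegral_rectangle A B F a b :
  measurable A -> measurable B -> measurable_fun setT F ->
  m1.-integrable A (EFin \o a) -> m2.-integrable B (EFin \o b) ->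
  (forall x y, A x -> B y -> `|F (x, y)| <= a x * b y) ->
  measurable_fun A (fun x => \int[m2]_(y in B) F (x, y)).
Proof.
move=> mA mB mF ia ib Fab.
have iG := integrable_rectangle mA mB mF ia ib Fab.
have /(measurable_funTS (D := A)) mf1 := measurable_fubini_F iG.
have mf2 : measurable_fun A (fun x => fine (fubini_F m2 (EFin \o (fun z : T1 * T2 => \1_A z.1 * \1_B z.2 * F z)) x)).
  exact: measurableT_comp.
apply: eq_measurable_fun mf2 => x xA; congr fine.
rewrite /fubini_F [RHS]integral_mkcond; apply: eq_integral => y _ /=.
rewrite patchE !indicE xA mul1r.
by case: ifPn; rewrite ?mul1r ?mul0r.
Qed.

End fubini_rectangle.

(** * Derivatives and the fundamental theorem of calculus *)

Section calculus.
Context {R : realType}.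
Notation mu := (@lebesgue_measure R).
Implicit Types (f g F : R -> R).

Definition has_deriv (f : R -> R) (x d : R) : Prop := is_derive x 1 f d.

Lemma deriveC (c x : R) : has_deriv (fun _ : R => c) x 0.
Proof. exact: is_derive_cst. Qed.

Lemma deriveI (x : R) : has_deriv (fun t : R => t) x 1.
Proof. exact: is_derive_id. Qed.

(** Separates finding a derivative from recognising it: the tactic [der] produces some [d] by
    unification, and [ring] or [field] compares it with the wanted value. [Rintegral_FTC] takes its
    hypothesis in the same form. *)
Lemma derive_eq f (x b : R) : (exists2 d, has_deriv f x d & d = b) ->
  has_deriv f x b.
Proof. by case=> d fd <-. Qed.

Lemma deriveD_fun f g (x a b : R) : has_deriv f x a -> has_deriv g x b ->
  has_deriv (fun t => f t + g t) x (a + b).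
Proof. by move=> fa gb; exact: is_deriveD. Qed.

Lemma deriveB_fun f g (x a b : R) : has_deriv f x a -> has_deriv g x b ->
  has_deriv (fun t => f t - g t) x (a - b).
Proof. by move=> fa gb; exact: is_deriveB. Qed.

Lemma deriveN_fun f (x a : R) : has_deriv f x a ->
  has_deriv (fun t => - f t) x (- a).
Proof. by move=> fa; exact: is_deriveN. Qed.

Lemma deriveM_fun f g (x a b : R) : has_deriv f x a -> has_deriv g x b ->
  has_deriv (fun t => f t * g t) x (a * g x + f x * b).
Proof.
move=> fa gb; apply: (@is_derive_eq _ _ _ _ _ _ _ _ (is_deriveM fa gb)).
by rewrite addrC [a * _]mulrC.
Qed.

Lemma deriveV_fun f (x a : R) : f x != 0 -> has_deriv f x a ->
  has_deriv (fun t => (f t)^-1) x (- ((f x) ^- 2 * a)).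
Proof.
move=> fx0 fa; apply: (@is_derive_eq _ _ _ _ _ _ _ _ (is_deriveV fx0 fa)).
by rewrite -mulNr.
Qed.

Lemma derive_sin_fun f (x a : R) : has_deriv f x a ->
  has_deriv (fun t => sin (f t)) x (cos (f x) * a).
Proof. by move=> fa; exact: (is_derive1_comp (is_derive_sin _) fa). Qed.

Lemma derive_cos_fun f (x a : R) : has_deriv f x a ->
  has_deriv (fun t => cos (f t)) x (- sin (f x) * a).
Proof. by move=> fa; exact: (is_derive1_comp (is_derive_cos _) fa). Qed.

Lemma derive_expR_fun f (x a : R) : has_deriv f x a ->
  has_deriv (fun t => expR (f t)) x (expR (f x) * a).
Proof. by move=> fa; exact: (is_derive1_comp (is_derive_expR _) fa). Qed.

Lemma is_derive_continuous f : (forall x : R, exists d, has_deriv f x d) ->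
  continuous f.
Proof.
move=> df x; have [d [dfx _]] := df x.
by apply: differentiable_continuous; apply/derivable1_diffP.
Qed.

Lemma continuousD_fun f g : continuous f -> continuous g ->
  continuous (fun t => f t + g t).
Proof. by move=> cf cg x; apply: cvgD; [exact: cf|exact: cg]. Qed.

Lemma continuousM_fun f g : continuous f -> continuous g ->
  continuous (fun t => f t * g t).
Proof. by move=> cf cg x; apply: cvgM; [exact: cf|exact: cg]. Qed.

Lemma Rintegral_FTC f F (a b : R) : a <= b ->
  (forall x : R, exists2 d, has_deriv F x d & d = f x) -> continuous f ->
  \int[mu]_(x in `[a, b]) f x = F b - F a.
Proof.
rewrite le_eqVlt => /predU1P[<- _ _|ab dF0 cf].
  by rewrite set_itv1 Rintegral_set1 subrr.
have dF x := derive_eq (dF0 x).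
have cF : continuous F by apply: is_derive_continuous => x; exists (f x).
rewrite /Rintegral (@continuous_FTC2 _ f F)//.
- exact: continuous_subspaceT.
- split.
  + by move=> x _; have [] := dF x.
  + exact/cvg_at_right_filter/cF.
  + exact/cvg_at_left_filter/cF.
- by move=> x _; rewrite derive1E; have [_ ->] := dF x.
Qed.

Lemma continuous_integrable_cc f (a b : R) : continuous f ->
  mu.-integrable `[a, b] (EFin \o f).
Proof.
move=> cf; apply: continuous_compact_integrable; first exact: segment_compact.
exact: continuous_subspaceT.
Qed.

Lemma Rintegral_cc_le f (a b B : R) : a <= b -> continuous f ->
  (forall t, a <= t <= b -> `|f t| <= B) ->
  `|\int[mu]_(t in `[a, b]) f t| <= B * (b - a).
Proof.
move=> ab cf fB.
apply: (@le_trans _ _ (\int[mu]_(t in `[a, b]) B)).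
  apply: normr_Rintegral_le => //.
  - exact: measurable_funTS (continuous_measurable_fun cf).
  - apply: continuous_integrable_cc => x; exact: cvg_cst.
by rewrite Rintegral_cst//= lebesgue_measure_itv/= lte_fin; case: ltP => //= ba;
    rewrite (le_anti (_ : a <= b <= a)) ?ab// subrr mulr0.
Qed.

Lemma continuous_Rmeasurable f (D : set R) : continuous f -> measurable_fun D f.
Proof. by move=> cf; exact: measurable_funTS (continuous_measurable_fun cf). Qed.

End calculus.

Ltac der_step := first
 [ apply: deriveC | apply: deriveI | apply: deriveD_fun | apply: deriveB_fun
 | apply: deriveM_fun | apply: deriveN_fun | apply: derive_sin_fun
 | apply: derive_cos_fun | apply: derive_expR_fun ].
Ltac der := repeat der_step.
Ltac cont := apply: is_derive_continuous => ?; eexists; der.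

(** * The Fejer kernel and the mirror kernel *)

Section lorentz_density.
Context {R : realType}.
Notation mu := (@lebesgue_measure R).

(** Common integrable majorant of the kernels below: the Cauchy density up to the factor [pi]. *)
Definition lorentz (y : R) : R := (1 + y ^+ 2)^-1.

Lemma lorentz_gt0 y : 0 < lorentz y.
Proof. by rewrite invr_gt0 ltr_pwDl// sqr_ge0. Qed.

Lemma lorentz_le1 y : lorentz y <= 1.
Proof. by rewrite invf_le1 ?lerDl ?sqr_ge0// ltr_pwDl// sqr_ge0. Qed.

Lemma lorentzN y : lorentz (- y) = lorentz y.
Proof. by rewrite /lorentz sqrrN. Qed.

(** Reduces a majorisation to two separate bounds, one on [a] and one on [y ^+ 2 * a]. *)
Lemma le_lorentz (a y C : R) : (1 + y ^+ 2) * a <= C -> a <= C * lorentz y.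
Proof. by rewrite ler_pdivlMr 1?mulrC// ltr_pwDl// sqr_ge0. Qed.

Lemma continuous_lorentz : continuous lorentz.
Proof. exact: continuous_oneDsqrV. Qed.

Lemma integral_lorentz : (\int[mu]_x (lorentz x)%:E = pi%:E)%E.
Proof.
rewrite ge0_symfun_integralT//=.
- rewrite -set_itvcy [X in (_ * X)%E](_ : _ = (pi / 2)%:E).
    by rewrite -EFinM mulrCA divff ?mulr1.
  exact: integral0y_oneDsqr.
- by move=> x; exact/ltW/lorentz_gt0.
- exact: continuous_lorentz.
- by move=> x /=; rewrite lorentzN.
Qed.

Lemma integral_affine (G : R -> R) (s u : R) : 0 < s -> continuous G ->
  (forall x, 0 <= G x) ->
  (\int[mu]_x (s * G (s * (x - u)))%:E = \int[mu]_x (G x)%:E)%E.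
Proof.
move=> s0 cG G0; pose F x := s * (x - u).
have dF (x : R) : has_deriv F x s.
  rewrite /F; apply: derive_eq; eexists; first by der.
  by rewrite /= mul0r add0r addr0 mulr1.
have F'E : derive1 F = cst s.
  by apply/funext => x; rewrite derive1E; have [_ ->] := dF x.
rewrite [RHS](@increasing_ge0_integration_by_substitutionT _ F G)//.
- by apply: eq_integral => x _; rewrite F'E /= mulrC.
- by move=> x y xy; rewrite /F ltr_pM2l// ltrD2r.
- by rewrite F'E; exact: cst_continuous.
- by rewrite F'E; exact: is_cvg_cst.
- by rewrite F'E; exact: is_cvg_cst.
- apply/cvgrNyPle => A; near=> x.
  rewrite /F -ler_pdivlMl// lerBlDr; by near: x; apply: nbhs_ninfty_le; rewrite num_real.
- apply/cvgryPge => A; near=> x.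
  rewrite /F -ler_pdivrMl// lerBrDr; by near: x; apply: nbhs_pinfty_ge; rewrite num_real.
Unshelve. all: by end_near. Qed.

Lemma integrable_affine (G : R -> R) (s u : R) : 0 < s -> continuous G ->
  (forall x, 0 <= G x) -> mu.-integrable setT (EFin \o G) ->
  mu.-integrable setT (EFin \o (fun x => G (s * (x - u)))).
Proof.
move=> s0 cG G0 /integrableP[mG iG].
have cGs : continuous (fun x => G (s * (x - u))).
  move=> x; apply: continuous_comp; last exact: cG.
  have h : continuous (fun x : R => s * (x - u)) by cont.
  exact: h.
suff : mu.-integrable setT (EFin \o (fun x => s^-1 * (s * G (s * (x - u))))).
  by under [X in EFin \o X]eq_fun do rewrite mulKf ?gt_eqF//.
apply: integrableRZ => //; apply/integrableP; split.
  by apply/measurable_EFinP; apply: measurable_funM => //; exact: continuous_Rmeasurable.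
under eq_integral do rewrite /= ger0_norm ?mulr_ge0 ?(ltW s0)//.
rewrite integral_affine//; move: iG; congr (_ < _)%E.
by apply: eq_integral => x _; rewrite /= ger0_norm.
Qed.

Lemma Rintegral_affine (G : R -> R) (s u : R) : 0 < s -> continuous G ->
  (forall x, 0 <= G x) -> mu.-integrable setT (EFin \o G) ->
  \int[mu]_x (G (s * (x - u))) = s^-1 * \int[mu]_x G x.
Proof.
move=> s0 cG G0 iG; apply: (mulfI (lt0r_neq0 s0)); rewrite mulVKf ?gt_eqF//.
by rewrite -RintegralZl//; [congr fine; exact: integral_affine|exact: integrable_affine].
Qed.

Lemma integrable_lorentz : mu.-integrable setT (EFin \o lorentz).
Proof.
apply/integrableP; split.
  by apply/measurable_EFinP; apply: continuous_Rmeasurable; exact: continuous_lorentz.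
under eq_integral do rewrite /= gtr0_norm ?lorentz_gt0//.
by rewrite integral_lorentz ltry.
Qed.

Lemma Rintegral_lorentz : \int[mu]_x lorentz x = pi.
Proof. by rewrite /Rintegral integral_lorentz. Qed.

End lorentz_density.

Section fejer_kernel.
Context {R : realType}.
Notation mu := (@lebesgue_measure R).

(** The kernel 2 sin^2(My/2) / (M y^2); the value M/2 is its continuous extension to 0. With this
    normalisation it is the cosine transform of the triangle 1 - t/M on [0, M]. *)
Definition fejer (M y : R) : R :=
  if y == 0 then M / 2 else (1 - cos (M * y)) / (M * y ^+ 2).

Lemma fejer_integral M y : 0 < M ->
  \int[mu]_(t in `[0, M]) ((1 - t / M) * cos (t * y)) = fejer M y.
Proof.
move=> M0; have MN0 : M != 0 by rewrite gt_eqF.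
rewrite /fejer; case: eqP => [->|/eqP y0].
  rewrite (@Rintegral_FTC _ _ (fun t => t - t * t / (2 * M)))//.
  - by field.
  - exact: ltW.
  - move=> x; eexists; first by der.
    by rewrite /= !mulr0 cos0; field.
  - by cont.
rewrite (@Rintegral_FTC _ _
  (fun t => (1 - t / M) * sin (t * y) / y - cos (t * y) / (M * y ^+ 2)))//.
- by rewrite !mul0r sin0 cos0; field; rewrite y0.
- exact: ltW.
- move=> x; eexists; first by der.
  by rewrite /=; field; rewrite ?y0 ?MN0.
- by cont.
Qed.

Lemma fejer_scale M y : 0 < M -> fejer M y = M * fejer 1 (M * y).
Proof.
move=> M0; have MN0 : M != 0 by rewrite gt_eqF.
rewrite /fejer mulf_eq0 (negbTE MN0)/= !mul1r.
by have [//|y0] := eqVneq y 0; field; rewrite ?y0.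
Qed.

Lemma fejer_ge0 M y : 0 < M -> 0 <= fejer M y.
Proof.
move=> M0; rewrite /fejer; case: ifP => _; first by rewrite divr_ge0// ltW.
by rewrite divr_ge0 ?subr_ge0 ?cos_le1// mulr_ge0 ?sqr_ge0// ltW.
Qed.

Lemma fejer_far M y : 0 < M -> y != 0 -> fejer M y <= 2 / (M * y ^+ 2).
Proof.
move=> M0 y0; rewrite /fejer (negbTE y0) ler_wpM2r//.
  by rewrite invr_ge0 mulr_ge0 ?sqr_ge0// ltW.
by have := cos_geN1 (M * y); lra.
Qed.

Lemma fejer1_le1 y : fejer 1 y <= 1.
Proof.
rewrite -fejer_integral// (le_trans (ler_norm _))//.
rewrite (le_trans (@Rintegral_cc_le _ _ 0 1 1 _ _ _))// ?subr0 ?mulr1//.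
- by cont.
- move=> t /andP[t0 t1]; rewrite normrM divr1 -[leRHS]mul1r ler_pM ?cos_max//.
  by rewrite ger0_norm; lra.
Qed.

Lemma fejer1_le y : fejer 1 y <= 3 * lorentz y.
Proof.
apply: le_lorentz; rewrite mulrDl mul1r (natrD _ 1 2) lerD ?fejer1_le1//.
have [->|y0] := eqVneq y 0; first by rewrite expr0n mul0r.
rewrite mulrC -ler_pdivlMr ?exprn_even_gt0//.
by rewrite (le_trans (fejer_far _ y0))// mul1r.
Qed.

(** The integral representation treats the point 0 like any other: the integrand is continuous in
    [y] and dominated by 1. *)
Lemma continuous_fejer1 : continuous (fejer 1).
Proof.
move=> y; pose f z t : R := (1 - t / 1) * cos (t * z).
have -> : fejer 1 = fun z => \int[mu]_(t in `[0, 1]) f z t.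
  by apply/funext => z; rewrite fejer_integral.
apply: (@continuity_under_integral _ _ _ mu f `[0, 1] _ (y - 1) (y + 1) _ _ (cst 1)) => //.
- by move=> z _; apply: continuous_integrable_cc; rewrite /f; cont.
- by apply: aeW => t _ z _; move: z; rewrite /f; cont.
- by apply: continuous_integrable_cc => x; exact: cvg_cst.
- move=> z _; apply: aeW => t /=; rewrite in_itv/= => /andP[t0 t1].
  rewrite /f normrM divr1 -[leRHS]mul1r ler_pM ?cos_max//.
  by rewrite ger0_norm; lra.
- by rewrite inE/= in_itv/=; lra.
Qed.

Lemma integrable_fejer1 : mu.-integrable setT (EFin \o fejer 1).
Proof.
apply: (@integrable_le _ _ _ mu _ _ (fun y => 3 * lorentz y)) => //.
- by apply: continuous_Rmeasurable; exact: continuous_fejer1.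
- by apply: integrableRZ => //; exact: integrable_lorentz.
- by move=> y _; rewrite ger0_norm ?fejer_ge0// fejer1_le.
Qed.

Definition fejer_mass : R := \int[mu]_y fejer 1 y.

(** For t and y in [0, 1] the cosine of t y is at least [cos 1], and the triangle has mass 1/2.
    Being valid on a set of positive measure, the bound makes [fejer_mass] positive. *)
Lemma fejer1_ge y : 0 <= y <= 1 -> cos 1 / 2 <= fejer 1 y.
Proof.
move=> /andP[y0 y1]; rewrite -fejer_integral//.
apply: (@le_trans _ _ (\int[mu]_(t in `[0, 1]) ((1 - t) * cos 1))).
  rewrite (@Rintegral_FTC _ _ (fun t => (t - t * t / 2) * cos 1))//.
  - by lra.
  - move=> x; eexists; first by der.
    by rewrite /=; field.
  - by cont.
apply: le_Rintegral => //; try by apply: continuous_integrable_cc; cont.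
move=> t /=; rewrite in_itv/= => /andP[t0 t1]; rewrite divr1 ler_wpM2l//; first lra.
have h1pi : 1 <= pi :> R by rewrite (le_trans _ (pi_ge2 _))// ler1n.
have ty : 0 <= t * y <= 1.
  by rewrite mulr_ge0//= -[leRHS]mulr1 ler_pM.
move: ty => /andP[ty0 ty1]; move: ty1; rewrite le_eqVlt => /predU1P[->//|ty1].
by apply/ltW; rewrite ltr_cos// in_itv/= ?ler01 ?ty0//= (le_trans (ltW ty1)).
Qed.

Lemma fejer_mass_gt0 : 0 < fejer_mass.
Proof.
apply: (@lt_le_trans _ _ (cos 1 / 2)); first by rewrite divr_gt0// cos1_gt0.
apply: (@le_trans _ _ (\int[mu]_y (cos 1 / 2 * \1_(`[0, 1] : set R) y))).
  rewrite RintegralZl//; last exact: integrable_indic_itv.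
  have -> : \int[mu]_x \1_(`[0, 1] : set R) x = 1.
    by rewrite /Rintegral integral_indic//= ?setIT ?setTI lebesgue_measure_itv/= lte_fin ltr01/= subr0.
  by rewrite mulr1.
apply: le_Rintegral => //.
- by apply: integrableRZ => //; exact: integrable_indic_itv.
- exact: integrable_fejer1.
- move=> y _; rewrite indicE mem_setE; have [|_] := boolP (y \in `[0, 1]); last by rewrite mulr0 fejer_ge0.
  by rewrite in_itv/= mulr1; exact: fejer1_ge.
Qed.

Lemma integrable_fejer M u : 0 < M ->
  mu.-integrable setT (EFin \o (fun x => fejer M (x - u))).
Proof.
move=> M0; under [X in EFin \o X]eq_fun do rewrite fejer_scale//.
apply: integrableRZ => //; apply: (@integrable_affine _ (fejer 1)) => //.
- exact: continuous_fejer1.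
- by move=> x; exact: fejer_ge0.
- exact: integrable_fejer1.
Qed.

Lemma Rintegral_fejer M u : 0 < M -> \int[mu]_x fejer M (x - u) = fejer_mass.
Proof.
move=> M0; under eq_Rintegral do rewrite fejer_scale//.
rewrite RintegralZl//; last first.
  apply: (@integrable_affine _ (fejer 1)) => //.
  - exact: continuous_fejer1.
  - by move=> x; exact: fejer_ge0.
  - exact: integrable_fejer1.
rewrite (@Rintegral_affine _ (fejer 1))//.
- by rewrite mulVKf ?gt_eqF.
- exact: continuous_fejer1.
- by move=> x; exact: fejer_ge0.
- exact: integrable_fejer1.
Qed.

(** For |y| > r one has 2 y^2 >= r^2 + y^2, which turns the decay 2/(M y^2) into a rescaled
    [lorentz]. The majorant has total mass 4 pi/(M r), small when M r is large. *)
Lemma fejer_tail M r y : 0 < M -> 0 < r -> r < `|y| ->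
  fejer M y <= 4 / (M * r ^+ 2) * lorentz (r^-1 * y).
Proof.
move=> M0 r0 ry; have y0 : y != 0 by rewrite -normr_gt0 (lt_trans r0).
rewrite (le_trans (fejer_far M0 y0))// /lorentz.
have ryE : r ^+ 2 <= y ^+ 2.
  by rewrite -[leRHS]real_normK ?num_real// ler_sqr ?nnegrE ?(ltW r0) ?(ltW ry).
have y2 : 0 < y ^+ 2 by rewrite exprn_even_gt0.
have r2 : 0 < r ^+ 2 by rewrite exprn_gt0.
have MryE : M * r ^+ 2 <= M * y ^+ 2 by rewrite ler_pM2l.
have -> : 4 / (M * r ^+ 2) / (1 + (r^-1 * y) ^+ 2) = 4 / (M * (r ^+ 2 + y ^+ 2)).
  rewrite -mulrA -invfM; congr (_ / _); field; by rewrite gt_eqF.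
rewrite ler_pdivrMr; last by rewrite mulr_gt0.
rewrite mulrAC ler_pdivlMr; last by rewrite mulr_gt0// addr_gt0.
lra.
Qed.

Lemma integrable_lorentz_scale (r u : R) : 0 < r ->
  mu.-integrable setT (EFin \o (fun x => lorentz (r^-1 * (x - u)))).
Proof.
move=> r0; apply: (@integrable_affine _ lorentz); rewrite ?invr_gt0//.
- exact: continuous_lorentz.
- by move=> x; exact/ltW/lorentz_gt0.
- exact: integrable_lorentz.
Qed.

Lemma Rintegral_lorentz_scale (r u : R) : 0 < r ->
  \int[mu]_x lorentz (r^-1 * (x - u)) = r * pi.
Proof.
move=> r0; rewrite (@Rintegral_affine _ lorentz) ?invr_gt0// ?invrK ?Rintegral_lorentz//.
- exact: continuous_lorentz.
- by move=> x; exact/ltW/lorentz_gt0.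
- exact: integrable_lorentz.
Qed.

(* A function that is at least [c] on a window of half-width [r] has Fejer mean
   at least [c], up to the mass of the kernel outside of the window. *)
Lemma fejer_peak (M u r B c : R) (th : R -> R) : 0 < M -> 0 < r -> r <= u ->
  0 <= c -> measurable_fun (`[0, +oo[ : set R) th ->
  (forall x, 0 <= x -> `|th x| <= B) ->
  (forall x, u - r <= x <= u + r -> c <= th x) ->
  c * fejer_mass - (B + c) * (4 * pi / (M * r)) <=
  \int[mu]_(x in `[0, +oo[) (th x * fejer M (x - u)).
Proof.
move=> M0 r0 ru c0 mth thB thc.
have B0 : 0 <= B by rewrite (le_trans _ (thB 0 (lexx _))).
pose H x := 4 / (M * r ^+ 2) * lorentz (r^-1 * (x - u)).
have iH : mu.-integrable setT (EFin \o H).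
  by apply: integrableRZ => //; exact: integrable_lorentz_scale.
have ik := @integrable_fejer M u M0.
have H0 x : 0 <= H x.
  by rewrite mulr_ge0 ?(ltW (lorentz_gt0 _))// divr_ge0// mulr_ge0 ?exprn_ge0// ltW.
have -> : c * fejer_mass - (B + c) * (4 * pi / (M * r)) =
    \int[mu]_x (c * fejer M (x - u) - (B + c) * H x).
  rewrite RintegralB//; try exact: integrableRZ.
  rewrite !RintegralZl ?Rintegral_fejer//; last exact: integrable_lorentz_scale.
  rewrite Rintegral_lorentz_scale//; congr (_ - _ * _).
  by field; rewrite !gt_eqF.
rewrite [leRHS]Rintegral_mkcond; apply: le_Rintegral => //.
- by apply: integrableRB => //; exact: integrableRZ.
- rewrite -restrict_EFin; apply/(integrable_mkcond _ _).1 => //.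
  under [X in EFin \o X]eq_fun do rewrite mulrC.
  apply: (@integrable_mul_bounded _ _ _ mu _ _ _ B) => //.
    exact: integrableS ik.
  by move=> x /=; rewrite in_itv/= andbT; exact: thB.
- move=> x _; rewrite patchE mem_setE in_itv/= andbT; have -> : point = 0 :> R by [].
  have k0 := fejer_ge0 (x - u) M0.
  (* The window lies in [0, +oo[ because r <= u. Outside of it the function may drop from [c] to
     [-B], at a cost of [B + c] times the tail; left of 0 the restricted integrand vanishes. *)
  have [xur|xur] := leP `|x - u| r.
    have xin : u - r <= x <= u + r by move: xur; rewrite ler_norml; lra.
    rewrite ifT; last by move: xin; lra.
    have h1 := ler_wpM2r k0 (thc x xin).
    have h2 : 0 <= (B + c) * H x by rewrite mulr_ge0// addr_ge0.
    lra.
  have kH := fejer_tail M0 r0 xur; rewrite -/(H x) in kH.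
  case: ifPn => [x0|x0].
    have := thB x x0; rewrite ler_norml => /andP[thB' _].
    have h1 := ler_wpM2r k0 thB'.
    have h2 : (B + c) * fejer M (x - u) <= (B + c) * H x by rewrite ler_wpM2l// addr_ge0.
    lra.
  have h2 : c * fejer M (x - u) <= c * H x by rewrite ler_wpM2l.
  have h3 : 0 <= B * H x by rewrite mulr_ge0.
  lra.
Qed.

End fejer_kernel.

(** * The mirror kernel and its quadratic decay *)

Section mirror_kernel.
Context {R : realType}.
Notation mu := (@lebesgue_measure R).

Lemma normD_le (a b A B : R) : `|a| <= A -> `|b| <= B -> `|a + b| <= A + B.
Proof. by move=> aA bB; rewrite (le_trans (ler_normD _ _))// lerD. Qed.

Lemma normB_le (a b A B : R) : `|a| <= A -> `|b| <= B -> `|a - b| <= A + B.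
Proof. by move=> aA bB; rewrite (le_trans (ler_normB _ _))// lerD. Qed.

Lemma normM_le (a b A B : R) : `|a| <= A -> `|b| <= B -> `|a * b| <= A * B.
Proof. by move=> aA bB; rewrite normrM ler_pM. Qed.

Lemma normN_le (a A : R) : `|a| <= A -> `|- a| <= A.
Proof. by rewrite normrN. Qed.

Lemma normc_le (n : nat) : `|n%:R : R| <= n%:R.
Proof. by rewrite normr_nat. Qed.

Ltac norm_bound := repeat first
  [ eassumption | exact: normc_le | exact: cos_max | exact: sin_max
  | apply: normB_le | apply: normD_le | apply: normM_le | apply: normN_le ].

(** Two integrations by parts give y^2 I = O(1). The boundary terms that carry a factor y vanish: at
    M because both coefficients do, at 0 because [h2 0 = 0] and sin 0 = 0. The constant adds |I| <=
    2MB to |y^2 I| <= 3B + 2MB. *)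
Lemma oscillating_integral_le (h1 d1 e1 h2 d2 e2 : R -> R) (M B y : R) :
  0 < M -> (forall t, has_deriv h1 t (d1 t)) -> (forall t, has_deriv d1 t (e1 t)) ->
  (forall t, has_deriv h2 t (d2 t)) -> (forall t, has_deriv d2 t (e2 t)) ->
  continuous e1 -> continuous e2 -> h1 M = 0 -> h2 M = 0 -> h2 0 = 0 ->
  (forall t, 0 <= t <= M -> [/\ `|h1 t| <= B, `|d1 t| <= B & `|e1 t| <= B]) ->
  (forall t, 0 <= t <= M -> [/\ `|h2 t| <= B, `|d2 t| <= B & `|e2 t| <= B]) ->
  `|\int[mu]_(t in `[0, M]) (h1 t * cos (t * y) + h2 t * sin (t * y))| <=
  (4 * M * B + 3 * B) * lorentz y.
Proof.
move=> M0 hd1 hd1' hd2 hd2' ce1 ce2 h1M h2M h20 b1 b2.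
have ccos : continuous (fun t : R => cos (t * y)) by cont.
have csin : continuous (fun t : R => sin (t * y)) by cont.
have ch1 : continuous h1 by apply: is_derive_continuous => t; exists (d1 t).
have ch2 : continuous h2 by apply: is_derive_continuous => t; exists (d2 t).
have cf : continuous (fun t => h1 t * cos (t * y) + h2 t * sin (t * y)).
  by apply: continuousD_fun; exact: continuousM_fun.
have ce : continuous (fun t => e1 t * cos (t * y) + e2 t * sin (t * y)).
  by apply: continuousD_fun; exact: continuousM_fun.
set I := \int[mu]_(t in `[0, M]) _.
have I1 : `|I| <= 2 * M * B.
  rewrite [leRHS](_ : _ = (B * 1 + B * 1) * (M - 0)); last by ring.
  apply: Rintegral_cc_le => //; first exact: ltW.
  move=> t t0M; have [? _ _] := b1 t t0M; have [? _ _] := b2 t t0M.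
  by norm_bound.
(* Both integrations by parts at once: [P] is an antiderivative of y^2 times the integrand plus the
   same expression with the second derivatives [e1], [e2] as coefficients. *)
pose P t := y * h1 t * sin (t * y) + d1 t * cos (t * y) -
   y * h2 t * cos (t * y) + d2 t * sin (t * y).
pose J := \int[mu]_(t in `[0, M]) (e1 t * cos (t * y) + e2 t * sin (t * y)).
have J1 : `|J| <= 2 * M * B.
  rewrite [leRHS](_ : _ = (B * 1 + B * 1) * (M - 0)); last by ring.
  apply: Rintegral_cc_le => //; first exact: ltW.
  move=> t t0M; have [_ _ ?] := b1 t t0M; have [_ _ ?] := b2 t t0M.
  by norm_bound.
have IJ : y ^+ 2 * I + J = P M - P 0.
  rewrite /I /J -RintegralZl//; last exact: continuous_integrable_cc.
  rewrite -RintegralD//; [|apply: integrableRZ => //|]; try exact: continuous_integrable_cc.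
  apply: Rintegral_FTC; first exact: ltW.
    move=> t; eexists.
      rewrite /P; der; first [exact: hd1|exact: hd1'|exact: hd2|exact: hd2'].
    by rewrite /=; ring.
  apply: continuousD_fun ce; apply: continuousM_fun => //.
  by move=> t; exact: cvg_cst.
have PM : P M - P 0 = d1 M * cos (M * y) + d2 M * sin (M * y) - d1 0.
  by rewrite /P h1M h2M h20 !mul0r sin0 cos0; ring.
have M0M : 0 <= M <= M by rewrite lexx ltW.
have O0M : 0 <= (0 : R) <= M by rewrite lexx ltW.
have [_ ? _] := b1 _ M0M; have [_ ? _] := b2 _ M0M; have [_ ? _] := b1 _ O0M.
apply: le_lorentz; rewrite mulrDl mul1r.
have -> : y ^+ 2 * `|I| = `|y ^+ 2 * I| by rewrite normrM (ger0_norm (sqr_ge0 _)).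
have -> : y ^+ 2 * I = d1 M * cos (M * y) + d2 M * sin (M * y) - d1 0 - J.
  by rewrite -PM -IJ addrK.
have : `|d1 M * cos (M * y) + d2 M * sin (M * y) - d1 0 - J| <=
    B * 1 + B * 1 + B + 2 * M * B by norm_bound.
lra.
Qed.

(** The integrand is (1 - t/M) Re((s / conj s) e^{-ity}) with s = sigma + it. *)
Definition mirror (M sigma y : R) : R := \int[mu]_(t in `[0, M])
  ((1 - t / M) * ((sigma ^+ 2 - t ^+ 2) / (sigma ^+ 2 + t ^+ 2)) * cos (t * y) +
   (1 - t / M) * (2 * sigma * t / (sigma ^+ 2 + t ^+ 2)) * sin (t * y)).

(** The factor 4M + 3 comes from [oscillating_integral_le]. The other one dominates the two
    coefficients and their first two derivatives; the worst is [e2] in [mirror_le], at most 56 +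
    24/M. *)
Definition mirror_const (M : R) : R := (4 * M + 3) * (60 + 24 / M).

Lemma mirror_const_ge0 (M : R) : 0 < M -> 0 <= mirror_const M.
Proof.
move=> M0; rewrite /mirror_const mulr_ge0// addr_ge0//; first by rewrite mulr_ge0// ltW.
by rewrite divr_ge0// ltW.
Qed.

(** With r = 1/(sigma^2 + t^2), the quantities r, t r, sigma^2 r and t^2 r all lie in [0, 1], and r'
    = -2 t r^2. The coefficients and their derivatives are therefore polynomials in bounded
    quantities, uniformly in sigma. *)
Lemma mirror_le (M sigma y : R) : 0 < M -> 1 <= sigma <= 2 ->
  `|mirror M sigma y| <= mirror_const M * lorentz y.
Proof.
move=> M0 /andP[s1 s2]; have MN0 : M != 0 by rewrite gt_eqF.
have q0 t : 0 < sigma * sigma + t * t.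
  by rewrite ltr_pwDl ?mulr_gt0//; [lra|lra|rewrite -expr2 sqr_ge0].
have qN0 t : sigma * sigma + t * t != 0 by rewrite gt_eqF.
pose r (t : R) := (sigma * sigma + t * t)^-1.
pose a t := t * r t; pose p t := sigma * sigma * r t; pose z t := t * a t.
pose m := M^-1.
pose h1 t := (1 - t * m) * (2 * p t - 1).
pose d1 t := - (2 * p t - 1) * m + (1 - t * m) * (- (4 * p t * a t)).
pose e1 t := 8 * p t * a t * m + (1 - t * m) * (- (4 * p t * r t) + 16 * p t * z t * r t).
pose h2 t := (1 - t * m) * (2 * sigma * a t).
pose d2 t := - (2 * sigma * a t * m) + (1 - t * m) * (2 * sigma * (r t - 2 * z t * r t)).
pose e2 t := - (4 * sigma * m * (r t - 2 * z t * r t)) +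
  (1 - t * m) * (2 * sigma * (- (6 * a t * r t) + 8 * z t * a t * r t)).
have hr t : has_deriv r t (- (2 * t * r t * r t)).
  apply: derive_eq; eexists; first by rewrite /r; apply: deriveV_fun; [exact: qN0|der].
  by rewrite /= /r; field; rewrite qN0.
have cr : continuous r by apply: is_derive_continuous => t; eexists; exact: hr.
have key : (4 * M + 3) * (60 + 24 / M) = 4 * M * (60 + 24 / M) + 3 * (60 + 24 / M).
  by rewrite mulrDl.
rewrite /mirror_const key.
have -> : mirror M sigma y = \int[mu]_(t in `[0, M]) (h1 t * cos (t * y) + h2 t * sin (t * y)).
  apply: eq_Rintegral => t _; rewrite /h1 /h2 /a /p /m /r; congr (_ * _ * _ + _ * _ * _).
    by field; rewrite qN0.
  by field; rewrite qN0.
have bnd t : 0 <= t <= M -> [/\ `|1 - t * m| <= 1, `|r t| <= 1, `|a t| <= 1,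
    `|z t| <= 1 & `|2 * p t - 1| <= 1 /\ `|p t| <= 1].
  move=> /andP[t0 tM]; have tm : 0 <= t * m <= 1.
    by rewrite divr_ge0//= ?ler_pdivrMr ?mul1r// ltW.
  have tt : 0 <= t * t by rewrite mulr_ge0.
  have ss : 1 <= sigma * sigma by rewrite -[leLHS]mul1r ler_pM.
  have r0 : 0 < r t by rewrite invr_gt0.
  have E : sigma * sigma * r t + t * t * r t = 1 by rewrite -mulrDl divff.
  have p0 : 0 <= sigma * sigma * r t by rewrite mulr_ge0 ?ltW//; lra.
  have z0 : 0 <= t * t * r t by rewrite mulr_ge0// ltW.
  have r1 : r t <= 1 by rewrite invf_le1//; lra.
  have tr : t * r t <= 1.
    rewrite ler_pdivrMr// mul1r; have := sqr_ge0 (t - 1); rewrite expr2; lra.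
  have tr0 : 0 <= t * r t by rewrite mulr_ge0// ltW.
  split; rewrite /a /z /p ?mulrA.
  - by rewrite ger0_norm; lra.
  - by rewrite ger0_norm; lra.
  - by rewrite ger0_norm.
  - by rewrite ger0_norm; lra.
  - by split; rewrite ler_norml; lra.
have sn : `|sigma| <= 2 by rewrite ger0_norm; lra.
have m0 : 0 <= m by rewrite invr_ge0 ltW.
have mn : `|m| <= m by rewrite ger0_norm.
have loosen X B : (exists2 C, `|X| <= C & C <= B) -> `|X| <= B :> R.
  by case=> C; exact: le_trans.
have Em : 24 / M = 24 * m by [].
apply: (@oscillating_integral_le h1 d1 e1 h2 d2 e2 M (60 + 24 / M) y).
- exact: M0.
- move=> t; apply: derive_eq; eexists; first by rewrite /h1 /p; der; exact: hr.
  by rewrite /= /d1 /a /p; ring.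
- move=> t; apply: derive_eq; eexists; first by rewrite /d1 /a /p; der; exact: hr.
  by rewrite /= /e1 /z /a /p; ring.
- move=> t; apply: derive_eq; eexists; first by rewrite /h2 /a; der; exact: hr.
  by rewrite /= /d2 /z /a; ring.
- move=> t; apply: derive_eq; eexists; first by rewrite /d2 /z /a; der; exact: hr.
  by rewrite /= /e2 /z /a; ring.
- by apply: is_derive_continuous => t; eexists; rewrite /e1 /z /a /p; der; exact: hr.
- by apply: is_derive_continuous => t; eexists; rewrite /e2 /z /a /p; der; exact: hr.
- by rewrite /h1 /m divff// subrr mul0r.
- by rewrite /h2 /m divff// subrr mul0r.
- by rewrite /h2 /a; ring.
- move=> t /bnd[? ? ? ? [? ?]]; rewrite /h1 /d1 /e1 Em; split; apply: loosen; eexists;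
    by [norm_bound|lra].
- move=> t /bnd[? ? ? ? [? ?]]; rewrite /h2 /d2 /e2 Em; split; apply: loosen; eexists;
    by [norm_bound|lra].
Qed.

End mirror_kernel.

(** * Testing the real part of the transform *)

Section laplace_identity.
Context {R : realType}.
Notation mu := (@lebesgue_measure R).
Notation D := (`[0, +oo[%classic : set R).
Implicit Types (S : R -> R).

Definition damped S (sigma x : R) : R := S x * expR (- sigma * x).

Definition re_laplace S (sigma t : R) : R :=
  \int[mu]_(x in D) (damped S sigma x * (sigma * cos (t * x) + t * sin (t * x))).

Definition weight (M sigma u t : R) : R :=
  (1 - t / M) * ((sigma * cos (t * u) + t * sin (t * u)) / (sigma ^+ 2 + t ^+ 2)).

Lemma measurable_damped S sigma (A : set R) : measurable_fun setT S ->
  measurable_fun A (damped S sigma).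
Proof.
move=> mS; apply: measurable_funM; first exact: measurable_funTS.
by apply: continuous_Rmeasurable; cont.
Qed.

Lemma norm_trig_abs_le (sigma t y : R) : 0 <= sigma ->
  `|sigma * cos (t * y) + t * sin (t * y)| <= sigma + `|t|.
Proof.
move=> s0; rewrite -[X in _ <= X + _]mulr1 -[X in _ <= _ + X]mulr1.
by apply: normD_le; apply: normM_le; rewrite ?(ger0_norm s0) ?cos_max ?sin_max.
Qed.

Lemma norm_trig_le (sigma t y : R) : 0 <= sigma -> 0 <= t ->
  `|sigma * cos (t * y) + t * sin (t * y)| <= sigma + t.
Proof. by move=> s0 t0; have := @norm_trig_abs_le sigma t y s0; rewrite (ger0_norm t0). Qed.

Lemma sqrD_gt0 (sigma t : R) : 0 < sigma -> 0 < sigma ^+ 2 + t ^+ 2.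
Proof. by move=> s0; rewrite ltr_pwDl ?exprn_gt0 ?sqr_ge0. Qed.

Lemma weight_le (M sigma u t : R) : 0 < M -> 1 <= sigma -> 0 <= t <= M ->
  `|weight M sigma u t| <= 2.
Proof.
move=> M0 s1 /andP[t0 tM].
have q0 := @sqrD_gt0 sigma t (lt_le_trans ltr01 s1).
rewrite -[leRHS]mul1r; apply: normM_le.
  have : 0 <= t / M <= 1 by rewrite divr_ge0//= ?ler_pdivrMr ?mul1r// ltW.
  by rewrite ler_norml; lra.
rewrite normrM (gtr0_norm (_ : 0 < _^-1)) ?invr_gt0// ler_pdivrMr//.
rewrite (le_trans (norm_trig_le _ _ _))//; first lra.
have h1 : 2 * t <= 1 + t ^+ 2 by have := sqr_ge0 (t - 1); rewrite !expr2; lra.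
have h2 : sigma <= sigma ^+ 2 by rewrite expr2 ler_peMr//; lra.
have := sqr_ge0 t; have : 1 <= sigma ^+ 2 by rewrite expr_ge1//; lra.
lra.
Qed.

Lemma continuous_weight (M sigma u : R) : 0 < sigma ->
  continuous (weight M sigma u).
Proof.
move=> s0; apply: is_derive_continuous => t; eexists; rewrite /weight.
under eq_fun do rewrite !expr2.
der; apply: deriveV_fun; last by der.
by rewrite -!expr2 gt_eqF// sqrD_gt0.
Qed.

(** 2 Re F Re G = Re(F G) + Re(F conj G) for F = s e^{-itx} and G = conj(s) e^{itu}: the first
    product is |s|^2 e^{-it(x-u)}, the second s^2 e^{-it(x+u)}. *)
Lemma product_to_sum (sigma t x u : R) :
  2 * ((sigma * cos (t * x) + t * sin (t * x)) * (sigma * cos (t * u) + t * sin (t * u))) =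
  (sigma ^+ 2 + t ^+ 2) * cos (t * (x - u)) +
  ((sigma ^+ 2 - t ^+ 2) * cos (t * (x + u)) + 2 * sigma * t * sin (t * (x + u))).
Proof. by rewrite (mulrBr t x u) (mulrDr t x u) cosB cosD sinD; ring. Qed.

Lemma mirror_integrable (M sigma y : R) : 0 < sigma -> mu.-integrable `[0, M]
  (EFin \o (fun t => (1 - t / M) * ((sigma ^+ 2 - t ^+ 2) / (sigma ^+ 2 + t ^+ 2)) * cos (t * y) +
   (1 - t / M) * (2 * sigma * t / (sigma ^+ 2 + t ^+ 2)) * sin (t * y))).
Proof.
move=> s0; apply: continuous_integrable_cc; apply: is_derive_continuous => t; eexists.
under eq_fun do rewrite !expr2.
by der; (apply: deriveV_fun; [rewrite -!expr2 gt_eqF// sqrD_gt0|der]).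
Qed.

Lemma weight_integral (M sigma u x : R) : 0 < M -> 0 < sigma ->
  2 * \int[mu]_(t in `]0, M])
    ((sigma * cos (t * x) + t * sin (t * x)) * weight M sigma u t) =
  fejer M (x - u) + mirror M sigma (x + u).
Proof.
move=> M0 s0.
have cg : continuous (fun t : R => sigma * cos (t * x) + t * sin (t * x)) by cont.
have ig : mu.-integrable `[0, M] (EFin \o (fun t => (sigma * cos (t * x) + t * sin (t * x)) * weight M sigma u t)).
  apply: continuous_integrable_cc; apply: continuousM_fun cg _.
  exact: continuous_weight.
rewrite Rintegral_itv_obnd_cbnd; last first.
  by apply: integrableS ig => //; apply: subset_itvr; rewrite bnd_simp.
rewrite -RintegralZl// -fejer_integral// /mirror -RintegralD//; last 2 first.
- by apply: continuous_integrable_cc; cont.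
- exact: mirror_integrable.
apply: eq_Rintegral => t _; rewrite /weight.
have q0 := @sqrD_gt0 sigma t s0.
have -> : forall X Y : R, 2 * (X * ((1 - t / M) * (Y / (sigma ^+ 2 + t ^+ 2)))) =
  (1 - t / M) * ((2 * (X * Y)) / (sigma ^+ 2 + t ^+ 2)) by move=> X Y; ring.
rewrite product_to_sum; field; by rewrite !gt_eqF.
Qed.

Lemma measurable_trig_kernel (sigma : R) : measurable_fun setT
  (fun z : R * R => sigma * cos (z.1 * z.2) + z.1 * sin (z.1 * z.2)).
Proof.
have mf : measurable_fun setT (fun z : R * R => z.1 * z.2).
  by apply: measurable_funM; [exact: measurable_fst|exact: measurable_snd].
apply: measurable_funD; apply: measurable_funM => //.
- apply: (measurableT_comp _ mf).
  by apply: continuous_Rmeasurable; exact: continuous_cos.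
- apply: (measurableT_comp _ mf).
  by apply: continuous_Rmeasurable; exact: continuous_sin.
Qed.

Lemma measurable_laplace_kernel S (sigma : R) : measurable_fun setT S ->
  measurable_fun setT (fun z : R * R =>
    damped S sigma z.2 * (sigma * cos (z.1 * z.2) + z.1 * sin (z.1 * z.2))).
Proof.
move=> mS; apply: measurable_funM; last exact: measurable_trig_kernel.
apply: (measurableT_comp (f := damped S sigma)); last exact: measurable_snd.
exact: measurable_damped.
Qed.

Lemma integrable_oc (f : R -> R) (M : R) : continuous f ->
  mu.-integrable `]0, M] (EFin \o f).
Proof.
move=> cf; apply: integrableS (continuous_integrable_cc 0 M cf) => //.
by apply: subset_itvr; rewrite bnd_simp.
Qed.

(** Stated on a symmetric interval because condition (B.2) integrates over one; the positive half
    suffices for the testing argument. *)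
Lemma re_laplace_measurable S (sigma M : R) : measurable_fun setT S ->
  0 < sigma -> mu.-integrable D (EFin \o damped S sigma) ->
  measurable_fun `[- M, M] (re_laplace S sigma).
Proof.
move=> mS s0 iS.
apply: (@measurable_Rintegral_rectangle _ _ _ _ R mu mu `[- M, M] D
  (fun z => damped S sigma z.2 * (sigma * cos (z.1 * z.2) + z.1 * sin (z.1 * z.2)))
  (fun=> sigma + M) (fun x => `|damped S sigma x|)) => //.
- exact: measurable_laplace_kernel.
- by apply: continuous_integrable_cc => x; exact: cvg_cst.
- exact: integrable_norm.
- move=> t x; rewrite /= !in_itv/= andbT -ler_norml => tM x0.
  rewrite normrM mulrC ler_wpM2r// (le_trans (norm_trig_abs_le _ _ (ltW s0)))//.
  by rewrite lerD2l.
Qed.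

Lemma re_laplace_le S (sigma M t : R) : measurable_fun setT S ->
  0 < sigma -> mu.-integrable D (EFin \o damped S sigma) -> 0 < t <= M ->
  `|re_laplace S sigma t| <= (sigma + M) * \int[mu]_(x in D) `|damped S sigma x|.
Proof.
move=> mS s0 iS /andP[t0 tM]; rewrite -RintegralZl//; last exact: integrable_norm.
apply: normr_Rintegral_le => //.
- apply: measurable_funM; first exact: measurable_damped.
  by apply: continuous_Rmeasurable; cont.
- by apply: integrableRZ => //; exact: integrable_norm.
- move=> x _; rewrite normrM mulrC ler_wpM2r// (le_trans (norm_trig_le _ _ _))//; lra.
Qed.

Lemma re_laplace_integrable S (sigma M : R) : measurable_fun setT S ->
  0 < sigma -> 0 < M -> mu.-integrable D (EFin \o damped S sigma) ->
  mu.-integrable `]0, M] (EFin \o re_laplace S sigma).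
Proof.
move=> mS s0 M0 iS; apply: (@integrable_le _ _ _ mu _ _
  (fun=> (sigma + M) * \int[mu]_(x in D) `|damped S sigma x|)) => //.
- apply: measurable_funS (re_laplace_measurable (M := M) mS s0 iS) => //.
  by apply: subset_itvr; rewrite bnd_simp oppr_le0 ltW.
- by apply: integrable_oc => x; exact: cvg_cst.
- by move=> t; rewrite /= in_itv/=; exact: re_laplace_le.
Qed.

Lemma continuous_fejer (M u : R) : 0 < M -> continuous (fun x => fejer M (x - u)).
Proof.
move=> M0; rewrite (_ : (fun x => fejer M (x - u)) = fun x => M * fejer 1 (M * (x - u))).
  apply: continuousM_fun; first by move=> x; exact: cvg_cst.
  move=> x; apply: (@continuous_comp _ _ _ (fun x => M * (x - u)) (fejer 1));
    last exact: continuous_fejer1.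
  have h : continuous (fun x : R => M * (x - u)) by cont.
  exact: h.
by apply/funext => x; rewrite fejer_scale.
Qed.

Lemma fejer_leM (M y : R) : 0 < M -> `|fejer M y| <= M.
Proof.
move=> M0; rewrite ger0_norm ?fejer_ge0// fejer_scale// -[leRHS]mulr1.
by rewrite ler_wpM2l ?fejer1_le1// ltW.
Qed.

Lemma continuous_mirror (M sigma u : R) : 0 < M -> 1 <= sigma ->
  continuous (fun x => mirror M sigma (x + u)).
Proof.
move=> M0 s1 x; have s0 : 0 < sigma by lra.
apply: (@continuous_comp _ _ _ (fun x => x + u) (mirror M sigma)).
  have h : continuous (fun x : R => x + u) by cont.
  exact: h.
set y := x + u; pose f z t : R :=
  (1 - t / M) * ((sigma ^+ 2 - t ^+ 2) / (sigma ^+ 2 + t ^+ 2)) * cos (t * z) +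
   (1 - t / M) * (2 * sigma * t / (sigma ^+ 2 + t ^+ 2)) * sin (t * z).
apply: (@continuity_under_integral _ _ _ mu f `[0, M] _ (y - 1) (y + 1) _ _ (cst 2)) => //.
- by move=> z _; exact: mirror_integrable.
- by apply: aeW => t _ z _; move: z; rewrite /f; cont.
- by apply: continuous_integrable_cc => z; exact: cvg_cst.
- move=> z _; apply: aeW => t /=; rewrite in_itv/= => /andP[t0 tM].
  have q0 := @sqrD_gt0 sigma t s0.
  have tM1 : `|1 - t / M| <= 1.
    have : 0 <= t / M <= 1 by rewrite divr_ge0//= ?ler_pdivrMr ?mul1r// ltW.
    by rewrite ler_norml; lra.
  rewrite (_ : 2 = 1 * 1 * 1 + 1 * 1 * 1); last by ring.
  apply: normD_le; (apply: normM_le; [apply: normM_le => //|]); rewrite ?cos_max ?sin_max//.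
    rewrite normrM (gtr0_norm (_ : 0 < _^-1)) ?invr_gt0// ler_pdivrMr// mul1r.
    by rewrite ler_norml; have := sqr_ge0 t; have := sqr_ge0 sigma; lra.
  rewrite normrM (gtr0_norm (_ : 0 < _^-1)) ?invr_gt0// ler_pdivrMr// mul1r.
  rewrite ger0_norm; last by rewrite !mulr_ge0//; lra.
  by have := sqr_ge0 (sigma - t); rewrite !expr2; lra.
- by rewrite inE/= in_itv/=; lra.
Qed.

Lemma mirror_bounded (M sigma y : R) : 0 < M -> 1 <= sigma <= 2 ->
  `|mirror M sigma y| <= mirror_const M.
Proof.
move=> M0 s12; rewrite (le_trans (mirror_le _ _ _))// -[leRHS]mulr1.
by rewrite ler_wpM2l ?lorentz_le1 ?mirror_const_ge0.
Qed.

Lemma integrable_damped_fejer S (M sigma u : R) : 0 < M ->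
  mu.-integrable D (EFin \o damped S sigma) ->
  mu.-integrable D (EFin \o (fun x => damped S sigma x * fejer M (x - u))).
Proof.
move=> M0 iS; apply: (@integrable_mul_bounded _ _ _ mu _ _ _ M) => //.
- by apply: continuous_Rmeasurable; exact: continuous_fejer.
- by move=> x _; exact: fejer_leM.
Qed.

Lemma integrable_damped_mirror S (M sigma u : R) : 0 < M -> 1 <= sigma <= 2 ->
  mu.-integrable D (EFin \o damped S sigma) ->
  mu.-integrable D (EFin \o (fun x => damped S sigma x * mirror M sigma (x + u))).
Proof.
move=> M0 /[dup] s12 /andP[s1 _] iS.
apply: (@integrable_mul_bounded _ _ _ mu _ _ _ (mirror_const M)) => //.
- by apply: continuous_Rmeasurable; exact: continuous_mirror.
- by move=> x _; exact: mirror_bounded.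
Qed.

(* The key identity: testing the real part of the transform against [weight]
   produces a Fejer mean of [damped S sigma] at [u], plus a mirror term coming
   from the conjugate half of the real part. *)
Lemma re_laplace_weight S (M sigma u : R) : measurable_fun setT S ->
  0 < M -> 1 <= sigma <= 2 -> mu.-integrable D (EFin \o damped S sigma) ->
  2 * \int[mu]_(t in `]0, M]) (re_laplace S sigma t * weight M sigma u t) =
  \int[mu]_(x in D) (damped S sigma x * fejer M (x - u)) +
  \int[mu]_(x in D) (damped S sigma x * mirror M sigma (x + u)).
Proof.
move=> mS M0 /[dup] s12 /andP[s1 s2] iS; have s0 : 0 < sigma by lra.
have cg x : continuous (fun t : R => sigma * cos (t * x) + t * sin (t * x)) by cont.
pose F (z : R * R) := damped S sigma z.2 *
  (sigma * cos (z.1 * z.2) + z.1 * sin (z.1 * z.2)) * weight M sigma u z.1.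
have -> : \int[mu]_(t in `]0, M]) (re_laplace S sigma t * weight M sigma u t) =
    \int[mu]_(t in `]0, M]) \int[mu]_(x in D) F (t, x).
  apply: eq_Rintegral => t; rewrite inE/= in_itv/= => /andP[t0 tM].
  rewrite -RintegralZr//; apply: (@integrable_mul_bounded _ _ _ mu _ _ _ (sigma + t)) => //.
    by apply: continuous_Rmeasurable; cont.
  by move=> x _; apply: norm_trig_le; lra.
rewrite (@Rfubini_rectangle _ _ _ _ R mu mu `]0, M] D F
  (fun=> (sigma + M) * 2) (fun x => `|damped S sigma x|))//.
- have FE x : \int[mu]_(t in `]0, M]) F (t, x) =
      2^-1 * (damped S sigma x * fejer M (x - u) + damped S sigma x * mirror M sigma (x + u)).
    rewrite -mulrDr -weight_integral// mulrCA mulKf// -RintegralZl//.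
      by apply: eq_Rintegral => t _; rewrite /F/= mulrA.
    by apply: integrable_oc; apply: continuousM_fun => //; exact: continuous_weight.
  have i1 := @integrable_damped_fejer S M sigma u M0 iS.
  have i2 := @integrable_damped_mirror S M sigma u M0 s12 iS.
  under eq_Rintegral do rewrite FE.
  rewrite RintegralZl//; last exact: integrableRD.
  by rewrite mulrA divff// mul1r RintegralD.
- apply: measurable_funM; first exact: measurable_laplace_kernel.
  apply: (measurableT_comp (f := weight M sigma u)); last exact: measurable_fst.
  by apply: continuous_Rmeasurable; exact: continuous_weight.
- by apply: integrable_oc => x; exact: cvg_cst.
- exact: integrable_norm.
- move=> t x; rewrite /= !in_itv/= andbT => /andP[t0 tM] x0.
  rewrite /F/= -mulrA [leRHS]mulrC; apply: normM_le => //; apply: normM_le.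
    by rewrite (le_trans (norm_trig_le _ _ _))//; lra.
  by apply: weight_le => //; lra.
Qed.

(** For x, u >= 0 one has (x + u)^2 >= x^2 + u^2, so the kernel is at most [mirror_const M] times
    u^-2 lorentz(x/u), whose integral is pi/u. *)
Lemma mirror_mean_le S (M sigma u B : R) : measurable_fun setT S -> 0 < M -> 0 < u ->
  1 <= sigma <= 2 -> (forall x, 0 <= x -> `|damped S sigma x| <= B) ->
  `|\int[mu]_(x in D) (damped S sigma x * mirror M sigma (x + u))| <=
  B * (mirror_const M * pi / u).
Proof.
move=> mS M0 u0 /[dup] s12 /andP[s1 s2] SB.
have B0 : 0 <= B by rewrite (le_trans _ (SB 0 (lexx _))).
have C0 := mirror_const_ge0 M0.
have iL := @integrable_lorentz_scale _ u 0 u0.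
have E : B * (mirror_const M * pi / u) =
    \int[mu]_x (B * (mirror_const M * u ^- 2 ) * lorentz (u^-1 * (x - 0))).
  rewrite RintegralZl// Rintegral_lorentz_scale//; field; by rewrite gt_eqF.
rewrite E; apply: (@le_trans _ _ (\int[mu]_(x in D) (B * (mirror_const M * u ^- 2) * lorentz (u^-1 * (x - 0))))).
  apply: normr_Rintegral_le => //.
  - apply: measurable_funM; first exact: measurable_damped.
    by apply: continuous_Rmeasurable; exact: continuous_mirror.
  - by apply: integrableRZ => //; exact: integrableS iL.
  - move=> x; rewrite /= in_itv/= andbT => x0; rewrite -mulrA; apply: normM_le; first exact: SB.
    rewrite (le_trans (mirror_le _ _ _))// -mulrA ler_wpM2l// subr0 /lorentz -invfM.
    rewrite lef_pV2 ?posrE ?mulr_gt0 ?exprn_gt0// ?ltr_pwDl ?sqr_ge0//.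
    rewrite mulrDr mulr1 exprMn mulrA exprVn divff ?mul1r ?expf_neq0 ?gt_eqF//.
    have : 0 <= x * u by rewrite mulr_ge0// ltW.
    by rewrite !expr2; lra.
rewrite Rintegral_mkcond; apply: le_Rintegral => //.
- rewrite -restrict_EFin; apply/(integrable_mkcond _ _).1 => //.
  by apply: integrableRZ => //; exact: integrableS iL.
- exact: integrableRZ.
- move=> x _; rewrite patchE; case: ifPn => // _; have -> : point = 0 :> R by [].
  by rewrite mulr_ge0 ?(ltW (lorentz_gt0 _))// mulr_ge0// divr_ge0// sqr_ge0.
Qed.

End laplace_identity.

Section exponential_decay.
Context {R : realType}.
Notation mu := (@lebesgue_measure R).
Notation D := (`[0, +oo[%classic : set R).

Lemma integral_expR_decay (d : R) : 0 < d ->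
  (\int[mu]_(x in D) (expR (- d * x))%:E = (d^-1)%:E)%E.
Proof.
move=> d0; pose F x : R := - d^-1 * expR (- d * x).
have dF (x : R) : has_deriv F x (expR (- d * x)).
  apply: derive_eq; eexists; first by rewrite /F; der.
  by rewrite /=; field; rewrite gt_eqF.
have cF : continuous F by apply: is_derive_continuous => x; eexists; exact: dF.
have -> : (d^-1)%:E = (0%:E - (F 0)%:E)%E :> \bar R.
  by rewrite -EFinB /F mulr0 expR0 mulr1 sub0r opprK.
apply: ge0_continuous_FTC2y.
- by move=> x _; exact: expR_ge0.
- by apply: continuous_subspaceT; cont.
- rewrite /F -[X in _ --> X](mulr0 (- d^-1)); apply: cvgM; first exact: cvg_cst.
  have h : expR (- y) @[y --> +oo] --> (0 : R) by exact: cvgr_expR.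
  rewrite (_ : (fun x => expR (- d * x)) = (fun y => expR (- y)) \o (fun x => d * x)).
    apply: (cvg_comp _ _ _ h); apply/cvgryPge => A; near=> x.
    by rewrite -ler_pdivrMl.
  by apply/funext => x /=; rewrite mulNr.
- by move=> x _; have [] := dF x.
- exact/cvg_at_right_filter/cF.
- by move=> x _; rewrite derive1E; have [_ ->] := dF x.
Unshelve. all: by end_near. Qed.

Lemma integrable_expR_decay (d : R) : 0 < d ->
  mu.-integrable D (EFin \o (fun x => expR (- d * x))).
Proof.
move=> d0; apply/integrableP; split.
  by apply/measurable_EFinP; apply: continuous_Rmeasurable; cont.
under eq_integral do rewrite /= ger0_norm ?expR_ge0//.
by rewrite integral_expR_decay// ltry.
Qed.

Lemma Rintegral_expR_decay (d : R) : 0 < d ->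
  \int[mu]_(x in D) expR (- d * x) = d^-1.
Proof. by move=> d0; rewrite /Rintegral integral_expR_decay. Qed.

End exponential_decay.

(** * A priori bounds on the damped function *)

Section boundedness.
Context {R : realType}.
Notation mu := (@lebesgue_measure R).
Notation D := (`[0, +oo[%classic : set R).
Variable S : R -> R.
Hypothesis mS : measurable_fun setT S.
Hypothesis S_exp : forall sigma, 1 < sigma ->
  exists C, forall x, 0 <= x -> `|S x| <= C * expR (sigma * x).
Hypothesis S_slow : log_linearly_slowly_decreasing S.

Lemma integrable_damped sigma : 1 < sigma ->
  mu.-integrable D (EFin \o damped S sigma).
Proof.
(* Growth at the midpoint of 1 and sigma leaves a decay rate (sigma - 1)/2 after damping. *)
move=> s1; have [C SC] := @S_exp ((1 + sigma) / 2) ltac:(lra).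
have d0 : 0 < (sigma - 1) / 2 by lra.
apply: (@integrable_le _ _ _ mu _ _ (fun x => C * expR (- ((sigma - 1) / 2) * x))) => //.
- exact: measurable_damped.
- by apply: integrableRZ => //; exact: integrable_expR_decay.
- move=> x; rewrite /= in_itv/= andbT => x0.
  rewrite normrM (ger0_norm (expR_ge0 _)).
  rewrite (le_trans (ler_wpM2r (expR_ge0 _) (SC x x0)))// -[C * _ * _]mulrA -expRD.
  by rewrite le_eqVlt; apply/orP; left; apply/eqP; congr (_ * expR _); field.
Qed.

Lemma damped_bounded sigma : 1 < sigma ->
  exists C, forall x, 0 <= x -> `|damped S sigma x| <= C.
Proof.
move=> s1; have [C SC] := S_exp s1; exists C => x x0.
rewrite normrM (ger0_norm (expR_ge0 _)).
rewrite (le_trans (ler_wpM2r (expR_ge0 _) (SC x x0)))// -mulrA -expRD.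
by rewrite mulNr subrr expR0 mulr1.
Qed.

(** Uniformity in sigma is the point: on a compact set the damped function costs a constant that
    does not deteriorate as sigma tends to 1. *)
Lemma damped_bounded_below_at (X : R) : exists C, 0 <= C /\
  forall sigma x, 0 <= sigma -> 0 <= x <= X -> `|damped S sigma x| <= C.
Proof.
have [C SC] := @S_exp 2 ltac:(lra).
have C0 : 0 <= C by have := SC 0 (lexx _); rewrite mulr0 expR0 mulr1; apply: le_trans.
exists (C * expR (2 * X)); split => [|sigma x s0 /andP[x0 xX]].
  by rewrite mulr_ge0 ?expR_ge0.
rewrite -[leRHS]mulr1; apply: normM_le.
  rewrite (le_trans (SC x x0))// ler_wpM2l// ler_expR; lra.
rewrite ger0_norm ?expR_ge0// -expR0 ler_expR mulNr oppr_le0 mulr_ge0//.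
Qed.

(** Slow decrease multiplied by e^{-sigma y}; since e^x <= e^{sigma x} for x >= 0, the window and
    the threshold do not depend on sigma. *)
Lemma damped_slow (eps : R) : 0 < eps -> exists h x0, [/\ 0 < h, 0 < x0 &
  forall sigma x y, 1 <= sigma -> x0 <= x -> x <= y -> y <= x + h ->
    expR (- sigma * (y - x)) * (damped S sigma x - eps) <= damped S sigma y].
Proof.
move=> e0; have [h [x0 [h0 x00 hS]]] := S_slow e0; exists h, x0; split=> // sigma x y s1 xx xy yh.
have := hS x y xx xy yh; rewrite ler_pdivlMr ?expR_gt0// => H.
have E : expR (- sigma * (y - x)) = expR (- sigma * y) * expR (sigma * x).
  by rewrite -expRD; congr expR; ring.
have E1 : expR (sigma * x) * expR (- sigma * x) = 1.
  by rewrite -expRD -expR0; congr expR; ring.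
rewrite E /damped [leRHS]mulrC -mulrA ler_wpM2l ?expR_ge0//.
rewrite mulrBr mulrCA E1 mulr1.
have : expR x <= expR (sigma * x) by rewrite ler_expR ler_peMl//; lra.
have := ler_wpM2l (ltW e0); move=> /(_ (expR x) (expR (sigma * x))) h1 /h1.
lra.
Qed.

Lemma weighted_re_laplace_le (M sigma u : R) : 0 < M -> 1 < sigma <= 2 ->
  `|\int[mu]_(t in `]0, M]) (re_laplace S sigma t * weight M sigma u t)| <=
  2 * \int[mu]_(t in `]0, M]) `|re_laplace S sigma t|.
Proof.
move=> M0 /andP[s1 s2]; have s0 : 0 < sigma by lra.
have iU := re_laplace_integrable mS s0 M0 (integrable_damped s1).
rewrite -RintegralZl//; last exact: integrable_norm.
apply: normr_Rintegral_le => //.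
- apply: measurable_funM; first exact: integrable_measurable iU.
  by apply: continuous_Rmeasurable; exact: continuous_weight.
- by apply: integrableRZ => //; exact: integrable_norm.
- move=> t; rewrite /= in_itv/= => /andP[t0 tM]; rewrite normrM mulrC ler_wpM2r//.
  by apply: weight_le => //; lra.
Qed.

Lemma fejer_mean_le (M sigma u B : R) : 0 < M -> 1 < sigma <= 2 -> 0 < u ->
  (forall x, 0 <= x -> `|damped S sigma x| <= B) ->
  `|\int[mu]_(x in D) (damped S sigma x * fejer M (x - u))| <=
  4 * \int[mu]_(t in `]0, M]) `|re_laplace S sigma t| + B * (mirror_const M * pi / u).
Proof.
move=> M0 /[dup] s12 /andP[s1 s2] u0 SB.
have s12' : 1 <= sigma <= 2 by lra.
have h1 := weighted_re_laplace_le u M0 s12.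
have h2 := mirror_mean_le mS M0 u0 s12' SB.
have E := re_laplace_weight u mS M0 s12' (integrable_damped s1).
move: E h1 h2; set X := \int[mu]_(t in _) (_ * _); set Y := \int[mu]_(x in _) (_ * fejer _ _).
set Z := \int[mu]_(x in _) (_ * mirror _ _ _) => E h1 h2.
have -> : Y = 2 * X - Z by rewrite E addrK.
rewrite (le_trans (ler_normB _ _))// lerD// normrM ger0_norm//.
have -> : 4 = 2 * 2 :> R by ring.
by rewrite -mulrA ler_wpM2l.
Qed.

(** A positive near-maximum persists to its right: over a distance at most 1/50 and with sigma <= 2
    the exponential factor is at least 24/25. *)
Lemma decay_lower (sigma d r a m : R) : 0 < sigma <= 2 -> 0 <= d <= 2 * r ->
  r <= 1 / 100 -> 4 < m -> m - m / 10 < a ->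
  4 / 5 * m - 1 <= expR (- sigma * d) * (a - 1).
Proof.
move=> /andP[s0 s2] /andP[d0 dr] r1 m4 ma.
have hz : sigma * d <= 2 * (2 * r) by rewrite ler_pM// ltW.
have e1 : 24 / 25 <= expR (- sigma * d).
  by rewrite (le_trans _ (expR_ge1Dx _))//; lra.
apply: (@le_trans _ _ (24 / 25 * (a - 1))); first lra.
by rewrite ler_wpM2r//; lra.
Qed.

(** A deep negative value [b] forces the values to its left to be negative as well: [a - 1] cannot
    be nonnegative, and for a negative number the factor [e <= 1] only helps. *)
Lemma decay_upper (e a b m : R) : 0 < e <= 1 -> 4 < m -> m - m / 10 < - b ->
  e * (a - 1) <= b -> 4 / 5 * m - 1 <= - a.
Proof.
move=> /andP[e0 e1] m4 mb eab; have [h1|h1] := leP 0 (a - 1).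
  have : 0 <= e * (a - 1) by rewrite mulr_ge0// ltW.
  lra.
have : 0 <= (1 - e) * (1 - a) by rewrite mulr_ge0//; lra.
lra.
Qed.

(* The means of [damped S sigma] against a sufficiently concentrated Fejer
   kernel at a near-maximum of its modulus are comparable with that maximum,
   because slow decrease propagates the extremal value to one side. *)
Lemma damped_le_re_laplace : exists M C, [/\ 0 < M, 0 <= C &
  forall sigma x, 1 < sigma <= 2 -> 0 <= x -> `|damped S sigma x| <=
    C * (1 + \int[mu]_(t in `]0, M]) `|re_laplace S sigma t|)].
Proof.
have [h [x0 [h0 x00 slow]]] := damped_slow ltr01.
pose N := @fejer_mass R; have N0 : 0 < N := fejer_mass_gt0.
(* A window of length 2r fits in the range [h] of slow decrease, and r <= 1/100 is what
   [decay_lower] asks for. *)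
pose r := Num.min (h / 2) (1 / 100).
have r0 : 0 < r by rewrite lt_min divr_gt0//=; lra.
have rh : 2 * r <= h.
  have : r <= h / 2 by rewrite ge_min lexx.
  lra.
have r1 : r <= 1 / 100 by rewrite ge_min lexx orbT.
(* Makes the kernel mass 4 pi/(M r) outside the window equal to N/20. *)
pose M : R := 80 * pi / (N * r).
have pi0 : 0 < pi :> R := pi_gt0 R.
have M0 : 0 < M by rewrite divr_gt0 ?mulr_gt0.
have tail : 4 * pi / (M * r) = N / 20.
  have tailp (p : R) : 0 < p -> 4 * p / (80 * p / (N * r) * r) = N / 20.
    by move=> p0; field; rewrite !gt_eqF.
  exact: tailp.
pose K := mirror_const M.
have K0 : 0 <= K := mirror_const_ge0 M0.
have NE : fejer_mass = N by []; have KE : mirror_const M = K by [].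
clearbody K; clearbody M; clearbody N; clearbody r.
(* Beyond [u1] the mirror term costs at most m N/10. *)
pose u1 := 1 + 10 * K * pi / N.
have u10 : 0 < u1.
  by rewrite ltr_pwDl// divr_ge0 ?(ltW N0)// mulr_ge0 ?(ltW pi0)// mulr_ge0.
have mirr u : u1 <= u -> K * pi / u <= N / 10.
  move=> uu; rewrite ler_pdivrMr; last by lra.
  have : N / 10 * u1 <= N / 10 * u by rewrite ler_wpM2l//; lra.
  have -> : N / 10 * u1 = N / 10 + K * pi by rewrite /u1; field; rewrite gt_eqF.
  lra.
pose x1 := x0 + u1 + 1.
have [C1 [C10 SC1]] := damped_bounded_below_at x1.
exists M, (6 + 2 * C1 + 8 / N); split => //.
  by rewrite addr_ge0 ?divr_ge0// ?ltW//; lra.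
move=> sigma x /[dup] s12 /andP[s1 s2] xge0.
set J := \int[mu]_(t in _) _.
have J0 : 0 <= J by apply: Rintegral_ge0.
pose E := [set `|damped S sigma y| | y in D].
have [B SB] := damped_bounded s1.
have supE : has_sup E.
  split; first by exists `|damped S sigma 0|, 0; rewrite //= in_itv/= lexx.
  by exists B => z [y]; rewrite /= in_itv/= andbT => y0 <-; exact: SB.
pose m := sup E.
have Sm y : 0 <= y -> `|damped S sigma y| <= m.
  by move=> y0; apply: ub_le_sup; [by case: supE|exists y; rewrite //= in_itv/= y0].
rewrite (le_trans (Sm x xge0))//.
have N8 : 0 <= 8 / N by rewrite divr_ge0 ?ltW.
have NJ : 0 <= 8 / N * J by rewrite mulr_ge0.
have CJ : 0 <= C1 * J by rewrite mulr_ge0.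
have [m4|m4] := leP m 4.
  by lra.
have [v [y yD <-]] := @sup_adherent _ E (m / 10) ltac:(lra) supE.
rewrite -/m => ym; move: yD; rewrite /= in_itv/= andbT => y0.
have m0 : 0 <= m by lra.
have m1 : 0 <= 4 / 5 * m - 1 by lra.
have JE : J = \int[mu]_(t in `]0, M]) `|re_laplace S sigma t| by [].
clear supE; clearbody m; clear E; clearbody J.
have [yx1|yx1] := leP y x1.
  have s0 : 0 <= sigma by exact/ltW/(lt_trans _ s1).
  have yx : 0 <= y <= x1 by rewrite y0.
  have := SC1 sigma y s0 yx; move: ym NJ CJ N8 J0 C10.
  by move: (`|_|) (8 / N) => *; lra.
(* The peak estimate against the upper bound for the mean: m N keeps the coefficient 4/5 - 9/100 -
   1/10 = 61/100, from the window, the tail N/20 and the mirror term. This exceeds 1/2, whence m N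
   <= 2 N + 8 J. *)
have concl u (th : R -> R) : u1 <= u -> r <= u -> measurable_fun D th ->
    (forall z, 0 <= z -> `|th z| <= m) ->
    (forall z, u - r <= z <= u + r -> 4 / 5 * m - 1 <= th z) ->
    `|\int[mu]_(z in D) (th z * fejer M (z - u))| <= 4 * J + m * (K * pi / u) ->
    m <= (6 + 2 * C1 + 8 / N) * (1 + J).
  move=> uu ru mth thm thc Ile.
  have := fejer_peak M0 r0 ru m1 mth thm thc; rewrite tail NE => lo.
  have up := le_trans (ler_norm _) Ile.
  have hm : m * (K * pi / u) <= m * (N / 10) by rewrite ler_wpM2l ?mirr.
  have mN : m * N <= 2 * N + 8 * J.
    move: N0 J0 lo up hm; clear; set I := \int[mu]_(z in _) _; set T := K * pi / u.
    by clearbody I T; lra.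
  have : m <= 2 + 8 / N * J.
    rewrite -(ler_pM2r N0) mulrDl; have -> : 8 / N * J * N = 8 * J by field; rewrite gt_eqF.
    by [].
  lra.
have uy : x0 <= y /\ u1 <= y by split; move: yx1 x00 u10; rewrite /x1; clear; lra.
have uyr : r <= y - r /\ u1 <= y - r.
  by split; move: yx1 x00 u10 r1; rewrite /x1; clear; lra.
(* Slow decrease carries large positive values to the right and large negative values to the left,
   so the window is centred at y + r or y - r accordingly. *)
have [pos|neg] := leP 0 (damped S sigma y).
  rewrite ger0_norm// in ym.
  apply: (concl (y + r) (damped S sigma)) => //.
  - by rewrite ler_wpDr ?(ltW r0)//; exact: uy.2.
  - by rewrite lerDr.
  - exact: measurable_damped.
  - move=> z /andP[z1 z2].
    have yz : y <= z by move: z1; clear; lra.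
    have zd : z - y <= 2 * r by move: z2; clear; lra.
    have zh : z <= y + h by move: zd rh; clear; lra.
    apply: le_trans (slow sigma y z (ltW s1) uy.1 yz zh).
    by apply: (decay_lower (r := r)) => //; rewrite ?subr_ge0 ?yz// s2 (lt_trans _ s1).
  - rewrite -KE JE; apply: fejer_mean_le => //.
    by rewrite addr_gt0//; exact: lt_le_trans uy.1.
rewrite ltr0_norm// in ym.
apply: (concl (y - r) (fun z => - damped S sigma z)) => //.
- exact: uyr.2.
- exact: uyr.1.
- by apply: measurableT_comp => //; exact: measurable_damped.
- by move=> z z0; rewrite normrN; exact: Sm.
- move=> z /andP[z1 z2].
  have zy : z <= y by move: z2; clear; lra.
  have zh : y <= z + h by move: z1 rh; clear; lra.
  have xz : x0 <= z by move: z1 yx1 r1 u10; rewrite /x1; clear; lra.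
  apply: decay_upper (slow sigma z y (ltW s1) xz zy zh) => //.
  rewrite expR_gt0 -expR0 ler_expR mulNr oppr_le0 mulr_ge0 ?subr_ge0//.
  exact/ltW/(lt_trans _ s1).
- under eq_Rintegral do rewrite mulNr.
  rewrite (_ : \int[mu]_(z in D) - _ = - \int[mu]_(z in D) (damped S sigma z * fejer M (z - (y - r)))).
    rewrite normrN -KE JE; apply: fejer_mean_le => //.
    exact: lt_le_trans uyr.1.
  under eq_Rintegral do rewrite -mulN1r.
  by rewrite RintegralZl ?mulN1r//; apply: integrable_damped_fejer => //; exact: integrable_damped.
Qed.

(** Splits the mean at [X], where lorentz x <= 2 X^-2 lorentz(x/X) takes over. The global bound [B],
    which may grow as sigma tends to 1, is multiplied only by 2 pi/X, and the bound [CX] on the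
    compact part can be chosen free of sigma. *)
Lemma damped_mean_split (X CX B CL sigma : R) (k : R -> R) :
  0 < X -> 0 <= CL -> 0 <= CX -> 0 <= B -> continuous k ->
  (forall x, `|k x| <= CL * lorentz x) ->
  (forall x, 0 <= x <= X -> `|damped S sigma x| <= CX) ->
  (forall x, 0 <= x -> `|damped S sigma x| <= B) ->
  `|\int[mu]_(x in D) (damped S sigma x * k x)| <= CL * (CX * pi + B * (2 * pi / X)).
Proof.
move=> X0 CL0 CX0 B0 ck kL SX SB.
pose G x : R := CL * CX * lorentz x + CL * B * (2 * X ^- 2) * lorentz (X^-1 * (x - 0)).
have i1 := @integrable_lorentz R; have i2 := @integrable_lorentz_scale R X 0 X0.
have c2 : 0 <= 2 * X ^- 2 by rewrite divr_ge0// sqr_ge0.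
have iG : mu.-integrable setT (EFin \o G).
  by apply: integrableRD => //; exact: integrableRZ.
have -> : CL * (CX * pi + B * (2 * pi / X)) = \int[mu]_x G x.
  rewrite RintegralD//; try exact: integrableRZ.
  rewrite !RintegralZl// Rintegral_lorentz Rintegral_lorentz_scale//.
  have E (p : R) : CL * (CX * p + B * (2 * p / X)) = CL * CX * p + CL * B * (2 / X ^+ 2) * (X * p).
    by field; rewrite gt_eqF.
  exact: E.
apply: (@le_trans _ _ (\int[mu]_(x in D) G x)); last first.
  apply: Rintegral_subset_le => // x.
  by rewrite addr_ge0// mulr_ge0// ?(ltW (lorentz_gt0 _))// mulr_ge0// mulr_ge0.
apply: normr_Rintegral_le => //.
- by apply: measurable_funM; [exact: measurable_damped|exact: continuous_Rmeasurable].
- by apply: integrableS iG.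
move=> x; rewrite /= in_itv/= andbT => x0; rewrite normrM /G subr0.
have L0 := lorentz_gt0 x; have L0' := lorentz_gt0 (X^-1 * x).
have [xX|Xx] := leP x X.
  have h1 : `|damped S sigma x| * `|k x| <= CX * (CL * lorentz x).
    by rewrite ler_pM// SX// x0.
  have : 0 <= CL * B * (2 * X ^- 2) * lorentz (X^-1 * x).
    by rewrite mulr_ge0 ?(ltW L0')// mulr_ge0// mulr_ge0.
  lra.
have h1 : `|damped S sigma x| * `|k x| <= B * (CL * lorentz x) by rewrite ler_pM// SB.
have h2 : lorentz x <= 2 * X ^- 2 * lorentz (X^-1 * x).
  rewrite /lorentz -mulrA -invfM ler_pdivlMr; last first.
    by rewrite mulr_gt0 ?exprn_gt0// ltr_pwDl// sqr_ge0.
  rewrite mulrC ler_pdivrMr; last by rewrite ltr_pwDl// sqr_ge0.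
  rewrite mulrDr mulr1 exprMn mulrA exprVn divff ?mul1r ?expf_neq0 ?gt_eqF//.
  have : X ^+ 2 <= x ^+ 2 by rewrite ler_sqr ?nnegrE ?(ltW X0)// ltW.
  lra.
have h3 : B * (CL * lorentz x) <= B * (CL * (2 * X ^- 2 * lorentz (X^-1 * x))).
  by rewrite ler_wpM2l// ler_wpM2l.
have : 0 <= CL * CX * lorentz x by rewrite mulr_ge0 ?(ltW L0)// mulr_ge0.
lra.
Qed.

Lemma fejer_le_lorentz (M y : R) : 0 < M -> fejer M y <= (M + 2 / M) * lorentz y.
Proof.
move=> M0; apply: le_lorentz; rewrite mulrDl mul1r lerD//.
  by rewrite (le_trans (ler_norm _))// fejer_leM.
have [->|y0] := eqVneq y 0; first by rewrite expr0n mul0r divr_ge0// ltW.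
rewrite mulrC -ler_pdivlMr ?exprn_even_gt0//.
by rewrite (le_trans (fejer_far M0 y0))// -mulrA -invfM.
Qed.

(** At u = 0 the weight is (1 - t/M) sigma/(sigma^2 + t^2), without oscillation; on ]0, b] the two
    factors are at least 1/2 and 1/(4 + b^2). This positivity is why the identity is tested at u =
    0. *)
Lemma weight0_ge (M b sigma t : R) : 0 < M -> 0 < b -> b <= M / 2 -> 1 < sigma <= 2 ->
  0 < t <= b -> (2 * (4 + b ^+ 2))^-1 <= weight M sigma 0 t <= 2.
Proof.
move=> M0 b0 bM /andP[s1 s2] /andP[t0 tb]; apply/andP; split; last first.
  rewrite (le_trans (ler_norm _))//; apply: weight_le; lra.
rewrite /weight !mulr0 cos0 sin0 mulr0 addr0 mulr1 invfM.
have q0 := @sqrD_gt0 R sigma t ltac:(lra).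
apply: ler_pM; rewrite ?invr_ge0//.
- by rewrite addr_ge0// sqr_ge0.
- have : t / M <= 1 / 2 by rewrite ler_pdivrMr//; lra.
  lra.
- rewrite ler_pdivlMr// mulrC ler_pdivrMr; last by rewrite ltr_pwDl ?sqr_ge0.
  have h1 : sigma ^+ 2 <= 2 ^+ 2 by rewrite ler_sqr ?nnegrE; lra.
  have h2 : t ^+ 2 <= b ^+ 2 by rewrite ler_sqr ?nnegrE; lra.
  have h3 : 4 + b ^+ 2 <= sigma * (4 + b ^+ 2).
    by rewrite ler_peMl//; [rewrite addr_ge0// sqr_ge0|lra].
  move: h1; rewrite expr2; lra.
Qed.

(* A lower bound for the real part near the singular point turns into an [L1]
   bound: by the key identity at [u = 0], the total mass is controlled by the
   values of [S] on a compact set plus a small multiple of the mass itself. *)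
Lemma re_laplace_L1_near (M b C : R) (g : R -> R) : 0 < M -> 0 < b -> b <= M / 2 ->
  0 <= C -> mu.-integrable `]0, b] (EFin \o g) ->
  (forall sigma, 1 < sigma <= 2 ->
     {ae mu, forall t, `]0, b]%classic t -> g t <= re_laplace S sigma t}) ->
  (forall sigma x, 1 < sigma <= 2 -> 0 <= x -> `|damped S sigma x| <=
     C * (1 + \int[mu]_(t in `]0, M]) `|re_laplace S sigma t|)) ->
  exists C', forall sigma, 1 < sigma <= 2 ->
    \int[mu]_(t in `]0, M]) `|re_laplace S sigma t| <=
    C' * (1 + \int[mu]_(t in `]b, M]) `|re_laplace S sigma t|).
Proof.
move=> M0 b0 bM C0 ig Ug SC.
pose k : R := (2 * (4 + b ^+ 2))^-1.
have k0 : 0 < k by rewrite invr_gt0 mulr_gt0// ltr_pwDl// sqr_ge0.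
pose CL : R := M + 2 / M + mirror_const M.
have M2 : 0 <= 2 / M by rewrite divr_ge0// ltW.
have mc0 := mirror_const_ge0 M0.
have CL0 : 0 < CL by rewrite /CL; lra.
have pi0 := pi_gt0 R.
(* With this choice the term containing [J] is at most k (1 + J)/2, so that half of k J can be
   absorbed on the left. *)
pose X : R := 1 + 4 * CL * C * pi / k.
have X0 : 0 < X.
  by rewrite ltr_pwDl// divr_ge0 ?(ltW k0)// mulr_ge0 ?(ltW pi0)// mulr_ge0// mulr_ge0// ltW.
have [CX [CX0 SX]] := damped_bounded_below_at X.
pose G := \int[mu]_(t in `]0, b]) `|g t|.
have G0 : 0 <= G by exact: Rintegral_ge0.
pose C' := 2 / k * (CL * (CX * pi) + k + 2 + (2 + k) * G) + 2.
exists C' => sigma /[dup] s12 /andP[s1 s2]; have s0 : 0 < sigma by lra.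
have iU := re_laplace_integrable mS s0 M0 (integrable_damped s1).
have iw : mu.-integrable `]0, M] (EFin \o (fun t => re_laplace S sigma t * weight M sigma 0 t)).
  apply: (@integrable_mul_bounded _ _ _ mu _ _ _ 2) => //.
    by apply: continuous_Rmeasurable; exact: continuous_weight.
  by move=> t; rewrite /= in_itv/= => /andP[t0 tM]; apply: weight_le; lra.
have bM' : b <= M by lra.
have sb : `]0, b]%classic `<=` `]0, M]%classic by apply: subset_itvl; rewrite bnd_simp.
have sb' : `]b, M]%classic `<=` `]0, M]%classic by apply: subset_itvr; rewrite bnd_simp ltW.
have split_int (f : R -> R) : mu.-integrable `]0, M] (EFin \o f) ->
    \int[mu]_(t in `]0, M]) f t = \int[mu]_(t in `]0, b]) f t + \int[mu]_(t in `]b, M]) f t.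
  move=> fi; rewrite -(@Rintegral_itvB _ _ _ _ b fi) ?bnd_simp ?(ltW b0)//.
  by rewrite addrC subrK.
set J := \int[mu]_(t in `]0, M]) _; set Jb := \int[mu]_(t in `]b, M]) _.
have J0 : 0 <= J by exact: Rintegral_ge0.
have Jb0 : 0 <= Jb by exact: Rintegral_ge0.
have JE := split_int _ (integrable_norm iU); rewrite -/J -/Jb in JE.
have wE := split_int _ iw.
set Ja := \int[mu]_(t in `]0, b]) `|_| in JE.
set W := \int[mu]_(t in `]0, M]) _ in wE.
set Wa := \int[mu]_(t in `]0, b]) _ in wE; set Wb := \int[mu]_(t in `]b, M]) _ in wE.
have iUa := integrableS (mu := mu) (measurable_itv _) (measurable_itv _) sb iU.
have iUb := integrableS (mu := mu) (measurable_itv _) (measurable_itv _) sb' iU.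
have iwa := integrableS (mu := mu) (measurable_itv _) (measurable_itv _) sb iw.
have iwb := integrableS (mu := mu) (measurable_itv _) (measurable_itv _) sb' iw.
have h1 : k * Ja <= Wa + (2 + k) * G.
  rewrite /Ja /Wa /G -!RintegralZl//; try exact: integrable_norm.
  rewrite -RintegralD//; last by apply: integrableRZ => //; exact: integrable_norm.
  apply: le_Rintegral_ae => //.
  - by apply: integrableRZ => //; exact: integrable_norm.
  - apply: integrableRD => //; apply: integrableRZ => //; exact: integrable_norm.
  apply: (ae_imp (Ug sigma s12)) => t Ugt tb; have := Ugt tb; clear Ugt.
  move: tb; rewrite /= in_itv/= => /(weight0_ge M0 b0 bM s12) /andP[]; rewrite -/k.
  set w := weight _ _ _ _; set v := re_laplace _ _ _ => kw w2 gv.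
  (* The lower bound enters here: v - g t is nonnegative, so the weight may replace its lower bound
     [k] in front of it. What remains is a multiple of |g t|. *)
  have a1 : `|v| <= (v - g t) + `|g t|.
    rewrite -[X in `|X|](subrK (g t)) (le_trans (ler_normD _ _))// lerD//.
    by rewrite ger0_norm ?subr_ge0.
  have a2 : k * (v - g t) <= w * (v - g t) by rewrite ler_wpM2r// subr_ge0.
  have a3 : - (w * g t) <= 2 * `|g t|.
    rewrite -mulrN; have w0 : 0 <= w by exact: le_trans (ltW k0) kw.
    apply: (@le_trans _ _ (w * `|g t|)); last by rewrite ler_wpM2r.
    by rewrite ler_wpM2l// -normrN ler_norm.
  have a4 := ler_wpM2l (ltW k0) a1.
  by move: a2 a3 a4; clearbody w v k; clear; lra.
have h2 : - Wb <= 2 * Jb.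
  rewrite (le_trans (ler_norm _))// normrN /Jb -RintegralZl//; last exact: integrable_norm.
  apply: normr_Rintegral_le => //.
  - exact: integrable_measurable iwb.
  - by apply: integrableRZ => //; exact: integrable_norm.
  - move=> t; rewrite /= in_itv/= => /andP[t0 tM]; rewrite normrM mulrC ler_wpM2r//.
    by apply: weight_le => //; move: s1 s2 t0 tM b0 M0; clear; lra.
have h3 : 2 * W <= 2 * (CL * (CX * pi + C * (1 + J) * (2 * pi / X))).
  have s12' : 1 <= sigma <= 2 by rewrite (ltW s1).
  rewrite /W re_laplace_weight//; last exact: integrable_damped.
  rewrite mulr_natl mulr2n; apply: lerD; rewrite (le_trans (ler_norm _))//;
    apply: damped_mean_split => //; rewrite ?(ltW CL0)//.
  - by rewrite mulr_ge0// addr_ge0.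
  - exact: continuous_fejer.
  - move=> x; rewrite subr0 ger0_norm ?fejer_ge0// (le_trans (fejer_le_lorentz _ _))//.
    by rewrite ler_wpM2r ?(ltW (lorentz_gt0 _))// /CL lerDl.
  - by move=> x; apply: SX; exact: ltW.
  - by move=> x x0; exact: SC.
  - by rewrite mulr_ge0// addr_ge0.
  - by apply: continuous_mirror => //; exact: ltW.
  - move=> x; rewrite addr0 (le_trans (mirror_le _ _ _))//.
    by rewrite ler_wpM2r ?(ltW (lorentz_gt0 _))// /CL lerDr addr_ge0// ltW.
  - by move=> x; apply: SX; exact: ltW.
  - by move=> x x0; exact: SC.
have h4 : CL * (C * (1 + J) * (2 * pi / X)) <= k / 2 * (1 + J).
  have -> : CL * (C * (1 + J) * (2 * pi / X)) = (2 * CL * C * pi / X) * (1 + J).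
    by rewrite !mulrA; ring.
  rewrite ler_wpM2r ?addr_ge0// ler_pdivrMr//.
  have -> : k / 2 * X = k / 2 + 2 * CL * C * pi.
    rewrite /X; have E (p : R) : k / 2 * (1 + 4 * CL * C * p / k) = k / 2 + 2 * CL * C * p.
      by field; rewrite gt_eqF.
    exact: E.
  by rewrite lerDr divr_ge0// ltW.
have fin : k * J <= 2 * (CL * (CX * pi) + k + 2 + (2 + k) * G) * (1 + Jb) + 2 * k * Jb.
  have p1 : 0 <= CL * (CX * pi) by rewrite mulr_ge0 ?(ltW CL0)// mulr_ge0// ltW.
  have p2 : 0 <= (2 + k) * G by rewrite mulr_ge0// addr_ge0// ltW.
  have p3 : 0 <= CL * (CX * pi) * Jb by rewrite mulr_ge0.
  have p4 : 0 <= (2 + k) * G * Jb by rewrite mulr_ge0.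
  have p5 : 0 <= k * Jb by rewrite mulr_ge0// ltW.
  move: h1 h2 h3 h4 JE wE p1 p2 p3 p4 p5 k0 Jb0; clear.
  set P := CL * (CX * pi); set Q := CL * (C * (1 + J) * (2 * pi / X)).
  have -> : CL * (CX * pi + C * (1 + J) * (2 * pi / X)) = P + Q by rewrite mulrDr.
  clearbody P Q J Jb Ja W Wa Wb k G; move=> *; subst; lra.
rewrite -(ler_pM2l k0) /C'; apply: (le_trans fin).
have -> : k * ((2 / k * (CL * (CX * pi) + k + 2 + (2 + k) * G) + 2) * (1 + Jb)) =
   2 * (CL * (CX * pi) + k + 2 + (2 + k) * G) * (1 + Jb) + 2 * k * (1 + Jb).
  have E (p : R) : k * ((2 / k * (CL * (CX * p) + k + 2 + (2 + k) * G) + 2) * (1 + Jb)) =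
   2 * (CL * (CX * p) + k + 2 + (2 + k) * G) * (1 + Jb) + 2 * k * (1 + Jb).
    by field; rewrite gt_eqF.
  exact: E.
by rewrite lerD2l ler_wpM2l ?mulr_ge0 ?(ltW k0)// lerDr.
Qed.

End boundedness.

(** * The Riemann-Lebesgue lemma *)

Section riemann_lebesgue.
Context {R : realType}.
Notation mu := (@lebesgue_measure R).

(** Heine-Cantor through near-covering compactness, with delta as the filter variable tending to 0
    from the right. *)
Lemma uniform_continuity_cc (g : R -> R) (a b e : R) : continuous g -> 0 < e ->
  exists d, 0 < d /\ forall x y, a <= x <= b -> `|y - x| < d -> `|g y - g x| < e.
Proof.
move=> cg e0.
have /compact_near_coveringP := @segment_compact R a b.
move=> /(_ R 0^'+ (fun d x => forall y, `|y - x| < d -> `|g y - g x| < e)) H.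
have {}H := H _.
have : \forall d \near 0^'+, `[a, b]%classic `<=`
    (fun x => forall y, `|y - x| < d -> `|g y - g x| < e).
  apply: H => x _.
  have e20 : 0 < e / 2 by rewrite divr_gt0.
  have /cvgrPdist_lt /(_ _ e20) [r /= r0 Hr] := cg x.
  exists (ball x (r / 2), [set d | d < r / 2]).
    split; first by apply: nbhsx_ballx; rewrite divr_gt0.
    by apply: nbhs_right_lt; rewrite divr_gt0.
  move=> [x' d] [/= x'x dr] y yx'.
  rewrite /ball/= in x'x.
  have h1 : `|g x - g x'| < e / 2.
    by apply: Hr; rewrite /ball_/=; move: x'x r0; clear; lra.
  have h2 : `|g x - g y| < e / 2.
    apply: Hr; rewrite /ball_/= (_ : x - y = (x - x') - (y - x')); last by ring.
    rewrite (le_lt_trans (ler_normB _ _))//; move: x'x yx' dr; clear; lra.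
  rewrite (_ : g y - g x' = (g x - g x') - (g x - g y)); last by ring.
  rewrite (le_lt_trans (ler_normB _ _))//; move: h1 h2; clear; lra.
move=> /(filterI (nbhs_right_gt 0)) /filter_ex [d /= [d0 Hd]].
exists d; split => // x y xab; apply: Hd; rewrite /= in_itv/=.
exact: xab.
Qed.

(** Stands for cos and sin at once: boundedness by 1 and integrals of order 1/u over every segment
    are what the argument uses. *)
Variable c : R -> R.
Hypothesis cc : continuous c.
Hypothesis c1 : forall x, `|c x| <= 1.
Hypothesis c_int : forall a b u, a <= b -> 0 < u ->
  `|\int[mu]_(t in `[a, b]) c (t * u)| <= 2 / u.

Lemma continuous_osc (u : R) : continuous (fun t : R => c (t * u)).
Proof.
have h : continuous (fun x : R => x * u) by cont.
by move=> t; exact: (@continuous_comp _ _ _ (fun t : R => t * u) c t (h t) (@cc _)).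
Qed.

Lemma osc_piece (g : R -> R) (a b w G u : R) : continuous g -> a <= b -> 0 < u ->
  (forall t, a <= t <= b -> `|g t - g a| <= w) -> `|g a| <= G ->
  `|\int[mu]_(t in `[a, b]) (g t * c (t * u))| <= w * (b - a) + G * (2 / u).
Proof.
move=> cg ab u0 gw gG.
have co := @continuous_osc u.
have cga : continuous (fun t => g t - g a).
  by apply: continuousD_fun => // x; exact: cvg_cst.
have cgc : continuous (fun t => (g t - g a) * c (t * u)) by exact: continuousM_fun.
have -> : \int[mu]_(t in `[a, b]) (g t * c (t * u)) =
    \int[mu]_(t in `[a, b]) ((g t - g a) * c (t * u)) + g a * \int[mu]_(t in `[a, b]) c (t * u).
  rewrite -RintegralZl//; last exact: continuous_integrable_cc.
  rewrite -RintegralD//; try exact: continuous_integrable_cc.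
    by apply: eq_Rintegral => t _; ring.
  by apply: integrableRZ => //; exact: continuous_integrable_cc.
rewrite (le_trans (ler_normD _ _))// lerD//; last first.
  by apply: normM_le => //; exact: c_int.
apply: Rintegral_cc_le => // t tab; rewrite -[w]mulr1; apply: normM_le => //.
exact: gw.
Qed.

Lemma osc_pieces (g : R -> R) (d w G u : R) (n : nat) : continuous g -> 0 < d -> 0 < u ->
  (forall t s, 0 <= t <= n%:R * d -> `|s - t| <= d -> `|g s - g t| <= w) ->
  (forall t, 0 <= t <= n%:R * d -> `|g t| <= G) ->
  `|\int[mu]_(t in `[0, n%:R * d]) (g t * c (t * u))| <= n%:R * (w * d + G * (2 / u)).
Proof.
move=> cg d0 u0; elim: n => [|n IH] gw gG.
  by rewrite !mul0r set_itv1 Rintegral_set1 normr0.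
have nS : n.+1%:R * d = n%:R * d + d by rewrite -natr1 mulrDl mul1r.
have n0 : 0 <= n%:R * d by rewrite mulr_ge0// ltW.
have nn : n%:R * d <= n.+1%:R * d by rewrite nS; lra.
have ci : continuous (fun t => g t * c (t * u)).
  by apply: continuousM_fun => //; exact: continuous_osc.
have i1 := continuous_integrable_cc 0 (n.+1%:R * d) ci.
have E := @Rintegral_itvB _ _ _ _ (n%:R * d) i1.
have {}E := E (ltac:(by rewrite bnd_simp)) (ltac:(by rewrite bnd_simp)).
rewrite -[X in `|X|](subrK (\int[mu]_(t in `[0, n%:R * d]) (g t * c (t * u)))) E.
rewrite Rintegral_itv_obnd_cbnd; last first.
  by apply: integrableS (continuous_integrable_cc (n%:R * d) (n.+1%:R * d) ci) => //;
    apply: subset_itvr; rewrite bnd_simp.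
have -> : n.+1%:R * (w * d + G * (2 / u)) = (w * d + G * (2 / u)) + n%:R * (w * d + G * (2 / u)).
  by rewrite -natr1; ring.
rewrite (le_trans (ler_normD _ _))// lerD//; last first.
  apply: IH => [t s t1|t t1]; [apply: gw|apply: gG]; lra.
have -> : w * d = w * (n.+1%:R * d - n%:R * d) by rewrite nS; ring.
apply: osc_piece => //.
  move=> t t1; apply: gw; first lra.
  by rewrite ger0_norm; lra.
by apply: gG; lra.
Qed.

Lemma riemann_lebesgue_continuous (g : R -> R) (M e : R) : continuous g -> 0 < M -> 0 < e ->
  exists u0, 0 < u0 /\ forall u, u0 <= u ->
    `|\int[mu]_(t in `[0, M]) (g t * c (t * u))| <= e.
Proof.
move=> cg M0 e0.
have [G GH] : exists G, forall t, 0 <= t <= M -> `|g t| <= G.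
  have /compact_bounded [B [_ HB]] : compact (g @` `[0, M]).
    apply: continuous_compact; last exact: segment_compact.
    exact: continuous_subspaceT.
  exists (`|B| + 1) => t tM; apply: (HB (`|B| + 1)).
    by rewrite ltr_pwDr// ler_norm.
  by exists t => //=; rewrite in_itv.
have G0 : 0 <= G by rewrite (le_trans _ (GH 0 _))// lexx ltW.
have w0 : 0 < e / (2 * M) by rewrite divr_gt0// mulr_gt0.
have [d [d0 Hd]] := uniform_continuity_cc 0 M cg w0.
pose n := (Num.truncn (M / d)).+1.
have nd : M / n%:R < d.
  rewrite ltr_pdivrMr ?ltr0n// mulrC -ltr_pdivrMr//.
  by apply: real_truncnS_gt; rewrite num_real.
have n0 : 0 < n%:R :> R by rewrite ltr0n.
have nM : n%:R * (M / n%:R) = M by field; rewrite gt_eqF.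
pose u0 := 1 + 4 * n%:R * G / e.
have u00 : 0 < u0 by rewrite ltr_pwDl// divr_ge0 ?(ltW e0)// !mulr_ge0// ltW.
exists u0; split => // u uu; have u_0 : 0 < u by lra.
have := @osc_pieces g (M / n%:R) (e / (2 * M)) G u n cg (divr_gt0 M0 n0) u_0.
rewrite nM => H; apply: (le_trans (H _ _)) => //.
  by move=> t s t1 ts; apply/ltW/Hd => //; exact: le_lt_trans nd.
rewrite mulrDr mulrCA nM.
have -> : e / (2 * M) * M = e / 2 by field; rewrite gt_eqF.
have : n%:R * (G * (2 / u)) <= e / 2.
  have -> : n%:R * (G * (2 / u)) = 2 * n%:R * G / u by ring.
  rewrite ler_pdivrMr//.
  have : e / 2 * u0 <= e / 2 * u by rewrite ler_wpM2l//; lra.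
  have -> : e / 2 * u0 = e / 2 + 2 * n%:R * G by rewrite /u0; field; rewrite gt_eqF.
  lra.
lra.
Qed.

Lemma riemann_lebesgue (h : R -> R) (M e : R) : 0 < M -> 0 < e ->
  mu.-integrable `]0, M] (EFin \o h) ->
  exists u0, 0 < u0 /\ forall u, u0 <= u ->
    `|\int[mu]_(t in `]0, M]) (h t * c (t * u))| <= e.
Proof.
move=> M0 e0 ih.
have muf : (mu `]0%R, M] < +oo)%E by rewrite lebesgue_measure_itv/= lte_fin M0 ltry.
(* Density of continuous functions in L1; as |c| <= 1, the approximation error is uniform in u. *)
have [g_ [cg ig cvg_g]] := approximation_continuous_integrable (measurable_itv _) muf ih.
have e20 : 0 < e / 2 by rewrite divr_gt0.
have [n hn] : exists n, \int[mu]_(t in `]0, M]) `|h t - g_ n t| <= e / 2.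
  have /fine_cvgP[_ /cvgrPdist_le /(_ _ e20)] := cvg_g.
  move=> /filter_ex[n]; rewrite /= sub0r normrN => Hn.
  by exists n; rewrite (le_trans (ler_norm _) Hn).
have [u0 [u00 Hu]] := riemann_lebesgue_continuous (cg n) M0 e20.
exists u0; split => // u uu.
have co := @continuous_osc u.
have id : mu.-integrable `]0, M] (EFin \o (fun t => h t - g_ n t)) by exact: integrableRB.
have cgc : continuous (fun t => g_ n t * c (t * u)) by exact: continuousM_fun.
have -> : \int[mu]_(t in `]0, M]) (h t * c (t * u)) =
    \int[mu]_(t in `]0, M]) ((h t - g_ n t) * c (t * u)) +
    \int[mu]_(t in `]0, M]) (g_ n t * c (t * u)).
  rewrite -RintegralD//.
  - by apply: eq_Rintegral => t _; ring.
  - apply: (@integrable_mul_bounded _ _ _ mu _ _ _ 1) => //.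
    exact: continuous_Rmeasurable.
  - exact: integrable_oc.
rewrite (le_trans (ler_normD _ _))//.
have h1 : `|\int[mu]_(t in `]0, M]) ((h t - g_ n t) * c (t * u))| <= e / 2.
  apply: le_trans hn; apply: normr_Rintegral_le => //.
  - apply: measurable_funM; first exact: integrable_measurable id.
    exact: continuous_Rmeasurable.
  - exact: (integrable_norm id).
  - by move=> t _; rewrite -[leRHS]mulr1; exact: normM_le.
have h2 : `|\int[mu]_(t in `]0, M]) (g_ n t * c (t * u))| <= e / 2.
  rewrite Rintegral_itv_obnd_cbnd; first exact: Hu.
  exact: integrable_oc.
by move: h1 h2; clear; lra.
Qed.

End riemann_lebesgue.

(** * Regularisation of the weight at the origin *)

Section trigonometric_osc.
Context {R : realType}.
Notation mu := (@lebesgue_measure R).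

Lemma cos_osc (a b u : R) : a <= b -> 0 < u ->
  `|\int[mu]_(t in `[a, b]) cos (t * u)| <= 2 / u.
Proof.
move=> ab u0; rewrite (@Rintegral_FTC _ _ (fun t => sin (t * u) / u))//; last by cont.
  rewrite -mulrBl normrM (gtr0_norm (_ : 0 < u^-1)) ?invr_gt0// ler_wpM2r ?invr_ge0 ?(ltW u0)//.
  rewrite (le_trans (ler_normB _ _))//; have := sin_max (a * u); have := sin_max (b * u); lra.
move=> x; eexists; first by der.
by rewrite /=; field; rewrite gt_eqF.
Qed.

Lemma sin_osc (a b u : R) : a <= b -> 0 < u ->
  `|\int[mu]_(t in `[a, b]) sin (t * u)| <= 2 / u.
Proof.
move=> ab u0; rewrite (@Rintegral_FTC _ _ (fun t => - cos (t * u) / u))//; last by cont.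
  rewrite -mulrBl normrM (gtr0_norm (_ : 0 < u^-1)) ?invr_gt0// ler_wpM2r ?invr_ge0 ?(ltW u0)//.
  by rewrite (le_trans (normB_le (normN_le (cos_max _)) (normN_le (cos_max _))))//; lra.
move=> x; eexists; first by der.
by rewrite /=; field; rewrite gt_eqF.
Qed.

Lemma cos_sub1_le (y : R) : `|cos y - 1| <= `|y|.
Proof.
wlog y0 : y / 0 <= y => [H|].
  have [|/ltW y0] := leP 0 y; first exact: H.
  by rewrite -(cosN y) -(normrN y); apply: H; rewrite oppr_ge0.
have -> : cos y - 1 = \int[mu]_(t in `[0, y]) - sin t.
  rewrite (@Rintegral_FTC _ _ (fun t => cos t))//; first by rewrite cos0.
    by move=> x; eexists; [der|rewrite mulr1].
  by cont.
rewrite (le_trans (@Rintegral_cc_le _ _ 0 y 1 _ _ _))//; first by cont.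
  by move=> t _; rewrite normrN sin_max.
by rewrite subr0 mul1r ger0_norm.
Qed.

(** The positive part of 1 - t, in a form whose continuity is immediate. It equals 1 at 0, vanishes
    beyond 1 and involves neither M nor u, so one functional records the mass of U at the origin for
    every kernel. *)
Definition hat (t : R) : R := (`|1 - t| + (1 - t)) / 2.

Lemma continuous_hat : continuous hat.
Proof.
have h : continuous (fun t : R => 1 - t) by cont.
apply: (@continuousM_fun _ (fun t => `|1 - t| + (1 - t)) (cst 2^-1)).
  apply: continuousD_fun => // t.
  exact: (@continuous_comp _ _ _ (fun t : R => 1 - t) Num.Def.normr t (h t) (@norm_continuous _ _ _)).
by move=> x; exact: cvg_cst.
Qed.

Lemma hat_bound (t : R) : 0 <= t -> [/\ 0 <= hat t, hat t <= 1 & 1 - hat t <= t].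
Proof.
move=> t0; rewrite /hat; have [h|h] := leP 0 (1 - t); first by rewrite ger0_norm//; split; lra.
by rewrite ltr0_norm//; split; lra.
Qed.

Lemma hat_eq0 (t : R) : 1 <= t -> hat t = 0.
Proof. by move=> t1; rewrite /hat ler0_norm; [lra|lra]. Qed.

Lemma ratio_sub_le (sigma t u : R) : 1 <= sigma <= 2 -> 0 < t ->
  `|(sigma * cos (t * u) + t * sin (t * u)) / (sigma ^+ 2 + t ^+ 2) - sigma^-1| <=
  (`|u| + 2) * t.
Proof.
move=> /andP[s1 s2] t0; set Q := sigma ^+ 2 + t ^+ 2.
have s0 : 0 < sigma by lra.
have Q0 : 0 < Q := @sqrD_gt0 _ _ t s0.
have -> : (sigma * cos (t * u) + t * sin (t * u)) / Q - sigma^-1 =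
    (sigma * sigma * (cos (t * u) - 1) + sigma * t * sin (t * u) - t * t) / (sigma * Q).
  by rewrite /Q; field; rewrite ?gt_eqF//= -/Q.
rewrite normrM (gtr0_norm (_ : 0 < _^-1)) ?invr_gt0 ?mulr_gt0// ler_pdivrMr ?mulr_gt0//.
have sQ : sigma * sigma <= sigma * Q.
  rewrite ler_wpM2l ?(ltW s0)// /Q; have : sigma <= sigma ^+ 2 by rewrite expr2 ler_peMl// ltW.
  have := sqr_ge0 t; lra.
have Q1 : 1 <= Q.
  rewrite /Q; have : 1 <= sigma ^+ 2 by rewrite expr_ge1// ltW.
  have := sqr_ge0 t; lra.
have sQ0 : 0 < sigma * Q by rewrite mulr_gt0.
have tQ : t <= sigma * Q.
  have h1 : Q <= sigma * Q by rewrite ler_peMl// ltW.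
  have h2 : 2 * t <= 1 + t ^+ 2 by have := sqr_ge0 (t - 1); rewrite !expr2; lra.
  have : 1 <= sigma ^+ 2 by rewrite expr_ge1// ltW.
  rewrite /Q in h1 *; lra.
have a1 : `|sigma * sigma * (cos (t * u) - 1)| <= sigma * sigma * (t * `|u|).
  apply: normM_le; first by rewrite ger0_norm// mulr_ge0 ?ltW.
  by rewrite (le_trans (cos_sub1_le _))// normrM (gtr0_norm t0).
have a2 : `|sigma * t * sin (t * u)| <= sigma * t * 1.
  by apply: normM_le; [rewrite ger0_norm// mulr_ge0 ?ltW|exact: sin_max].
have a3 : `|t * t| <= t * t by rewrite ger0_norm// mulr_ge0 ?ltW.
rewrite (le_trans (normB_le (normD_le a1 a2) a3))//.
have b1 : sigma * sigma * (t * `|u|) <= sigma * Q * (t * `|u|).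
  by rewrite ler_wpM2r// mulr_ge0// ltW.
have b2 : sigma * t * 1 <= sigma * Q * t.
  by rewrite mulr1 ler_wpM2r ?(ltW t0)// ler_peMr// ltW.
have b3 : t * t <= sigma * Q * t by rewrite ler_wpM2r// ltW.
by move: b1 b2 b3; clear; lra.
Qed.

(** At t = 0 both terms equal 1/sigma, so the difference is O(t) and does not see the possible
    singularity of U at the origin. *)
Definition weight_diff (M u sigma t : R) : R := weight M sigma u t - hat t / sigma.

Lemma continuous_weight_diff (M u sigma : R) : 1 <= sigma ->
  continuous (weight_diff M u sigma).
Proof.
move=> s1; have s0 : 0 < sigma by lra.
apply: continuousD_fun; first exact: continuous_weight.
move=> t; apply: cvgN; apply: cvgM; first exact: continuous_hat.
exact: cvg_cst.
Qed.

Lemma trig_ratio_le (sigma t u : R) : 1 <= sigma -> 0 <= t ->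
  `|(sigma * cos (t * u) + t * sin (t * u)) / (sigma ^+ 2 + t ^+ 2)| <= 2.
Proof.
move=> s1 t0; have q0 := @sqrD_gt0 R sigma t ltac:(lra).
rewrite normrM (gtr0_norm (_ : 0 < _^-1)) ?invr_gt0// ler_pdivrMr//.
rewrite (le_trans (norm_trig_le _ _ _))//; first lra.
have h1 : 2 * t <= 1 + t ^+ 2 by have := sqr_ge0 (t - 1); rewrite !expr2; lra.
have h2 : sigma <= sigma ^+ 2 by rewrite expr2 ler_peMr//; lra.
have := sqr_ge0 t; have : 1 <= sigma ^+ 2 by rewrite expr_ge1//; lra.
lra.
Qed.

Lemma weight_diff_le (M u sigma t : R) : 0 < M -> 1 <= sigma <= 2 -> 0 < t <= M ->
  `|weight_diff M u sigma t| <= (`|u| + 10 + 2 / M) * t.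
Proof.
move=> M0 /[dup] s12 /andP[s1 s2] /andP[t0 tM].
have [h0 h1 h2] := hat_bound (ltW t0).
have r1 := trig_ratio_le u s1 (ltW t0).
have r2 := ratio_sub_le u s12 t0.
rewrite /weight_diff /weight; set A := (_ / (_ + _)) in r1 r2 *.
have -> : (1 - t / M) * A - hat t / sigma =
    (A - sigma^-1) - t / M * A + (1 - hat t) * sigma^-1 by ring.
have tm : `|t / M| <= t / M by rewrite ger0_norm// divr_ge0 ?ltW.
have hh : `|1 - hat t| <= t by rewrite ger0_norm// subr_ge0.
have si : `|sigma^-1| <= 1 by rewrite gtr0_norm ?invr_gt0 ?invf_le1//; lra.
have H := normD_le (normB_le r2 (normM_le tm r1)) (normM_le hh si).
rewrite (le_trans H)//; move: t0; clear; lra.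
Qed.

(** The computation gives 8 (sigma - 1); the larger constant is that of [weight_diff_le], because
    [boundary_limit] takes a single constant for both estimates. *)
Lemma weight_diff_lip (M u sigma t : R) : 0 < M -> 1 <= sigma <= 2 -> 0 < t <= M ->
  `|weight_diff M u sigma t - weight_diff M u 1 t| <= (`|u| + 10 + 2 / M) * (sigma - 1).
Proof.
move=> M0 /andP[s1 s2] /andP[t0 tM].
have s0 : 0 < sigma by lra.
have [h0 h1 _] := hat_bound (ltW t0).
have q0 := @sqrD_gt0 _ _ t s0; have q1 := @sqrD_gt0 R 1 t ltr01.
rewrite expr1n in q1; rewrite /weight_diff /weight expr1n.
set A := sigma * cos (t * u) + t * sin (t * u).
set B := 1 * cos (t * u) + t * sin (t * u).
set Q := sigma ^+ 2 + t ^+ 2; set Q1 := 1 + t ^+ 2.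
have E : A / Q - B / Q1 =
    ((sigma - 1) * cos (t * u) * Q1 - B * ((sigma + 1) * (sigma - 1))) / (Q * Q1).
  have QE : Q = Q1 + (sigma + 1) * (sigma - 1) by rewrite /Q /Q1; ring.
  have AE : A = B + (sigma - 1) * cos (t * u) by rewrite /A /B; ring.
  have -> : A / Q - B / Q1 = (A * Q1 - B * Q) / (Q * Q1).
    move: q0 q1; rewrite -/Q -/Q1; clear; move: Q Q1 A B => Q Q1 A B q0 q1.
    by field; rewrite !gt_eqF.
  by congr (_ / _); rewrite AE {1}QE; ring.
have -> : (1 - t / M) * (A / Q) - hat t / sigma - ((1 - t / M) * (B / Q1) - hat t / 1) =
    (1 - t / M) * (A / Q - B / Q1) + hat t * ((sigma - 1) * sigma^-1).
  move: (A / Q) (B / Q1) => X Y.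
  by field; rewrite !gt_eqF.
have tm : `|1 - t / M| <= 1.
  have : 0 <= t / M <= 1 by rewrite divr_ge0 ?(ltW t0) ?(ltW M0)//= ler_pdivrMr// mul1r.
  by rewrite ler_norml; lra.
have hh : `|hat t| <= 1 by rewrite ger0_norm.
have si : `|sigma^-1| <= 1 by rewrite gtr0_norm ?invr_gt0 ?invf_le1//; lra.
have sm : `|sigma - 1| <= sigma - 1 by rewrite ger0_norm; lra.
have Q11 : 1 <= Q1 by rewrite /Q1 lerDl sqr_ge0.
have QQ : 1 <= Q.
  rewrite /Q; have : 1 <= sigma ^+ 2 by rewrite expr_ge1// ltW.
  have := sqr_ge0 t; lra.
have tQ : 1 + t <= 2 * Q1.
  have : 2 * t <= 1 + t ^+ 2 by have := sqr_ge0 (t - 1); rewrite !expr2; lra.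
  rewrite /Q1; have := sqr_ge0 t; lra.
have Bn : `|B| <= 2 * Q1 by rewrite (le_trans (norm_trig_le _ _ _))// ltW.
have AB : `|A / Q - B / Q1| <= 7 * (sigma - 1).
  rewrite E normrM (gtr0_norm (_ : 0 < _^-1)) ?invr_gt0 ?mulr_gt0// ler_pdivrMr ?mulr_gt0//.
  have Q1n : `|Q1| <= Q1 by rewrite gtr0_norm.
  have sp : `|sigma + 1| <= 3 by rewrite ger0_norm; lra.
  have H := normB_le (normM_le (normM_le sm (cos_max (t * u))) Q1n) (normM_le Bn (normM_le sp sm)).
  rewrite (le_trans H)//.
  have -> : (sigma - 1) * 1 * Q1 + 2 * Q1 * (3 * (sigma - 1)) = 7 * (sigma - 1) * (1 * Q1) by ring.
  by rewrite ler_wpM2l ?mulr_ge0 ?subr_ge0// ler_wpM2r// ltW.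
have H := normD_le (normM_le tm AB) (normM_le hh (normM_le sm si)).
rewrite (le_trans H)//.
have u0 := normr_ge0 u; have M2 : 0 <= 2 / M by rewrite divr_ge0// ltW.
have : 8 * (sigma - 1) <= (`|u| + 10 + 2 / M) * (sigma - 1).
  by rewrite ler_wpM2r ?subr_ge0//; lra.
clear; lra.
Qed.

End trigonometric_osc.

(** * Boundary behavior *)

Section boundary.
Context {R : realType}.
Notation mu := (@lebesgue_measure R).
Notation D := (`[0, +oo[%classic : set R).
Variable S : R -> R.
Hypothesis mS : measurable_fun setT S.
Hypothesis S_exp : forall sigma, 1 < sigma ->
  exists C, forall x, 0 <= x -> `|S x| <= C * expR (sigma * x).
Hypothesis S_slow : log_linearly_slowly_decreasing S.
Variable f : R -> R.
Hypothesis f_int : forall a b, 0 < a -> a <= b ->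
  mu.-integrable `[a, b] (EFin \o f).
Hypothesis f_lim : forall a b, 0 < a -> a <= b -> forall e, 0 < e ->
  exists eta, 0 < eta <= 1 /\ forall sigma, 1 < sigma < 1 + eta ->
    \int[mu]_(t in `[a, b]) `|re_laplace S sigma t - f t| <= e.
(** The first alternative serves (B.1), with constant [g], and (B.3); the second serves (B.2). *)
Hypothesis near0 :
  (exists b g, [/\ 0 < b, mu.-integrable `]0, b] (EFin \o g) &
    forall sigma, 1 < sigma <= 2 ->
      {ae mu, forall t, `]0, b]%classic t -> g t <= re_laplace S sigma t}]) \/
  (exists b C, 0 < b /\ forall sigma, 1 < sigma < 2 ->
      \int[mu]_(t in `]0, b]) `|re_laplace S sigma t| <= C).

Lemma Rintegral_subset (A B : set R) (h : R -> R) : measurable A -> measurable B ->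
  mu.-integrable B (EFin \o h) -> (forall x, 0 <= h x) -> A `<=` B ->
  \int[mu]_(x in A) h x <= \int[mu]_(x in B) h x.
Proof.
move=> mA mB iB h0 AB; have iA : mu.-integrable A (EFin \o h) by exact: integrableS iB.
rewrite -lee_fin !EFin_Rintegral//; apply: ge0_subset_integral => //.
- exact: measurable_int iB.
- by move=> x _; rewrite lee_fin.
Qed.

Lemma U_integrable sigma M : 1 < sigma -> 0 < M ->
  mu.-integrable `]0, M] (EFin \o re_laplace S sigma).
Proof.
move=> s1 M0; apply: re_laplace_integrable => //; first lra.
exact: integrable_damped.
Qed.

Lemma U_integrable_cc sigma a M : 1 < sigma -> 0 < a -> a <= M ->
  mu.-integrable `[a, M] (EFin \o re_laplace S sigma).
Proof.
move=> s1 a0 aM; apply: integrableS (U_integrable s1 (lt_le_trans a0 aM)) => //.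
by move=> x; rewrite /= !in_itv/= => /andP[ax ->]; rewrite (lt_le_trans a0).
Qed.

Lemma L1_away a b : 0 < a -> a <= b -> exists C eta, 0 < eta <= 1 /\
  forall sigma, 1 < sigma < 1 + eta -> \int[mu]_(t in `[a, b]) `|re_laplace S sigma t| <= C.
Proof.
move=> a0 ab; have [eta [eta0 H]] := f_lim a0 ab ltr01.
exists (1 + \int[mu]_(t in `[a, b]) `|f t|), eta; split => // sigma /[dup] se /andP[s1 _].
have iU := U_integrable_cc s1 a0 ab; have if_ := f_int a0 ab.
have iB : mu.-integrable `[a, b] (EFin \o (fun t => re_laplace S sigma t - f t)) by exact: integrableRB.
have := H _ se; move=> h.
apply: (@le_trans _ _ (\int[mu]_(t in `[a, b]) `|re_laplace S sigma t - f t| +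
  \int[mu]_(t in `[a, b]) `|f t|)); last by rewrite lerD2r.
rewrite -RintegralD//; try exact: integrable_norm.
apply: le_Rintegral => //; first exact: integrable_norm.
  by apply: integrableRD => //; exact: integrable_norm.
by move=> t _; rewrite -[X in `|X| <= _](subrK (f t)) ler_normD.
Qed.

Lemma L1_near_some : exists b C eta, [/\ 0 < b, 0 < eta <= 1 &
  forall sigma, 1 < sigma < 1 + eta ->
    \int[mu]_(t in `]0, b]) `|re_laplace S sigma t| <= C].
Proof.
case: near0 => [[b [g [b0 ig gU]]]|[b [C [b0 H]]]]; last first.
  exists b, C, 1; split => //; first by rewrite ltr01/=.
have [M [C [M0 C0 SC]]] := damped_le_re_laplace mS S_exp S_slow.
(* The cut must stay below M/2, where M is dictated by the sup bound; the mass on the remaining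
   []b', M]] is controlled by the boundary behavior. *)
pose b' := Num.min b (M / 2).
have b'0 : 0 < b' by rewrite lt_min b0 divr_gt0.
have b'b : b' <= b by rewrite ge_min lexx.
have b'M : b' <= M / 2 by rewrite ge_min lexx orbT.
have sb : `]0, b']%classic `<=` `]0, b]%classic by apply: subset_itvl; rewrite bnd_simp.
have ig' : mu.-integrable `]0, b'] (EFin \o g) by exact: integrableS ig.
have gU' sigma : 1 < sigma <= 2 ->
    {ae mu, forall t, `]0, b']%classic t -> g t <= re_laplace S sigma t}.
  by move=> s12; apply: (ae_imp (gU sigma s12)) => t gt tb'; apply: gt; exact: sb.
have [C' HC'] := re_laplace_L1_near mS S_exp M0 b'0 b'M C0 ig' gU' SC.
have [Ca [eta [/andP[eta0 eta1] HCa]]] := L1_away b'0 (le_trans b'M (ltac:(lra) : M / 2 <= M)).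
exists M, (`|C'| * (1 + Ca)), eta; split=> //; first by rewrite eta0.
move=> sigma /[dup] se /andP[s1 s2].
apply: (le_trans (HC' sigma _)); first lra.
have h1 : \int[mu]_(t in `]b', M]) `|re_laplace S sigma t| <= Ca.
  apply: le_trans (HCa _ se); apply: Rintegral_subset => //.
    by apply: integrable_norm; apply: U_integrable_cc => //; lra.
  by apply: subset_itvr; rewrite bnd_simp.
have h2 : 0 <= \int[mu]_(t in `]b', M]) `|re_laplace S sigma t| by exact: Rintegral_ge0.
apply: (le_trans (ler_wpM2r _ (ler_norm C'))); first by rewrite addr_ge0.
by rewrite ler_wpM2l// lerD2l.
Qed.

Lemma L1_bound M : 0 < M -> exists C eta, [/\ 0 <= C, 0 < eta <= 1 &
  forall sigma, 1 < sigma < 1 + eta ->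
    \int[mu]_(t in `]0, M]) `|re_laplace S sigma t| <= C].
Proof.
move=> M0; have [b [C [eta [b0 /andP[eta0 eta1] H]]]] := L1_near_some.
pose M' := Num.max b M.
have bM' : b <= M' by rewrite le_max lexx.
have MM' : M <= M' by rewrite le_max lexx orbT.
have M'0 : 0 < M' by lra.
have [C2 [eta2 [/andP[eta20 eta21] H2]]] := L1_away b0 bM'.
exists (`|C| + `|C2|), (Num.min eta eta2); split.
- by rewrite addr_ge0.
- by rewrite lt_min eta0 eta20/= ge_min eta1.
move=> sigma /andP[s1]; rewrite -ltrBlDl lt_min => /andP[se1 se2].
have h1 := H sigma ltac:(lra); have h2 := H2 sigma ltac:(lra).
have iU := integrable_norm (U_integrable s1 M'0).
apply: (@le_trans _ _ (\int[mu]_(t in `]0, M']) `|re_laplace S sigma t|)).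
  by apply: Rintegral_subset => //; apply: subset_itvl; rewrite bnd_simp.
have E := @Rintegral_itvB _ _ _ _ b iU.
have {}E := E (ltac:(by rewrite bnd_simp ltW)) (ltac:(by rewrite bnd_simp)).
rewrite -[leLHS](subrK (\int[mu]_(t in `]0, b]) `|re_laplace S sigma t|)) E.
rewrite addrC; apply: lerD; first by rewrite (le_trans h1)// ler_norm.
rewrite (le_trans _ (ler_norm _))// (le_trans _ h2)//.
apply: Rintegral_subset => //.
- by apply: integrable_norm; exact: U_integrable_cc.
- by move=> x /=.
- by apply: subset_itvr; rewrite bnd_simp.
Qed.

(** The bound is uniform for sigma > 1, and at a fixed x the factor e^{-(sigma - 1)x} tends to 1, so
    it survives at sigma = 1. *)
Lemma S_bound : exists m, 0 <= m /\ exists eta, [/\ 0 < eta <= 1,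
  forall x, 0 <= x -> `|damped S 1 x| <= m &
  forall sigma x, 1 < sigma < 1 + eta -> 0 <= x -> `|damped S sigma x| <= m].
Proof.
have [M [C [M0 C0 SC]]] := damped_le_re_laplace mS S_exp S_slow.
have [K [eta [K0 /andP[eta0 eta1] HK]]] := L1_bound M0.
pose m := C * (1 + K); have m0 : 0 <= m by rewrite mulr_ge0// addr_ge0.
have Hm sigma x : 1 < sigma < 1 + eta -> 0 <= x -> `|damped S sigma x| <= m.
  move=> /andP[s1 s2] x0; rewrite (le_trans (SC sigma x _ x0))//; first lra.
  by rewrite ler_wpM2l// lerD2l HK//; lra.
exists m; split => //; exists eta; split => //; first by rewrite eta0.
move=> x x0; rewrite leNgt; apply/negP => mlt.
set v := `|_| in mlt; have v0 : 0 < v by lra.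
(* Makes v d x <= (v - m)/2, hence v (1 - d x) > m: the excess at sigma = 1 would persist at sigma =
   1 + d. *)
pose d := Num.min (eta / 2) ((v - m) / (2 * v * (x + 1))).
have den : 0 < 2 * v * (x + 1) by rewrite mulr_gt0// ?mulr_gt0//; lra.
have d0 : 0 < d by rewrite lt_min !divr_gt0// subr_gt0.
have d1 : d <= eta / 2 by rewrite ge_min lexx.
have d2 : d * (2 * v * (x + 1)) <= v - m by rewrite -ler_pdivlMr// ge_min lexx orbT.
have := Hm (1 + d) x ltac:(lra) x0; apply/negP; rewrite -ltNge.
have -> : damped S (1 + d) x = damped S 1 x * expR (- (d * x)).
  by rewrite /damped -mulrA -expRD; congr (_ * expR _); ring.
rewrite normrM (ger0_norm (expR_ge0 _)) -/v.
apply: (@lt_le_trans _ _ (v * (1 + - (d * x)))); last first.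
  by rewrite ler_wpM2l ?(ltW v0)// expR_ge1Dx.
have dv : 0 <= d * v by rewrite mulr_ge0// ltW.
have dvx : 0 <= d * v * x by rewrite mulr_ge0.
move: d2 dv dvx mlt; clear; lra.
Qed.

(** The mass of U on [a, M] is bounded independently of a, and U converges to f there in L1, so f
    inherits the bound up to 1. Monotone convergence then lets a tend to 0. *)
Lemma f_L1 M : 0 < M -> exists C, [/\ 0 <= C, mu.-integrable `]0, M] (EFin \o f) &
  \int[mu]_(t in `]0, M]) `|f t| <= C].
Proof.
move=> M0; have [C [eta [C0 /andP[eta0 eta1] HC]]] := L1_bound M0.
have loc a : 0 < a -> a <= M -> \int[mu]_(t in `[a, M]) `|f t| <= C + 1.
  move=> a0 aM; have [eta2 [/andP[eta20 eta21] H]] := f_lim a0 aM ltr01.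
  pose d := Num.min eta eta2 / 2.
  have de : 0 < Num.min eta eta2 by rewrite lt_min eta0.
  have d1 : Num.min eta eta2 <= eta by rewrite ge_min lexx.
  have d2 : Num.min eta eta2 <= eta2 by rewrite ge_min lexx orbT.
  have s1 : 1 < 1 + d by rewrite /d; lra.
  have iU := U_integrable_cc s1 a0 aM; have if_ := f_int a0 aM.
  have iB : mu.-integrable `[a, M] (EFin \o (fun t => re_laplace S (1 + d) t - f t)) by exact: integrableRB.
  have h1 := H (1 + d) ltac:(rewrite /d; lra).
  have h2 := HC (1 + d) ltac:(rewrite /d; lra).
  have h3 : \int[mu]_(t in `[a, M]) `|re_laplace S (1 + d) t| <= C.
    apply: le_trans h2; apply: Rintegral_subset => //.
      exact/integrable_norm/U_integrable.
    by apply: subset_itvr; rewrite bnd_simp.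
  apply: (@le_trans _ _ (\int[mu]_(t in `[a, M]) `|re_laplace S (1 + d) t| +
    \int[mu]_(t in `[a, M]) `|re_laplace S (1 + d) t - f t|)); last exact: lerD.
  rewrite -RintegralD//; try exact: integrable_norm.
  apply: le_Rintegral => //; first exact: integrable_norm.
    by apply: integrableRD => //; exact: integrable_norm.
  move=> t _; set u := re_laplace _ _ _; rewrite -[X in `|X| <= _](subKr u).
  by rewrite (le_trans (ler_normB _ _)).
pose F n : set R := `[M / n.+1%:R, M]%classic.
have an n : 0 < M / n.+1%:R <= M.
  by rewrite divr_gt0//= ler_pdivrMr// ler_peMr ?ler1n// ltW.
have iF n : mu.-integrable (F n) (EFin \o f) by have /andP[] := an n; exact: f_int.
have UF : \bigcup_n F n = `]0, M]%classic.
  apply/seteqP; split => [t [n _]|t].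
    rewrite /F/= !in_itv/= => /andP[tn ->]; rewrite andbT.
    by have /andP[h _] := an n; exact: lt_le_trans tn.
  rewrite /= in_itv/= => /andP[t0 tM]; exists (Num.truncn (M / t)) => //.
  rewrite /F/= in_itv/= tM andbT ler_pdivrMr// mulrC -ler_pdivrMr//.
  by apply/ltW/real_truncnS_gt; rewrite num_real.
have mF : measurable_fun `]0, M] f.
  rewrite -UF; apply: (measurable_fun_bigcup _ (fun=> measurable_itv _)).2 => n.
  exact: integrable_measurable (iF n).
have ndF : nondecreasing_seq F.
  apply/nondecreasing_seqP => n; rewrite subsetEset /F; apply: subset_itvr.
  by rewrite bnd_simp ler_pM2l// lef_pV2 ?posrE ?ltr0n// ler_nat.
have cvgI : (\int[mu]_(t in F n) (`|f t|)%:E)%E @[n --> \oo] -->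
    (\int[mu]_(t in \bigcup_n F n) (`|f t|)%:E)%E.
  apply: ge0_nondecreasing_set_cvg_integral => //.
  - by move=> n; exact: measurable_itv.
  - move=> n; apply/measurable_EFinP.
    exact: (integrable_measurable (integrable_norm (iF n))).
rewrite UF in cvgI.
have leC : (\int[mu]_(t in `]0%R, M]) (`|f t|)%:E <= (C + 1)%:E)%E.
  rewrite -(cvg_lim _ cvgI)//; apply: lime_le.
    by apply/cvg_ex; eexists; exact: cvgI.
  apply: nearW => n; rewrite -EFin_Rintegral ?lee_fin//.
  - by have /andP[] := an n; exact: loc.
  - exact: measurable_itv.
  - exact: (integrable_norm (iF n)).
have fi : mu.-integrable `]0, M] (EFin \o f).
  apply/integrableP; split; first exact/measurable_EFinP.
  by apply: le_lt_trans leC _; rewrite ltry.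
exists (C + 1); split => //; first by rewrite addr_ge0.
by rewrite -lee_fin EFin_Rintegral//; exact: integrable_norm.
Qed.

(* [f_L1] excludes a non-integrable part at the origin, so on test functions
   vanishing there the boundary value is given by [f] alone. *)
Lemma boundary_limit (M P : R) (p : R -> R -> R) : 0 < M -> 0 < P ->
  (forall sigma, 1 <= sigma -> continuous (p sigma)) ->
  (forall sigma t, 1 <= sigma <= 2 -> 0 < t <= M -> `|p sigma t| <= P * t) ->
  (forall sigma t, 1 <= sigma <= 2 -> 0 < t <= M -> `|p sigma t - p 1 t| <= P * (sigma - 1)) ->
  forall e, 0 < e -> exists eta, 0 < eta <= 1 /\ forall sigma, 1 < sigma < 1 + eta ->
    `|\int[mu]_(t in `]0, M]) (re_laplace S sigma t * p sigma t) -
      \int[mu]_(t in `]0, M]) (f t * p 1 t)| <= e.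
Proof.
move=> M0 P0 cp p0 p1 e e0.
have [C [eta1 [C0 /andP[eta10 eta11] HC]]] := L1_bound M0.
have [C' [C'0 fi HC']] := f_L1 M0.
pose K := C + C' + 1; have K0 : 0 < K by rewrite /K; lra.
have PK : 0 < 8 * P * K by rewrite !mulr_gt0.
have PM : 0 < 4 * P * M by rewrite !mulr_gt0.
pose q := e / (8 * P * K); have q0 : 0 < q by rewrite divr_gt0.
(* On ]0, a] the test function is at most P a and meets bounded masses of U and f; on [a, M] the L1
   convergence applies. *)
pose a := Num.min M q.
have a0 : 0 < a by rewrite lt_min M0.
have aM : a <= M by rewrite ge_min lexx.
have aq : a <= q by rewrite ge_min lexx orbT.
have [eta2 [/andP[eta20 eta21] H2]] := f_lim a0 aM (divr_gt0 e0 PM).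
pose eta := Num.min (Num.min eta1 eta2) q.
exists eta; split.
  by rewrite !lt_min eta10 eta20 q0/= !ge_min eta11.
move=> sigma /andP[s1 s2].
have se : sigma - 1 < eta by rewrite ltrBlDl.
have se1 : sigma - 1 < eta1 by apply: (lt_le_trans se); rewrite !ge_min lexx.
have se2 : sigma - 1 < eta2 by apply: (lt_le_trans se); rewrite !ge_min lexx orbT.
have seq : sigma - 1 <= q by apply: (le_trans (ltW se)); rewrite ge_min lexx orbT.
have s12 : 1 <= sigma <= 2 by lra.
have qE : P * q * (8 * K) = e by rewrite /q; field; rewrite !gt_eqF.
have hU : \int[mu]_(t in `]0, M]) `|re_laplace S sigma t| <= C by apply: HC; lra.
have hUf : \int[mu]_(t in `[a, M]) `|re_laplace S sigma t - f t| <= e / (4 * P * M).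
  by apply: H2; lra.
have iU := U_integrable s1 M0.
have s10 : 1 <= (1 : R) <= 2 by apply/andP; split => //; rewrite ler1n.
have pB v t : 1 <= v <= 2 -> 0 < t <= M -> `|p v t| <= P * M.
  move=> v12 /[dup] tM /andP[_ tM']; rewrite (le_trans (p0 _ _ v12 tM))//.
  by rewrite ler_wpM2l// ltW.
have iUp : mu.-integrable `]0, M] (EFin \o (fun t => re_laplace S sigma t * p sigma t)).
  apply: (@integrable_mul_bounded _ _ _ mu _ _ _ (P * M)) => //.
    by apply: continuous_Rmeasurable; apply: cp; lra.
  by move=> t; rewrite /= in_itv/=; exact: pB.
have ifp : mu.-integrable `]0, M] (EFin \o (fun t => f t * p 1 t)).
  apply: (@integrable_mul_bounded _ _ _ mu _ _ _ (P * M)) => //.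
    by apply: continuous_Rmeasurable; apply: cp; lra.
  by move=> t; rewrite /= in_itv/=; exact: pB.
pose h t := re_laplace S sigma t * p sigma t - f t * p 1 t.
have ih : mu.-integrable `]0, M] (EFin \o h) by exact: integrableRB.
rewrite -RintegralB// -/h.
have sa : `]0, a]%classic `<=` `]0, M]%classic by apply: subset_itvl; rewrite bnd_simp.
have saM : `]a, M]%classic `<=` `]0, M]%classic by apply: subset_itvr; rewrite bnd_simp ltW.
have saM' : `]a, M]%classic `<=` `[a, M]%classic by apply: subset_itvr; rewrite bnd_simp.
have -> : \int[mu]_(t in `]0, M]) h t =
    \int[mu]_(t in `]0, a]) h t + \int[mu]_(t in `]a, M]) h t.
  rewrite -(@Rintegral_itvB _ _ _ _ a ih) ?bnd_simp ?(ltW a0)//.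
  by rewrite addrC subrK.
have iaU : mu.-integrable `]0, a] (EFin \o re_laplace S sigma) by exact: integrableS iU.
have iaf : mu.-integrable `]0, a] (EFin \o f) by exact: integrableS fi.
have iMU : mu.-integrable `]a, M] (EFin \o re_laplace S sigma) by exact: integrableS iU.
have iMf : mu.-integrable `]a, M] (EFin \o f) by exact: integrableS fi.
have mh : measurable_fun `]0, M] h by exact: integrable_measurable ih.
have hE t : 0 < t <= M -> `|h t| <= P * (sigma - 1) * `|re_laplace S sigma t| +
     `|re_laplace S sigma t - f t| * `|p 1 t|.
  move=> tM; have -> : h t = re_laplace S sigma t * (p sigma t - p 1 t) +
    (re_laplace S sigma t - f t) * p 1 t by rewrite /h; ring.
  rewrite (le_trans (ler_normD _ _))// !normrM lerD2r mulrC ler_wpM2r//.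
  exact: p1.
have Ps0 : 0 <= P * (sigma - 1) by rewrite mulr_ge0// ?ltW// subr_gt0.
have Pa0 : 0 <= P * a by rewrite mulr_ge0// ltW.
have PM0 : 0 <= P * M by rewrite mulr_ge0// ltW.
have b1 : `|\int[mu]_(t in `]0, a]) h t| <=
    (P * (sigma - 1) + P * a) * C + P * a * C'.
  apply: (@le_trans _ _ (\int[mu]_(t in `]0, a])
    ((P * (sigma - 1) + P * a) * `|re_laplace S sigma t| + P * a * `|f t|))).
    apply: normr_Rintegral_le => //.
    - exact: measurable_funS mh.
    - by apply: integrableRD => //; apply: integrableRZ => //; exact: integrable_norm.
    move=> t; rewrite /= in_itv/= => /andP[t0 ta].
    have tM : 0 < t <= M by rewrite t0 (le_trans ta).
    have h1 := hE t tM.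
    have h2 : `|p 1 t| <= P * a by rewrite (le_trans (p0 _ _ s10 tM))// ler_wpM2l// ltW.
    have h3 : `|re_laplace S sigma t - f t| * `|p 1 t| <=
        (`|re_laplace S sigma t| + `|f t|) * (P * a) by rewrite ler_pM// ler_normB.
    rewrite (le_trans h1)//; move: h3; clear.
    by lra.
  rewrite RintegralD//; try by apply: integrableRZ => //; exact: integrable_norm.
  rewrite !RintegralZl//; try exact: integrable_norm.
  apply: lerD; apply: ler_wpM2l => //.
  - by rewrite addr_ge0.
  - apply: le_trans hU; apply: Rintegral_subset => //.
    exact: integrable_norm.
  - apply: le_trans HC'; apply: Rintegral_subset => //.
    exact: integrable_norm.
have b2 : `|\int[mu]_(t in `]a, M]) h t| <= P * (sigma - 1) * C + P * M * (e / (4 * P * M)).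
  apply: (@le_trans _ _ (\int[mu]_(t in `]a, M])
    (P * (sigma - 1) * `|re_laplace S sigma t| + P * M * `|re_laplace S sigma t - f t|))).
    have id : mu.-integrable `]a, M] (EFin \o (fun t => re_laplace S sigma t - f t)).
      exact: integrableRB.
    apply: normr_Rintegral_le => //.
    - exact: measurable_funS mh.
    - apply: integrableRD => //; apply: integrableRZ => //; first exact: integrable_norm.
      exact: (integrable_norm id).
    move=> t; rewrite /= in_itv/= => /andP[ta tM'].
    have tM : 0 < t <= M by rewrite tM' (lt_trans a0).
    rewrite (le_trans (hE t tM))// lerD2l mulrC ler_wpM2r//.
    exact: pB.
  have id : mu.-integrable `]a, M] (EFin \o (fun t => re_laplace S sigma t - f t)).
    exact: integrableRB.
  have id' := integrable_norm id.
  rewrite RintegralD//; [|by apply: integrableRZ => //; exact: integrable_norm|exact: integrableRZ id'].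
  rewrite !RintegralZl//; last exact: integrable_norm.
  apply: lerD; apply: ler_wpM2l => //.
    apply: le_trans hU; apply: Rintegral_subset => //.
    exact: integrable_norm.
  apply: le_trans hUf; apply: Rintegral_subset => //.
  have id2 : mu.-integrable `[a, M] (EFin \o (fun t => re_laplace S sigma t - f t)).
    by apply: integrableRB => //; [exact: U_integrable_cc|exact: f_int].
  exact: (integrable_norm id2).
have E1 : P * M * (e / (4 * P * M)) = e / 4 by field; rewrite !gt_eqF.
rewrite E1 in b2.
have CK : C <= K by rewrite /K -addrA lerDl addr_ge0.
have CK' : C' <= K by rewrite /K addrAC lerDr addr_ge0.
have t1 : P * (sigma - 1) * C <= e / 8.
  have h1 : P * (sigma - 1) * C <= P * q * K.
    by rewrite ler_pM// ler_wpM2l// ltW.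
  by move: h1 qE; clear; lra.
have t2 : P * a * C <= e / 8.
  have h1 : P * a * C <= P * q * K.
    by rewrite ler_pM// ler_wpM2l// ltW.
  by move: h1 qE; clear; lra.
have t3 : P * a * C' <= e / 8.
  have h1 : P * a * C' <= P * q * K.
    by rewrite ler_pM// ler_wpM2l// ltW.
  by move: h1 qE; clear; lra.
rewrite (le_trans (ler_normD _ _))//.
by move: b1 b2 t1 t2 t3 e0; rewrite mulrDl; clear; lra.
Qed.

Lemma right_near (P : set R) : (\forall s \near 1^'+, P s) ->
  exists eta, 0 < eta <= 1 /\ forall sigma, 1 < sigma < 1 + eta -> P sigma.
Proof.
move=> [r /= r0 HP]; exists (Num.min r 1); split.
  by rewrite lt_min r0 ltr01/= ge_min lexx orbT.
move=> sigma /andP[s1 s2]; apply: HP => //=.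
rewrite ltr0_norm ?subr_lt0// opprB ltrBlDl (lt_le_trans s2)// lerD2l.
by rewrite ge_min lexx.
Qed.

Lemma damped_mean_cvg (m eta0 : R) (k : R -> R) : 0 < eta0 ->
  measurable_fun D k -> mu.-integrable D (EFin \o k) ->
  (forall sigma x, 1 < sigma < 1 + eta0 -> 0 <= x -> `|damped S sigma x| <= m) ->
  forall e, 0 < e -> exists eta, 0 < eta <= 1 /\ forall sigma, 1 < sigma < 1 + eta ->
    `|\int[mu]_(x in D) (damped S sigma x * k x) -
      \int[mu]_(x in D) (damped S 1 x * k x)| <= e.
Proof.
move=> eta00 mk ik Sm e e0; apply: right_near.
suff : \int[mu]_(x in D) (damped S sigma x * k x) @[sigma --> 1^'+] -->
    \int[mu]_(x in D) (damped S 1 x * k x).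
  move=> /cvgrPdist_le /(_ e e0); apply: filterS => s; by rewrite distrC.
apply/cvg_at_rightP => s [s1 cs].
have /cvgrPdist_lt /(_ _ eta00) [N _ HN] := cs.
(* Discards the first terms, so that the domination holds at every index. *)
rewrite -(cvg_shiftn N).
apply: (@cvg_Rintegral_dominated _ _ _ mu _ _ _ (fun x => m * `|k x|)) => //.
- by move=> n; apply: measurable_funM => //; exact: measurable_damped.
- by apply: integrableRZ => //; exact: integrable_norm.
- move=> x Dx; apply: cvgM; last exact: cvg_cst.
  have cd : continuous (fun sigma => damped S sigma x) by rewrite /damped; cont.
  have cs' : s (n + N)%N @[n --> \oo] --> (1 : R) by rewrite (cvg_shiftn N).
  exact: (cvg_comp _ _ cs' (cd 1)).
- move=> n x; rewrite /= in_itv/= andbT => x0; rewrite normrM ler_wpM2r//.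
  apply: Sm => //; rewrite s1/=.
  have := HN (n + N)%N (leq_addl _ _); rewrite /= ltr0_norm ?subr_lt0//; lra.
Qed.

Definition hat_mass (sigma : R) : R := \int[mu]_(t in `]0, 1]) (re_laplace S sigma t * hat t).

Lemma hat_restrict (h : R -> R) (M : R) : 1 <= M -> mu.-integrable `]0, M] (EFin \o h) ->
  mu.-integrable `]0, M] (EFin \o (fun t => h t * hat t)) /\
  \int[mu]_(t in `]0, M]) (h t * hat t) = \int[mu]_(t in `]0, 1]) (h t * hat t).
Proof.
move=> M1 ih.
have ihh : mu.-integrable `]0, M] (EFin \o (fun t => h t * hat t)).
  apply: (@integrable_mul_bounded _ _ _ mu _ _ _ 1) => //.
    by apply: continuous_Rmeasurable; exact: continuous_hat.
  move=> t; rewrite /= in_itv/= => /andP[t0 tM].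
  by have [h0 h1 _] := hat_bound (ltW t0); rewrite ger0_norm.
split => //.
have E := @Rintegral_itvB _ _ _ _ 1 ihh.
have {}E := E (ltac:(by rewrite bnd_simp)) (ltac:(by rewrite bnd_simp)).
apply/eqP; rewrite -subr_eq0 E.
rewrite (_ : \int[mu]_(x in `]1, M]) _ = \int[mu]_(x in `]1, M]) (0 : R)).
  by rewrite Rintegral_cst// mul0r.
apply: eq_Rintegral => t; rewrite inE/= in_itv/= => /andP[t1 _].
by rewrite hat_eq0 ?mulr0// ltW.
Qed.

Lemma hat_mass_bound : exists C eta, [/\ 0 <= C, 0 < eta <= 1 &
  forall sigma, 1 < sigma < 1 + eta -> `|hat_mass sigma| <= C].
Proof.
have [C [eta [C0 eta01 HC]]] := L1_bound ltr01.
exists C, eta; split => // sigma /[dup] se /andP[s1 _].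
apply: le_trans (HC _ se); have iU := U_integrable s1 ltr01.
have [ih _] := hat_restrict (lexx 1) iU.
apply: normr_Rintegral_le => //.
- exact: integrable_measurable ih.
- exact: integrable_norm.
- move=> t; rewrite /= in_itv/= => /andP[t0 tM].
  have [h0 h1 _] := hat_bound (ltW t0).
  by rewrite -[leRHS]mulr1 normrM ler_wpM2l// ger0_norm.
Qed.

(** Compactness of [-C, C]. A cluster value is enough: the quantity to be identified, the Fejer mean
    at sigma = 1, does not depend on the sequence chosen. *)
Lemma hat_mass_cluster : exists l, forall e eta, 0 < e -> 0 < eta ->
  exists sigma, 1 < sigma < 1 + eta /\ `|hat_mass sigma - l| <= e.
Proof.
have [C [eta0 [C0 /andP[eta00 eta01] HC]]] := hat_mass_bound.
have FF : ProperFilter (hat_mass @ 1^'+) by exact: fmap_proper_filter.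
have nearlt r : 1 < r -> \forall s \near (1 : R)^'+, 1 < s < r.
  by move=> r1; near=> s; apply/andP; split.
have FC : (hat_mass @ 1^'+) `[- C, C]%classic.
  have : \forall s \near (1 : R)^'+, 1 < s < 1 + eta0 by apply: nearlt; rewrite ltrDl.
  by apply: filterS => s se; rewrite /= in_itv/= -ler_norml; exact: HC.
have [l [_ cl]] := @segment_compact R (- C) C _ FF FC.
exists l => e eta e0 eta_0.
have h1 : (hat_mass @ 1^'+) (hat_mass @` [set s | 1 < s < 1 + eta]).
  have : \forall s \near (1 : R)^'+, 1 < s < 1 + eta by apply: nearlt; rewrite ltrDl.
  by apply: filterS => s se; exists s.
have [_ [[s se <-] hb]] := cl _ _ h1 (nbhsx_ballx l e e0).
by exists s; split => //; rewrite distrC ltW.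
Unshelve. all: by end_near. Qed.

(* The limit is the mass at the origin of the boundary measure, up to the
   normalisation of the kernel; it does not depend on [M]. *)
Lemma fejer_mean_limit : exists A, forall M, 1 <= M -> forall e, 0 < e ->
  exists u0, 0 < u0 /\ forall u, u0 <= u ->
    `|\int[mu]_(x in D) (damped S 1 x * fejer M (x - u)) - A| <= e.
Proof.
have [l Hl] := hat_mass_cluster.
have [m [m0 [eta0 [/andP[eta00 eta01] S1m Sm]]]] := S_bound.
have [C [eta1 [C0 /andP[eta10 eta11] HC]]] := hat_mass_bound.
(* [l] is the limit of the [hat] part along the chosen sequence. The rest tends to the integral of f
   against [weight_diff], which is an oscillatory integral minus that of f against [hat]. *)
pose A := 2 * (l - \int[mu]_(t in `]0, 1]) (f t * hat t)).
exists A => M M1 e e0; have M0 : 0 < M by lra.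
have [Cf [_ fi _]] := f_L1 M0.
pose I u := \int[mu]_(x in D) (damped S 1 x * fejer M (x - u)).
have step u : 0 < u -> `|I u - 2 * (l + \int[mu]_(t in `]0, M]) (f t * weight_diff M u 1 t))|
    <= m * (mirror_const M * pi / u).
  move=> u0; apply/ler_addgt0Pr => e1 e10.
  (* Seven units of error: one for the Fejer mean, and two each for the regular part, the factor
     1/sigma and the cluster value, which the identity doubles. *)
  have d0 : 0 < e1 / 7 by rewrite divr_gt0.
  have ik : mu.-integrable D (EFin \o (fun x => fejer M (x - u))).
    by apply: integrableS (integrable_fejer u M0).
  have [a [/andP[a0 a1] Ha]] := damped_mean_cvg eta00 (integrable_measurable ik) ik Sm d0.
  have P0 : 0 < `|u| + 10 + 2 / M.
    by rewrite ltr_wpDr ?divr_ge0 ?(ltW M0)// ltr_wpDl.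
  have [b [/andP[b0 b1] Hb]] := boundary_limit M0 P0
    (fun s s1 => @continuous_weight_diff _ M u s s1)
    (fun s t => @weight_diff_le _ M u s t M0) (fun s t => @weight_diff_lip _ M u s t M0) d0.
  pose q := e1 / 7 / (C + 1).
  have q0 : 0 < q by rewrite divr_gt0// ltr_wpDl.
  pose eta := Num.min (Num.min a b) (Num.min (Num.min eta0 eta1) q).
  have eta_gt0 : 0 < eta by rewrite !lt_min a0 b0 eta00 eta10 q0.
  have [sigma [/andP[s1 s2] Hs]] := Hl _ _ d0 eta_gt0.
  move: s2; rewrite -ltrBlDl !lt_min => /andP[/andP[sa sb] /andP[/andP[se0 se1] sq]].
  have s12 : 1 <= sigma <= 2.
    by rewrite (ltW s1)/= -lerBlDl (le_trans (ltW sa)).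
  have h1 := Ha sigma (ltac:(by rewrite s1 -ltrBlDl)).
  have h2 := Hb sigma (ltac:(by rewrite s1 -ltrBlDl)).
  have h3 := HC sigma (ltac:(by rewrite s1 -ltrBlDl)).
  have Sms x (x0 : 0 <= x) := Sm sigma x (ltac:(by rewrite s1 -ltrBlDl)) x0.
  have h4 := mirror_mean_le mS M0 u0 s12 Sms.
  have E := re_laplace_weight u mS M0 s12 (integrable_damped mS S_exp s1).
  have iU := U_integrable s1 M0.
  have [iUh Uh] := hat_restrict M1 iU.
  have WE : \int[mu]_(t in `]0, M]) (re_laplace S sigma t * weight M sigma u t) =
    \int[mu]_(t in `]0, M]) (re_laplace S sigma t * weight_diff M u sigma t) +
    sigma^-1 * hat_mass sigma.
    rewrite /hat_mass -Uh -RintegralZl// -RintegralD//.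
    - by apply: eq_Rintegral => t _; rewrite /weight_diff; ring.
    - apply: (@integrable_mul_bounded _ _ _ mu _ _ _ ((`|u| + 10 + 2 / M) * M)) => //.
        by apply: continuous_Rmeasurable; apply: continuous_weight_diff; exact: ltW.
      move=> t; rewrite /= in_itv/= => /[dup] tM /andP[t0 tM'].
      by rewrite (le_trans (weight_diff_le u M0 s12 tM))// ler_wpM2l// ltW.
    - exact: integrableRZ.
  have h5 : `|sigma^-1 * hat_mass sigma - hat_mass sigma| <= e1 / 7.
    have s0 : 0 < sigma by exact: lt_trans s1.
    have -> : sigma^-1 * hat_mass sigma - hat_mass sigma =
      - (sigma^-1 * ((sigma - 1) * hat_mass sigma)).
      by move: (hat_mass _) => H; field; rewrite gt_eqF.
    have si : `|sigma^-1| <= 1 by rewrite gtr0_norm ?invr_gt0// invf_le1// ltW.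
    have sm : `|sigma - 1| <= q by rewrite gtr0_norm ?subr_gt0// ltW.
    have H := normN_le (normM_le si (normM_le sm h3)).
    rewrite (le_trans H)// mul1r.
    have -> : e1 / 7 = q * (C + 1) by rewrite /q mulfVK// gt_eqF// ltr_wpDl.
    by rewrite ler_wpM2l ?(ltW q0)// lerDl.
  move: E h1 h2 h4 h5 Hs; rewrite WE -/(I u).
  set X := \int[mu]_(t in _) (_ * weight_diff _ _ sigma _).
  set Y := \int[mu]_(t in _) (_ * weight_diff _ _ 1 _).
  set Z := \int[mu]_(x in _) (_ * mirror _ _ _).
  set W := \int[mu]_(x in _) (_ * fejer _ _).
  set T := m * _; set L := hat_mass sigma; set L' := sigma^-1 * L.
  clearbody X Y Z W T L L'; move: (I u) => Iu.
  rewrite !ler_norml; move: e10; clear; lra.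
have e2 : 0 < e / 8 by rewrite divr_gt0.
(* At sigma = 1 the weight is c1(t) cos(tu) + c1(t) t sin(tu): its dependence on u is purely
   oscillatory, as the Riemann-Lebesgue lemma requires. *)
pose c1 t := (1 - t / M) / (1 + t ^+ 2).
have cc1 : continuous c1.
  apply: is_derive_continuous => t; eexists; rewrite /c1; under eq_fun do rewrite expr2.
  der; apply: deriveV_fun; last by der.
  by rewrite -expr2 gt_eqF// ltr_pwDl ?sqr_ge0.
have fB (g : R -> R) : continuous g -> mu.-integrable `]0, M] (EFin \o (fun t => f t * g t)).
  move=> cg; have /compact_bounded [B [_ HB]] : compact (g @` `[0, M]).
    apply: continuous_compact; last exact: segment_compact.
    exact: continuous_subspaceT.
  apply: (@integrable_mul_bounded _ _ _ mu _ _ _ (`|B| + 1)) => //.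
    exact: continuous_Rmeasurable.
  move=> t; rewrite /= in_itv/= => /andP[t0 tM]; apply: (HB (`|B| + 1)).
    by rewrite ltr_pwDr// ler_norm.
  by exists t => //=; rewrite in_itv/= (ltW t0).
have cc2 : continuous (fun t => c1 t * t).
  by apply: continuousM_fun => // t; exact: cvg_id.
have i1 := fB _ cc1; have i2 := fB _ cc2.
have [u1 [u10 H1]] := riemann_lebesgue (@continuous_cos R) (@cos_max R) (@cos_osc R) M0 e2 i1.
have [u2 [u20 H2]] := riemann_lebesgue (@continuous_sin R) (@sin_max R) (@sin_osc R) M0 e2 i2.
pose u3 := 2 * (m * (mirror_const M * pi)) / e + 1.
have mc := mirror_const_ge0 M0; have pi0 := pi_gt0 R.
have mmp : 0 <= m * (mirror_const M * pi) by rewrite mulr_ge0// mulr_ge0// ltW.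
have u30 : 0 < u3 by rewrite ltr_wpDl// divr_ge0 ?(ltW e0)// mulr_ge0.
exists (u1 + u2 + u3); split; first by rewrite addr_gt0// addr_gt0.
move=> u uu; have u0 : 0 < u by apply: lt_le_trans uu; rewrite addr_gt0// addr_gt0.
have h0 := step u u0.
have uu1 : u1 <= u by apply: le_trans uu; rewrite -addrA lerDl addr_ge0// ltW.
have uu2 : u2 <= u by apply: le_trans uu; rewrite addrAC lerDr addr_ge0// ltW.
have uu3 : u3 <= u by apply: le_trans uu; rewrite lerDr addr_ge0// ltW.
have h1 := H1 u uu1; have h2 := H2 u uu2.
have h3 : m * (mirror_const M * pi / u) <= e / 2.
  rewrite mulrA ler_pdivrMr//.
  have : e / 2 * u3 <= e / 2 * u by rewrite ler_wpM2l ?divr_ge0 ?(ltW e0).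
  have -> : e / 2 * u3 = m * (mirror_const M * pi) + e / 2.
    rewrite /u3; move: (m * _) => T; by field; rewrite gt_eqF.
  lra.
have cosu : continuous (fun t : R => cos (t * u)) by cont.
have sinu : continuous (fun t : R => sin (t * u)) by cont.
have [ifh fh] := hat_restrict M1 fi.
have FE : \int[mu]_(t in `]0, M]) (f t * weight_diff M u 1 t) =
    \int[mu]_(t in `]0, M]) (f t * c1 t * cos (t * u)) +
    \int[mu]_(t in `]0, M]) (f t * (c1 t * t) * sin (t * u)) -
    \int[mu]_(t in `]0, 1]) (f t * hat t).
  have j1 : mu.-integrable `]0, M] (EFin \o (fun t => f t * c1 t * cos (t * u))).
    by apply: (@integrable_mul_bounded _ _ _ mu _ _ _ 1) => //;
      first [exact: i1 | exact: continuous_Rmeasurable | move=> t _; exact: cos_max].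
  have j2 : mu.-integrable `]0, M] (EFin \o (fun t => f t * (c1 t * t) * sin (t * u))).
    by apply: (@integrable_mul_bounded _ _ _ mu _ _ _ 1) => //;
      first [exact: i2 | exact: continuous_Rmeasurable | move=> t _; exact: sin_max].
  rewrite -fh -RintegralD// -RintegralB//; last exact: integrableRD.
  apply: eq_Rintegral => t _; rewrite /weight_diff /weight /c1 expr1n.
  have q1 : 1 + t ^+ 2 != 0 by rewrite gt_eqF// ltr_pwDl ?sqr_ge0.
  move: (cos _) (sin _) => x y; by field; rewrite q1 gt_eqF.
rewrite FE in h0; rewrite -/(I u) /A.
move: h0 h1 h2 h3 e0; move: (I u) (m * _) => Iu T.
set X := \int[mu]_(t in _) (_ * _ * cos _); set Y := \int[mu]_(t in _) (_ * _ * sin _).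
set Z := \int[mu]_(t in _) (_ * hat _); clearbody X Y Z.
rewrite !ler_norml; clear; lra.
Qed.

End boundary.

(** * From Fejer means to pointwise limits *)

Section fejer_tauberian.
Context {R : realType}.
Notation mu := (@lebesgue_measure R).
Notation D := (`[0, +oo[%classic : set R).
Notation N := (@fejer_mass R).
Variable S : R -> R.
Hypothesis mS : measurable_fun setT S.
Hypothesis S_slow : log_linearly_slowly_decreasing S.
Variable m : R.
Hypothesis m_ge0 : 0 <= m.
Hypothesis S_m : forall x, 0 <= x -> `|damped S 1 x| <= m.
Variable alpha : R.
Hypothesis S_A : forall M, 1 <= M -> forall e, 0 < e ->
  exists u0, 0 < u0 /\ forall u, u0 <= u ->
    `|\int[mu]_(x in D) (damped S 1 x * fejer M (x - u)) - alpha * N| <= e.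

(** Boundedness turns the multiplicative form of slow decrease into an additive one: on a window
    shorter than e/(m + e) the exponential factor costs at most another e. *)
Lemma damped_lower_step e : 0 < e -> exists h x0, [/\ 0 < h, 0 < x0 &
  forall x y, x0 <= x -> x <= y -> y <= x + h ->
    damped S 1 x - 2 * e <= damped S 1 y].
Proof.
move=> e0; have [h [x0 [h0 x00 H]]] := damped_slow S_slow e0.
have me : 0 < m + e by rewrite ltr_wpDl.
exists (Num.min h (e / (m + e))), x0; split => //.
  by rewrite lt_min h0 divr_gt0.
move=> x y xx xy; rewrite -lerBlDl le_min => /andP[yh ye].
apply: le_trans (H 1 x y (lexx _) xx xy _); last by rewrite -lerBlDl.
set E := expR _; set a := damped S 1 x - e.
have E1 : E <= 1 by rewrite -(expR0 R) ler_expR mulN1r oppr_le0 subr_ge0.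
have E2 : 1 - (y - x) <= E by rewrite /E mulN1r expR_ge1Dx.
have aB : `|a| <= m + e.
  by rewrite (le_trans (ler_normB _ _))// (gtr0_norm e0) lerD2r S_m// ltW// (lt_le_trans x00).
have dE : (1 - E) * `|a| <= e.
  have d1 : 1 - E <= e / (m + e) by rewrite (le_trans _ ye)// lerBlDr addrC -lerBlDr.
  have E1' : 0 <= 1 - E by rewrite subr_ge0.
  rewrite (le_trans (ler_pM E1' (normr_ge0 _) d1 aB))//.
  by rewrite mulfVK// gt_eqF.
have : (1 - E) * a <= (1 - E) * `|a| by rewrite ler_wpM2l ?subr_ge0 ?ler_norm.
move: dE; rewrite /a; move: (damped S 1 x) => t; move: (`|_|) => n.
by move=> *; nra.
Qed.

Lemma fejer_half_mass M u : 1 <= M -> 0 < u ->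
  `|\int[mu]_(x in D) fejer M (x - u) - N| <= 8 * pi / u.
Proof.
move=> M1 u0; have M0 : 0 < M by exact: lt_le_trans M1.
have p0 := pi_gt0 R.
have up : \int[mu]_(x in D) fejer M (x - u) <= N.
  rewrite -(Rintegral_fejer u M0); apply: Rintegral_subset_le => //.
    exact: integrable_fejer.
  by move=> x; exact: fejer_ge0.
(* The constant function 1 on the widest window inside the half-line, r = u, gives the lower bound
   for the mass on [0, +oo[. *)
have := @fejer_peak R M u u 1 1 (cst 1) M0 u0 (lexx _) ler01 (measurable_cst _)
  (fun x _ => (ltac:(by rewrite /= normr1) : `|cst 1 x| <= (1 : R))) (fun x _ => lexx _).
under eq_Rintegral do rewrite /= mul1r.
move=> lo; rewrite ler_norml.
have h : 4 * pi / (M * u) <= 4 * pi / u.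
  by rewrite ler_wpM2l ?mulr_ge0 ?(ltW p0)// lef_pV2 ?posrE ?mulr_gt0// ler_peMl// ltW.
have g : 0 <= 8 * pi / u by rewrite divr_ge0 ?mulr_ge0 ?(ltW p0)// ltW.
move: lo up h g; have -> : 8 * pi / u = 2 * (4 * pi / u) :> R by rewrite !mulrA -natrM.
move: (4 * pi / (M * u)) (4 * pi / u) (\int[mu]_(x in D) _) N => a b c n.
by move=> *; apply/andP; split; lra.
Qed.

Notation B := (m + `|alpha|).

Lemma damped_center_bound x : 0 <= x -> `|damped S 1 x - alpha| <= B.
Proof. by move=> x0; rewrite (le_trans (ler_normB _ _))// lerD2r S_m. Qed.

Lemma measurable_damped_center (E : set R) : measurable_fun E (fun x => damped S 1 x - alpha).
Proof. by apply: measurable_funB => //; exact: measurable_damped. Qed.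

Lemma fejer_mean_center M : 1 <= M -> forall e, 0 < e ->
  exists u0, 0 < u0 /\ forall u, u0 <= u ->
    `|\int[mu]_(x in D) ((damped S 1 x - alpha) * fejer M (x - u))| <= e.
Proof.
move=> M1 e e0; have M0 : 0 < M by exact: lt_le_trans M1.
have e20 : 0 < e / 2 by rewrite divr_gt0.
have [u0 [u00 H]] := S_A M1 e20.
have p0 := pi_gt0 R.
exists (u0 + `|alpha| * (8 * pi) / (e / 2)); split.
  by rewrite ltr_wpDr// !mulr_ge0 ?invr_ge0 ?(ltW e20) ?(ltW p0).
move=> u uu; have uu0 : u0 <= u.
  by apply: le_trans uu; rewrite lerDl !mulr_ge0 ?invr_ge0 ?(ltW e20) ?(ltW p0).
have up : 0 < u by exact: lt_le_trans uu0.
have h1 := H u uu0; have h2 := fejer_half_mass M1 up.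
have ik : mu.-integrable D (EFin \o (fun x => fejer M (x - u))).
  by apply: integrableS (integrable_fejer u M0).
have itk : mu.-integrable D (EFin \o (fun x => damped S 1 x * fejer M (x - u))).
  under [X in EFin \o X]eq_fun do rewrite mulrC.
  apply: (@integrable_mul_bounded _ _ _ mu _ _ _ m) => //.
    exact: measurable_damped.
  by move=> x; rewrite /= in_itv/= andbT; exact: S_m.
have -> : \int[mu]_(x in D) ((damped S 1 x - alpha) * fejer M (x - u)) =
    (\int[mu]_(x in D) (damped S 1 x * fejer M (x - u)) - alpha * N) -
    alpha * (\int[mu]_(x in D) fejer M (x - u) - N).
  under eq_Rintegral do rewrite mulrBl.
  rewrite RintegralB//; last exact: integrableRZ.
  by rewrite RintegralZl//; ring.
have h3 : `|alpha * (\int[mu]_(x in D) fejer M (x - u) - N)| <= e / 2.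
  rewrite normrM (le_trans (ler_wpM2l (normr_ge0 _) h2))//.
  rewrite mulrA ler_pdivrMr// [leRHS]mulrC -ler_pdivrMr//.
  by apply: le_trans uu; rewrite lerDr ltW.
by rewrite (le_trans (ler_normB _ _))// (splitr e) lerD.
Qed.

(** A deviation above 4e at a far point stays above e on a whole window of length [h]. The Fejer
    mean there is then at least e N/2 in modulus, against a bound e N/4. *)
Lemma damped_limit e : 0 < e -> exists X, 0 < X /\ forall x, X <= x ->
  `|damped S 1 x - alpha| <= 4 * e.
Proof.
move=> e0; have [h [x0 [h0 x00 step]]] := damped_lower_step e0.
have N0 : 0 < N by exact: fejer_mass_gt0.
have p0 := pi_gt0 R.
have Be : 0 < B + e by rewrite ltr_wpDl// addr_ge0.
pose r := h / 2; have r0 : 0 < r by rewrite divr_gt0.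
have hr : h = r + r by rewrite /r -splitr.
have reN : 0 < r * (e * N) by rewrite !mulr_gt0.
(* Makes the contribution from outside the window at most e N/2. *)
pose M := 1 + 8 * pi * (B + e) / (r * (e * N)).
have M1 : 1 <= M by rewrite lerDl divr_ge0 ?(ltW reN)// !mulr_ge0 ?(ltW p0)// ltW.
have M0 : 0 < M by exact: lt_le_trans M1.
have tail : (B + e) * (4 * pi / (M * r)) <= e * N / 2.
  rewrite mulrA ler_pdivrMr ?mulr_gt0//.
  have -> : e * N / 2 * (M * r) = (r * (e * N)) / 2 + 8 * pi * (B + e) / 2.
    rewrite /M; move: (@pi R) (B + e) => p b; by field; rewrite !gt_eqF.
  have -> : 8 * pi * (B + e) / 2 = (B + e) * (4 * pi).
    by move: (@pi R) => p; field.
  by rewrite lerDr divr_ge0// ltW.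
have eN4 : 0 < e * N / 4 by rewrite divr_gt0// mulr_gt0.
have [u0 [u00 HM]] := fejer_mean_center M1 eN4.
exists (x0 + h + u0); split; first by rewrite !addr_gt0.
have key (s : bool) u : u0 <= u -> r <= u ->
    ~ (forall x, u - r <= x <= u + r -> e <= (-1) ^+ s * (damped S 1 x - alpha)).
  move=> uu0 ru Hs.
  have := @fejer_peak R M u r B e (fun x => (-1) ^+ s * (damped S 1 x - alpha)) M0 r0 ru
    (ltW e0).
  have ms : measurable_fun D (fun x => (-1) ^+ s * (damped S 1 x - alpha)).
    by apply: measurable_funM => //; exact: measurable_damped_center.
  have bs x : 0 <= x -> `|(-1) ^+ s * (damped S 1 x - alpha)| <= B.
    by rewrite normrMsign; exact: damped_center_bound.
  move=> /(_ ms bs Hs).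
  under eq_Rintegral do rewrite -mulrA.
  have ik : mu.-integrable D (EFin \o (fun x => fejer M (x - u))).
    by apply: integrableS (integrable_fejer u M0).
  rewrite RintegralZl//; last first.
    under [X in EFin \o X]eq_fun do rewrite mulrC.
    apply: (@integrable_mul_bounded _ _ _ mu _ _ _ B) => //.
      exact: measurable_damped_center.
    by move=> x; rewrite /= in_itv/= andbT; exact: damped_center_bound.
  move=> /le_trans /(_ (ler_norm _)); rewrite normrMsign => /le_trans /(_ (HM u uu0)).
  by move: tail eN4; move: (e * N) (_ * (4 * _ / _)) => a b; lra.
move=> x xX; have xx0 : x0 <= x by move: xX h0 u00; lra.
(* A value too low propagates to the left and is tested at x - r; a value too high propagates to the
   right and is tested at x + r. *)
rewrite ler_norml; apply/andP; split; rewrite leNgt; apply/negP => lt4.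
  apply: (key true (x - r)); first by move: xX hr r0 x00; lra.
    by move: xX hr r0 x00 u00; lra.
  move=> y /andP[y1 y2]; rewrite expr1 mulN1r.
  have /step : x0 <= y by move: xX hr y1 u00; lra.
  have yx : y <= x by move: y2; lra.
  have xy : x <= y + h by move: y1 hr; lra.
  by move=> /(_ x yx xy); move: lt4 e0; lra.
apply: (key false (x + r)); first by move: xX hr r0 x00; lra.
  by move: xX hr r0 x00 u00; lra.
move=> y /andP[y1 y2]; rewrite expr0 mul1r.
have xy : x <= y by move: y1; lra.
have yx : y <= x + h by move: y2 hr; lra.
have := step x y xx0 xy yx.
by move: lt4 e0; lra.
Qed.

(** The Abelian direction: at t = 0 the transform is sigma times the integral of tau(x) e^{-(sigma -
    1)x}, and replacing tau by its limit gives sigma alpha/(sigma - 1). *)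
Lemma re_laplace_pole e : 0 < e -> exists K, 0 <= K /\ forall sigma, 1 < sigma <= 2 ->
  `|(sigma - 1) * re_laplace S sigma 0 - sigma * alpha| <= 2 * (4 * e + (sigma - 1) * K).
Proof.
move=> e0; have [X [X0 HX]] := damped_limit e0.
have B0 : 0 <= B by rewrite addr_ge0.
(* On [0, X] the integrand is at most [B], hence at most B e^X e^{-x}, which has integral B e^X
   whatever sigma is. *)
exists (B * expR X); split; first by rewrite mulr_ge0 ?expR_ge0.
move=> sigma /andP[s1 s2]; set d := sigma - 1.
have d0 : 0 < d by rewrite subr_gt0.
have dE x : damped S sigma x = damped S 1 x * expR (- d * x).
  by rewrite /damped -mulrA -expRD /d; congr (_ * expR _); ring.
have id := integrable_expR_decay d0; have i1 := @integrable_expR_decay R 1 ltr01.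
have B' x : 0 <= x -> `|(damped S 1 x - alpha) * expR (- d * x)| <=
    4 * e * expR (- d * x) + B * expR X * expR (- 1 * x).
  move=> x0; rewrite normrM (ger0_norm (expR_ge0 _)).
  have [/HX xX|xX] := leP X x.
    rewrite ler_wpDr ?ler_wpM2r ?expR_ge0//.
    by rewrite !mulr_ge0 ?expR_ge0.
  rewrite ler_wpDl ?mulr_ge0 ?expR_ge0// ?(ltW e0)//.
  rewrite (le_trans (ler_wpM2r (expR_ge0 _) (damped_center_bound x0)))//.
  rewrite -mulrA ler_wpM2l// -expRD ler_expR.
  rewrite [leLHS]mulNr; apply: (@le_trans _ _ 0); first by rewrite oppr_le0 mulr_ge0// ltW.
  by rewrite mulN1r subr_ge0 ltW.
have ic : mu.-integrable D (EFin \o (fun x => (damped S 1 x - alpha) * expR (- d * x))).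
  apply: (@integrable_le _ _ _ mu _ _
    (fun x => 4 * e * expR (- d * x) + B * expR X * expR (- 1 * x))) => //.
  - apply: measurable_funM; first exact: measurable_damped_center.
    exact: integrable_measurable id.
  - by apply: integrableRD => //; exact: integrableRZ.
  - by move=> x; rewrite /= in_itv/= andbT; exact: B'.
have bI : `|\int[mu]_(x in D) ((damped S 1 x - alpha) * expR (- d * x))| <=
    4 * e / d + B * expR X.
  apply: (@le_trans _ _ (\int[mu]_(x in D)
      (4 * e * expR (- d * x) + B * expR X * expR (- 1 * x)))).
    apply: normr_Rintegral_le => //.
    - exact: integrable_measurable ic.
    - by apply: integrableRD => //; exact: integrableRZ.
    - by move=> x; rewrite /= in_itv/= andbT; exact: B'.
  rewrite RintegralD//; try exact: integrableRZ.
  by rewrite !RintegralZl// !Rintegral_expR_decay// invr1 mulr1.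
have -> : d * re_laplace S sigma 0 - sigma * alpha =
    sigma * (d * \int[mu]_(x in D) ((damped S 1 x - alpha) * expR (- d * x))).
  have -> : re_laplace S sigma 0 = sigma *
      (\int[mu]_(x in D) ((damped S 1 x - alpha) * expR (- d * x)) + alpha / d).
    rewrite -(Rintegral_expR_decay d0) -RintegralZl// -RintegralD//; last exact: integrableRZ.
    rewrite -RintegralZl//; last by apply: integrableRD => //; exact: integrableRZ.
    apply: eq_Rintegral => x _; rewrite !mul0r cos0 dE; ring.
  by move: (\int[mu]_(x in D) _) => I; field; rewrite gt_eqF.
have s0 : 0 <= sigma by exact/ltW/(lt_trans _ s1).
rewrite normrM (ger0_norm s0) ler_pM// normrM (gtr0_norm d0).
rewrite (le_trans (ler_wpM2l (ltW d0) bI))// mulrDr mulrCA divff ?gt_eqF// mulr1.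
by [].
Qed.

End fejer_tauberian.

(** * From Stieltjes to Lebesgue integrals *)

Section variation_majorant.
Context {R : realType}.
Variable S : R -> R.
Hypothesis S_bv : loc_BV_nonneg S.

(** The term |S 0| accounts for the jump of [ext0 S] at 0. *)
Definition variation_majorant (x : R) : R :=
  if x < 0 then 0 else fine (total_variation 0 x S) + `|S 0|.

Lemma total_variation_fin_num x : 0 <= x -> total_variation 0 x S \is a fin_num.
Proof.
rewrite le_eqVlt => /predU1P[<-|x0]; first by rewrite total_variationxx.
by apply/bounded_variationP; [exact: ltW|exact: S_bv].
Qed.

Lemma ext0_variation x y : x <= y ->
  `|ext0 S y - ext0 S x| <= variation_majorant y - variation_majorant x.
Proof.
move=> xy; rewrite /ext0 /variation_majorant.
have [y0|y0] := ltP y 0; first by rewrite (le_lt_trans xy y0) !subrr normr0.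
have fy := total_variation_fin_num y0.
have [x0|x0] := ltP x 0.
  rewrite !subr0 -[X in `|X|](subrK (S 0)) (le_trans (ler_normD _ _))// lerD2r.
  by rewrite -lee_fin fineK// total_variation_ge.
have fx := total_variation_fin_num x0.
have D := total_variationD S x0 xy.
have fxy : total_variation x y S \is a fin_num.
  by move: fy; rewrite D fin_numD => /andP[].
by rewrite D fineD// opprD addrACA subrr addr0 addrAC subrr add0r -lee_fin fineK// total_variation_ge.
Qed.

End variation_majorant.

Lemma uniform_partition {R : realType} (a b : R) n : a < b -> (0 < n)%N ->
  exists s, [/\ itv_partition a b s, size s = n &
    forall i, (i <= n)%N -> nth b (a :: s) i = a + i%:R * ((b - a) / n%:R)].
Proof.
move=> ab n0; set h := (b - a) / n%:R.
have h0 : 0 < h by rewrite divr_gt0 ?subr_gt0 ?ltr0n.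
pose s := [seq a + i.+1%:R * h | i <- iota 0 n].
have sz : size s = n by rewrite size_map size_iota.
have nthE i : (i <= n)%N -> nth b (a :: s) i = a + i%:R * h.
  case: i => [|i] ni /=; first by rewrite mul0r addr0.
  by rewrite (nth_map 0%N) ?size_iota// nth_iota.
exists s; split => //; split.
  apply/(pathP b) => i; rewrite sz => ni.
  have := nthE i.+1 ni; rewrite /= => ->; rewrite nthE ?(ltnW ni)//.
  by rewrite ltrD2l ltr_pM2r// ltr_nat.
rewrite (last_nth b) sz nthE//.
by rewrite /h mulrC mulfVK ?subrKC// pnatr_eq0 -lt0n.
Qed.

Section riemann_stieltjes.
Context {R : realType}.
Notation mu := (@lebesgue_measure R).
Variables g V : R -> R.
Hypothesis g_V : forall x y, x <= y -> `|g y - g x| <= V y - V x.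

Lemma majorant_nondecreasing : {homo V : x y / x <= y}.
Proof. by move=> x y xy; rewrite -subr_ge0 (le_trans _ (g_V xy)). Qed.

(** Jordan decomposition: both V and V - g are nondecreasing. *)
Lemma measurable_variation (D : set R) : measurable D -> measurable_fun D g.
Proof.
move=> mD; have -> : g = (fun x => V x - (V x - g x)).
  by apply/funext => x; rewrite subKr.
apply: measurable_funB; apply: nondecreasing_measurable => //.
  by move=> x y; exact: majorant_nondecreasing.
move=> x y xy; have := g_V xy; have := ler_norm (g y - g x).
by move: (g x) (g y) => a b; lra.
Qed.

Lemma variation_bound a b x : a <= x -> x <= b -> `|g x| <= `|g a| + (V b - V a).
Proof.
move=> ax xb; rewrite -[X in `|X|](subrK (g a)) addrC (le_trans (ler_normD _ _))// lerD2l.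
by rewrite (le_trans (g_V ax))// lerD2r majorant_nondecreasing.
Qed.

Lemma integrable_variation_mul (F : R -> R) a b (A : set R) : continuous F ->
  measurable A -> A `<=` `[a, b]%classic -> mu.-integrable A (EFin \o (fun x => g x * F x)).
Proof.
move=> cF mA Aab; apply: (@integrableS _ _ _ mu `[a, b]%classic) => //.
under [X in EFin \o X]eq_fun do rewrite mulrC.
apply: (@integrable_mul_bounded _ _ _ mu _ _ _ (`|g a| + (V b - V a))) => //.
- exact: continuous_integrable_cc.
- exact: measurable_variation.
- by move=> x; rewrite /= in_itv/= => /andP[]; exact: variation_bound.
Qed.

Variables (F f : R -> R).
Hypothesis dF : forall x, exists2 d, has_deriv F x d & d = f x.
Hypothesis cf : continuous f.

(* One cell of a partition tagged at its right end point: the Stieltjes sum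
   telescopes against [F g - int g f] up to this error. *)
Lemma by_parts_step K a b x y : (forall z, a <= z <= b -> `|f z| <= K) ->
  a <= x -> x <= y -> y <= b ->
  `|F y * (g y - g x) - ((F y * g y - \int[mu]_(z in `[a, y]) (g z * f z)) -
     (F x * g x - \int[mu]_(z in `[a, x]) (g z * f z)))| <= K * (y - x) * (V y - V x).
Proof.
move=> fK ax xy yb; have ay := le_trans ax xy.
have iy : mu.-integrable `[a, y] (EFin \o (fun x => g x * f x)).
  exact: (@integrable_variation_mul _ a y).
have E := @Rintegral_itvB _ _ _ _ x iy.
have {}E := E (ltac:(by rewrite bnd_simp)) (ltac:(by rewrite bnd_simp)).
have FE := Rintegral_FTC xy dF cf.
have ifc : mu.-integrable `]x, y] (EFin \o f).
  apply: (@integrableS _ _ _ mu `[x, y]%classic) => //; last exact: continuous_integrable_cc.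
  by apply: subset_itvr; rewrite bnd_simp.
have ig : mu.-integrable `]x, y] (EFin \o (fun x => g x * f x)).
  apply: (@integrable_variation_mul _ x y) => //.
  by apply: subset_itvr; rewrite bnd_simp.
have -> : F y * (g y - g x) - ((F y * g y - \int[mu]_(z in `[a, y]) (g z * f z)) -
     (F x * g x - \int[mu]_(z in `[a, x]) (g z * f z))) =
   \int[mu]_(z in `]x, y]) (g z * f z) - g x * (F y - F x).
  by rewrite -E; ring.
rewrite -FE -Rintegral_itv_obnd_cbnd; last first.
  exact: ifc.
rewrite -RintegralZl// -RintegralB//; last exact: integrableRZ.
apply: (@le_trans _ _ (\int[mu]_(z in `]x, y]) (K * (V y - V x)))).
  apply: normr_Rintegral_le => //.
  - have mf : measurable_fun `]x, y] (fun z => g z * f z) by exact: integrable_measurable ig.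
    by apply: measurable_funB => //; apply: measurable_funM => //; exact: continuous_Rmeasurable.
  - apply: (@integrableS _ _ _ mu `[x, y]%classic) => //.
      by apply: subset_itvr; rewrite bnd_simp.
    by apply: continuous_integrable_cc => z; exact: cvg_cst.
  - move=> z; rewrite /= in_itv/= => /andP[xz zy].
    rewrite -mulrBl normrM mulrC ler_pM//.
      by apply: fK; rewrite (le_trans ax (ltW xz)) (le_trans zy).
    rewrite (le_trans (g_V (ltW xz)))// lerD2r; exact: majorant_nondecreasing.
rewrite Rintegral_cst//= lebesgue_measure_itv/= lte_fin.
have [_|yx] := ltP x y; first by rewrite /= mulrAC.
by rewrite /= mulr0 (@le_anti _ _ x y) ?xy ?yx// subrr mulr0 mul0r.
Qed.

(** The value is given, so it can be read off on equispaced partitions tagged at right end points;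
    the cell errors add up to at most K h (V b - V a), which vanishes with the mesh h. *)
Lemma RS_integral_by_parts a b J : a < b -> RS_integral F g a b J ->
  J = F b * g b - F a * g a - \int[mu]_(z in `[a, b]) (g z * f z).
Proof.
move=> ab FJ; set I := RHS.
have [K0 HK0] : exists K, forall z, a <= z <= b -> `|f z| <= K.
  have /compact_bounded [B [_ HB]] : compact (f @` `[a, b]).
    apply: continuous_compact; last exact: segment_compact.
    exact: continuous_subspaceT.
  exists (`|B| + 1) => z zab; apply: (HB (`|B| + 1)).
    by rewrite ltr_pwDr// ler_norm.
  by exists z => //=; rewrite in_itv.
pose K := `|K0|; have HK z : a <= z <= b -> `|f z| <= K.
  by move=> /HK0/le_trans; apply; exact: ler_norm.
pose Phi x := F x * g x - \int[mu]_(z in `[a, x]) (g z * f z).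
have PhiI : Phi b - Phi a = I.
  rewrite /Phi set_itv1 Rintegral_set1 subr0 /I.
  by move: (\int[mu]_(z in _) _) => X; ring.
apply/eqP; rewrite -subr_eq0 -normr_le0; apply/ler_addgt0Pl => e e0; rewrite addr0.
have e20 : 0 < e / 2 by rewrite divr_gt0.
have [d [d0 Hd]] := FJ _ e20.
have Vab : 0 <= V b - V a by rewrite subr_ge0 majorant_nondecreasing// ltW.
have q0 : 0 < d / (b - a) by rewrite divr_gt0// subr_gt0.
pose W := K * (b - a) * (V b - V a).
have ba0 : 0 <= b - a by rewrite subr_ge0 ltW.
have Kge0 : 0 <= K by exact: normr_ge0.
have W0 : 0 <= W by rewrite /W !mulr_ge0.
(* Large enough both for a mesh below [d] and for a total error W/n of at most e/2. *)
pose n := (Num.truncn ((d / (b - a))^-1 + W / (e / 2))).+1.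
have nB : (d / (b - a))^-1 + W / (e / 2) < n%:R by exact: real_truncnS_gt (num_real _).
have n0 : 0 < n%:R :> R by rewrite ltr0n.
have hd : (b - a) / n%:R < d.
  rewrite ltr_pdivrMr// mulrC -ltr_pdivrMr// -invf_div.
  by apply: le_lt_trans nB; rewrite lerDl divr_ge0// ltW.
have hW : W / n%:R <= e / 2.
  rewrite ler_pdivrMr// mulrC -ler_pdivrMr//.
  by apply: le_trans (ltW nB); rewrite lerDr invr_ge0 ltW.
have [s [ps sz nthE]] := @uniform_partition R a b n ab (ltn0Sn _).
set h := (b - a) / n%:R in hd nthE.
have h0 : 0 < h by rewrite divr_gt0// subr_gt0.
have step i : (i < n)%N -> nth b (a :: s) i.+1 - nth b (a :: s) i = h.
  by move=> ni; rewrite !nthE ?(ltnW ni)// -addn1 natrD; ring.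
have := Hd s (fun i => nth b (a :: s) i.+1) ps; rewrite sz.
have tags i : (i < n)%N -> nth b (a :: s) i <= nth b (a :: s) i.+1 <= nth b (a :: s) i.+1.
  by move=> ni; rewrite lexx andbT -subr_ge0 step// ltW.
have mesh i : (i < n)%N -> nth b (a :: s) i.+1 - nth b (a :: s) i < d.
  by move=> ni; rewrite step.
move=> /(_ tags mesh); rewrite /RS_sum sz => HJ.
set Q := \sum_(0 <= i < n) _ in HJ.
have x0E : nth b (a :: s) 0 = a by [].
have xnE : nth b (a :: s) n = b.
  by rewrite nthE// /h mulrC mulfVK ?subrKC// gt_eqF.
have le_x i : (i <= n)%N -> a <= nth b (a :: s) i <= b.
  move=> ni; rewrite nthE// lerDl mulr_ge0 ?ler0n ?(ltW h0)//=.
  rewrite -lerBrDl mulrA ler_pdivrMr// mulrC ler_pM2l ?subr_gt0//.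
  by rewrite ler_nat.
have QI : `|Q - I| <= K * h * (V b - V a).
  rewrite -PhiI; have -> : Phi b - Phi a = \sum_(0 <= i < n)
      (Phi (nth b (a :: s) i.+1) - Phi (nth b (a :: s) i)).
    by rewrite (telescope_sumr (fun i => Phi (nth b (a :: s) i)))// x0E xnE.
  have -> : V b - V a = \sum_(0 <= i < n)
      (V (nth b (a :: s) i.+1) - V (nth b (a :: s) i)).
    by rewrite (telescope_sumr (fun i => V (nth b (a :: s) i)))// x0E xnE.
  rewrite /Q -sumrB mulr_sumr (le_trans (ler_norm_sum _ _ _))//.
  rewrite !big_mkord; apply: ler_sum => i _.
  rewrite -(step _ (ltn_ord i)); apply: by_parts_step HK _ _ _.
  - by have /andP[] := le_x i (ltnW (ltn_ord i)).
  - by have /andP[] := tags i (ltn_ord i).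
  - by have /andP[] := le_x i.+1 (ltn_ord i).
rewrite -[J - I](subrKA Q) (le_trans (ler_normD _ _))// [e in leRHS]splitr lerD//.
  by rewrite distrC ltW.
rewrite (le_trans QI)//; apply: le_trans hW.
by rewrite /W /h mulrA mulrAC.
Qed.

End riemann_stieltjes.

Section laplace_stieltjes.
Context {R : realType}.
Notation mu := (@lebesgue_measure R).
Variable S : R -> R.
Hypothesis S_bv : loc_BV_nonneg S.
Notation g := (ext0 S).

Lemma measurable_ext0 (A : set R) : measurable A -> measurable_fun A g.
Proof. exact: (measurable_variation (ext0_variation S_bv)). Qed.

Lemma integrable_ext0 a b : mu.-integrable `[a, b] (EFin \o g).
Proof.
have c1 : continuous (fun _ : R => 1 : R) by move=> z; exact: cvg_cst.
have gV := ext0_variation S_bv.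
have h : mu.-integrable `[a, b] (EFin \o (fun x => g x * 1)).
  exact: (integrable_variation_mul (a := a) (b := b) gV c1).
rewrite (_ : ext0 S = (fun x => ext0 S x * 1))//.
by apply/funext => x; rewrite mulr1.
Qed.

Lemma has_deriv_kerRe (s t x : R) : exists2 d, has_deriv (kerRe s t) x d &
  d = - (expR (- s * x) * (s * cos (t * x) + t * sin (t * x))).
Proof. by eexists; [rewrite /kerRe; der|rewrite /=; ring]. Qed.

(** As [ext0 S] vanishes at -1, integration by parts leaves no boundary term at the lower end, and
    the jump at 0 is already accounted for. *)
Lemma RS_kerRe (s t T J : R) : 0 <= T -> RS_integral (kerRe s t) g (-1) T J ->
  J = cos (t * T) * damped g s T +
    \int[mu]_(x in `[0, T]) (damped g s x * (s * cos (t * x) + t * sin (t * x))).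
Proof.
move=> T0 HJ; have T1 : -1 < T by apply: lt_le_trans T0; rewrite oppr_lt0.
have cf : continuous (fun x => - (expR (- s * x) * (s * cos (t * x) + t * sin (t * x)))) by cont.
have gV := ext0_variation S_bv.
rewrite (RS_integral_by_parts gV (has_deriv_kerRe s t) cf T1 HJ).
have gN (x : R) : x < 0 -> g x = 0 by rewrite /ext0 => ->.
rewrite (gN (-1)) ?oppr_lt0// mulr0 subr0; congr (_ + _).
  by rewrite /kerRe /damped; ring.
have ig := integrable_variation_mul gV cf (measurable_itv `[-1, T]) (fun x h => h).
rewrite -[LHS]mulN1r -RintegralZl//.
rewrite [LHS]Rintegral_mkcond [RHS]Rintegral_mkcond; apply: eq_Rintegral => x _.
have p0 : point = 0 :> R by [].
rewrite !patchE !mem_setE !in_itv/= p0 /damped; have [x0|x0] := ltP x 0.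
  by rewrite gN// !mul0r mulr0; case: ifP.
rewrite (le_trans _ x0)//= ?lerN10//; case: ifP => // _; ring.
Qed.

Variable sigma : R.
Hypothesis sigma_gt0 : 0 < sigma.

Lemma integrable_damped_cc a b : mu.-integrable `[a, b] (EFin \o damped g sigma).
Proof.
have gV := ext0_variation S_bv.
by apply: (integrable_variation_mul (a := a) (b := b) gV) => //; cont.
Qed.

(** Integration by parts for e^{sigma x} B(x), with B the primitive of the damped function. Fubini
    on the triangle y <= x replaces differentiation of B, whose integrand may have jumps. *)
Lemma damped_primitive (T : R) : 0 <= T ->
  measurable_fun `[0, T] (fun x => \int[mu]_(y in `[0, x]) damped g sigma y) /\
  \int[mu]_(x in `[0, T]) (expR (sigma * x) * (sigma * \int[mu]_(y in `[0, x]) damped g sigma y)) =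
  expR (sigma * T) * \int[mu]_(y in `[0, T]) damped g sigma y - \int[mu]_(y in `[0, T]) g y.
Proof.
move=> T0.
pose F (z : R * R) := if z.2 <= z.1 then damped g sigma z.2 else 0.
have mF : measurable_fun setT F.
  apply: measurable_fun_ifT => //.
    by apply: measurable_fun_ler.
  have md : measurable_fun setT (damped g sigma) by apply: measurable_damped; exact: measurable_ext0.
  exact: (measurableT_comp md measurable_snd).
have iT := integrable_damped_cc 0 T.
have i1 : mu.-integrable `[0, T] (EFin \o cst (1 : R)).
  by apply: continuous_integrable_cc => z; exact: cvg_cst.
have Fb x y : `[0, T]%classic x -> `[0, T]%classic y -> `|F (x, y)| <= 1 * `|damped g sigma y|.
  by move=> _ _; rewrite mul1r /F/=; case: ifP => // _; rewrite normr0.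
have p0 : point = 0 :> R by [].
have Fx x : 0 <= x <= T -> \int[mu]_(y in `[0, T]) F (x, y) =
    \int[mu]_(y in `[0, x]) damped g sigma y.
  move=> /andP[x0 xT]; rewrite [LHS]Rintegral_mkcond [RHS]Rintegral_mkcond.
  apply: eq_Rintegral => y _; rewrite !patchE !mem_setE !in_itv/= p0 /F/=.
  have [yx|yx] := leP y x; last by rewrite andbF; case: ifP.
  by rewrite (le_trans yx xT).
have iT' : mu.-integrable `[0, T] (EFin \o (fun y => `|damped g sigma y|)) by exact: integrable_norm.
have mB := @measurable_Rintegral_rectangle _ _ _ _ R mu mu `[0, T]%classic `[0, T]%classic F _ _
  (measurable_itv _) (measurable_itv _) mF i1 iT' Fb.
split.
  by apply: eq_measurable_fun mB => x; rewrite inE/= in_itv/=; exact: Fx.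
pose G (z : R * R) := sigma * expR (sigma * z.1) * F z.
have mE : measurable_fun setT (fun x => sigma * expR (sigma * x)).
  by apply: continuous_Rmeasurable; cont.
have mG : measurable_fun setT G.
  by apply: measurable_funM => //; exact: (measurableT_comp mE measurable_fst).
have iE : mu.-integrable `[0, T] (EFin \o (fun x => sigma * expR (sigma * x))).
  by apply: continuous_integrable_cc; cont.
have Gb x y : `[0, T]%classic x -> `[0, T]%classic y ->
    `|G (x, y)| <= (sigma * expR (sigma * x)) * `|damped g sigma y|.
  move=> Tx Ty; have := Fb x y Tx Ty; rewrite mul1r => Fxy.
  by rewrite /G normrM ger0_norm ?ler_wpM2l// mulr_ge0 ?expR_ge0// ltW.
have := @Rfubini_rectangle _ _ _ _ R mu mu `[0, T]%classic `[0, T]%classic G _ _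
  (measurable_itv _) (measurable_itv _) mG iE iT' Gb.
have -> : \int[mu]_(x in `[0, T]) \int[mu]_(y in `[0, T]) G (x, y) =
    \int[mu]_(x in `[0, T]) (expR (sigma * x) * (sigma * \int[mu]_(y in `[0, x]) damped g sigma y)).
  apply: eq_Rintegral => x; rewrite inE/= in_itv/= => xT.
  rewrite -(Fx x xT) mulrA [_ * sigma]mulrC -RintegralZl//.
  apply: (@integrable_le _ _ _ mu _ _ (fun y => `|damped g sigma y|)) => //.
  - exact: (measurable_funS measurableT (@subsetT _ _) (measurableT_comp mF (pair1_measurable x))).
  - by move=> y Ty; have := Fb x y xT Ty; rewrite mul1r.
move=> ->.
have -> : \int[mu]_(y in `[0, T]) \int[mu]_(x in `[0, T]) G (x, y) =
    \int[mu]_(y in `[0, T]) (expR (sigma * T) * damped g sigma y - g y).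
  apply: eq_Rintegral => y; rewrite inE/= in_itv/= => /andP[y0 yT].
  have -> : \int[mu]_(x in `[0, T]) G (x, y) =
      \int[mu]_(x in `[y, T]) (damped g sigma y * (sigma * expR (sigma * x))).
    rewrite [LHS]Rintegral_mkcond [RHS]Rintegral_mkcond.
    apply: eq_Rintegral => x _; rewrite !patchE !mem_setE !in_itv/= p0 /G /F/=.
    have [yx|yx] := leP y x; last by rewrite /= mulr0; case: ifP.
    by rewrite (le_trans y0 yx)/=; case: ifP => // _; rewrite mulrC.
  rewrite RintegralZl//; last by apply: continuous_integrable_cc; cont.
  rewrite (@Rintegral_FTC _ _ (fun x => expR (sigma * x)))//.
  - have -> : g y = damped g sigma y * expR (sigma * y).
      by rewrite /damped -mulrA -expRD mulNr addNr expR0 mulr1.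
    by ring.
  - by move=> x; eexists; [der|rewrite /=; ring].
  - by cont.
rewrite RintegralB//; [|exact: integrableRZ|].
  by rewrite RintegralZl.
exact: integrable_ext0.
Qed.

(* If [B] is the primitive of [damped g sigma], then [e^(sigma x) B] has
   derivative [e^(sigma x) (damped g sigma + sigma B)], whence
   [sigma |B| <= C]. *)
Lemma damped_primitive_bound (C : R) :
  (forall T, 0 <= T -> `|damped g sigma T + sigma * \int[mu]_(y in `[0, T]) damped g sigma y| <= C) ->
  forall T, 0 <= T -> `|damped g sigma T| <= 2 * C.
Proof.
move=> HC T T0; have [mB E] := damped_primitive T0.
set B := fun x => \int[mu]_(y in `[0, x]) damped g sigma y.
have C0 : 0 <= C by exact: le_trans (HC 0 (lexx _)).
have ig : mu.-integrable `[0, T] (EFin \o g).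
  by exact: integrable_ext0.
have ie : mu.-integrable `[0, T] (EFin \o (fun x => C * expR (sigma * x))).
  by apply: continuous_integrable_cc; cont.
have mh : measurable_fun `[0, T] (fun x => expR (sigma * x) * (damped g sigma x + sigma * B x)).
  apply: measurable_funM; first by apply: continuous_Rmeasurable; cont.
  apply: measurable_funD; last exact: measurable_funM.
  by apply: measurable_damped; exact: measurable_ext0.
have hb x : `[0, T]%classic x ->
    `|expR (sigma * x) * (damped g sigma x + sigma * B x)| <= C * expR (sigma * x).
  rewrite /= in_itv/= => /andP[x0 _].
  by rewrite normrM (ger0_norm (expR_ge0 _)) mulrC ler_wpM2r ?expR_ge0// HC.
have ih : mu.-integrable `[0, T] (EFin \o (fun x => expR (sigma * x) * (damped g sigma x + sigma * B x))).
  exact: (@integrable_le _ _ _ mu _ _ _ (measurable_itv _) mh ie hb).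
have gE x : g x = expR (sigma * x) * damped g sigma x.
  by rewrite /damped mulrCA -expRD mulNr addrN expR0 mulr1.
have Eh : \int[mu]_(x in `[0, T]) (expR (sigma * x) * (damped g sigma x + sigma * B x)) =
    expR (sigma * T) * B T.
  have -> : expR (sigma * T) * B T = \int[mu]_(x in `[0, T]) (expR (sigma * x) * (sigma * B x)) +
      \int[mu]_(x in `[0, T]) g x by rewrite E subrK.
  rewrite -RintegralD//.
    by apply: eq_Rintegral => x _; rewrite {1}gE; ring.
  have : mu.-integrable `[0, T] (EFin \o (fun x =>
    expR (sigma * x) * (damped g sigma x + sigma * B x) - g x)) by exact: integrableRB.
  rewrite (_ : (fun x => _ - _) = (fun x => expR (sigma * x) * (sigma * B x)))//.
  by apply/funext => x; rewrite gE; ring.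
have := @normr_Rintegral_le _ _ _ mu `[0, T]%classic _ _ (measurable_itv _) mh ie hb.
rewrite Eh RintegralZl//; last by apply: continuous_integrable_cc; cont.
rewrite (@Rintegral_FTC _ _ (fun x => expR (sigma * x) / sigma))//; first last.
- by cont.
- by move=> x; eexists; [der|rewrite /=; field; rewrite gt_eqF].
rewrite mulr0 expR0 normrM (ger0_norm (expR_ge0 _)) -mulrBl => HB.
have BC : `|sigma * B T| <= C.
  rewrite normrM gtr0_norm// -(ler_pM2l (expR_gt0 (sigma * T))) mulrCA.
  rewrite (le_trans (ler_wpM2l (ltW sigma_gt0) HB))//.
  have -> : sigma * (C * ((expR (sigma * T) - 1) / sigma)) = C * (expR (sigma * T) - 1).
    by field; rewrite gt_eqF.
  by rewrite mulrC ler_wpM2r// gerBl.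
have -> : damped g sigma T = damped g sigma T + sigma * B T - sigma * B T by rewrite addrK.
by rewrite mulr_natl mulr2n (le_trans (ler_normB _ _))// lerD// HC.
Qed.

(** At t = 0 the truncated transform is the damped function plus sigma times its primitive. It is
    bounded for large T by convergence and for small T by local bounded variation, so
    [damped_primitive_bound] applies. *)
Lemma RS_improper_exp (I : R) : RS_improper (kerRe sigma 0) g (-1) I ->
  exists C, forall x, 0 <= x -> `|g x| <= C * expR (sigma * x).
Proof.
move=> /(_ 1 ltr01)[T0 HT0].
have gV := ext0_variation S_bv.
pose T1 := Num.max T0 0; have T10 : 0 <= T1 by rewrite le_max lexx orbT.
pose M := `|g 0| + (variation_majorant S T1 - variation_majorant S 0).
have M0 : 0 <= M by rewrite addr_ge0// subr_ge0 (majorant_nondecreasing gV).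
have damped_le T : 0 <= T -> T <= T1 -> `|damped g sigma T| <= M.
  move=> TT0 TT1; rewrite normrM (ger0_norm (expR_ge0 _)).
  rewrite -[leRHS]mulr1 ler_pM ?expR_ge0//; first exact: (variation_bound gV).
  by rewrite -expR0 ler_expR mulNr oppr_le0 mulr_ge0// ltW.
pose C := `|I| + 1 + (M + sigma * (M * T1)).
have HC T : 0 <= T -> `|damped g sigma T + sigma * \int[mu]_(y in `[0, T]) damped g sigma y| <= C.
  move=> TT0; have [TT1|T1T] := leP T T1; last first.
    have [|J [HJ JI]] := HT0 T; first by rewrite (le_trans _ (ltW T1T))// le_max lexx.
    have EJ := RS_kerRe TT0 HJ.
    have <- : J = damped g sigma T + sigma * \int[mu]_(y in `[0, T]) damped g sigma y.
      rewrite EJ mul0r cos0 mul1r -RintegralZl//; last exact: integrable_damped_cc.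
      congr (_ + _); apply: eq_Rintegral => x _.
      by rewrite !mul0r cos0 addr0 mulr1 mulrC.
    rewrite -[J](subrK I) (le_trans (ler_normD _ _))// addrC /C -addrA lerD2l.
    by rewrite ler_wpDr ?(ltW JI)// addr_ge0// !mulr_ge0// ltW.
  rewrite /C ler_wpDl ?addr_ge0// (le_trans (ler_normD _ _))// lerD ?damped_le//.
  rewrite normrM gtr0_norm// ler_pM2l//.
  apply: (@le_trans _ _ (\int[mu]_(y in `[0, T]) M)).
    apply: normr_Rintegral_le => //.
    - exact: (integrable_measurable (integrable_damped_cc 0 T)).
    - by apply: continuous_integrable_cc => z; exact: cvg_cst.
    - by move=> y; rewrite /= in_itv/= => /andP[y0 yT]; rewrite damped_le// (le_trans yT).
  have [z0|TT] := leP T 0; last first.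
    by rewrite Rintegral_cst//= lebesgue_measure_itv/= lte_fin TT/= subr0 ler_wpM2l.
  have -> : T = 0 by apply/eqP; rewrite eq_le z0.
  by rewrite set_itv1 Rintegral_set1 mulr_ge0.
exists (2 * C) => x x0; have := damped_primitive_bound HC x0.
by rewrite normrM (ger0_norm (expR_ge0 _)) mulNr expRN ler_pdivrMr ?expR_gt0.
Qed.

End laplace_stieltjes.

Section laplace_transform.
Context {R : realType}.
Notation mu := (@lebesgue_measure R).
Notation D := (`[0, +oo[%classic : set R).
Variable S : R -> R.
Hypothesis S_bv : loc_BV_nonneg S.
Notation g := (ext0 S).
Hypothesis g_exp : forall sigma, 1 < sigma ->
  exists C, forall x, 0 <= x -> `|g x| <= C * expR (sigma * x).

Lemma RS_improper_re_laplace (sigma t I : R) : 1 < sigma ->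
  RS_improper (kerRe sigma t) g (-1) I -> I = re_laplace g sigma t.
Proof.
move=> s1 HI; have s0 : 0 < sigma by exact: lt_trans s1.
have s1' : 1 < (1 + sigma) / 2 by lra.
have [C HC] := g_exp s1'.
have C0 : 0 <= C by have := HC 0 (lexx _); rewrite mulr0 expR0 mulr1; apply: le_trans.
have [d dE] : exists d, d = (sigma - 1) / 2 by exists ((sigma - 1) / 2).
have d0 : 0 < d by rewrite dE divr_gt0// subr_gt0.
have d20 : 0 < d / 2 by rewrite divr_gt0.
have Hd x : 0 <= x -> `|damped g sigma x| <= C * expR (- d * x).
  move=> x0; rewrite normrM (ger0_norm (expR_ge0 _)).
  rewrite (le_trans (ler_wpM2r (expR_ge0 _) (HC x x0)))// -mulrA -expRD.
  by rewrite le_eqVlt; apply/orP; left; apply/eqP; congr (_ * expR _); rewrite dE; field.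
pose k x := sigma * cos (t * x) + t * sin (t * x).
pose L := sigma + `|t|; have L0 : 0 <= L by rewrite addr_ge0// ltW.
have kL x : `|k x| <= L by exact/norm_trig_abs_le/ltW.
have mg := measurable_ext0 S_bv measurableT.
have id : mu.-integrable D (EFin \o damped g sigma) by exact: integrable_damped.
have ck : continuous k by rewrite /k; cont.
have ik : mu.-integrable D (EFin \o (fun x => damped g sigma x * k x)).
  apply: (@integrable_mul_bounded _ _ _ mu _ _ _ L) => //.
  exact: continuous_Rmeasurable.
(* [C] comes from the boundary term at T, and the second summand from the integral beyond T. *)
pose K := C + L * C * (2 / d).
have K0 : 0 <= K by rewrite addr_ge0// !mulr_ge0// ?invr_ge0 ltW.
have tail T : 0 <= T ->
    `|cos (t * T) * damped g sigma T - \int[mu]_(x in `]T, +oo[) (damped g sigma x * k x)|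
    <= K * expR (- (d / 2) * T).
  move=> T0; rewrite (le_trans (ler_normB _ _))// /K mulrDl lerD//.
    rewrite normrM (le_trans (ler_wpM2r (normr_ge0 _) (cos_max _)))// mul1r.
    rewrite (le_trans (Hd _ T0))// ler_wpM2l// ler_expR.
    by rewrite ler_wpM2r// lerN2 ler_piMr ?(ltW d0)//; lra.
  have sT : `]T, +oo[%classic `<=` D.
    by move=> x; rewrite /= !in_itv/= !andbT => /ltW; exact: le_trans.
  (* Half of the decay rate is spent on smallness in T, the other half on integrability in x. *)
  pose G x := L * C * expR (- (d / 2) * T) * expR (- (d / 2) * x).
  have iG : mu.-integrable D (EFin \o G).
    by apply: integrableRZ => //; exact: integrable_expR_decay.
  apply: (@le_trans _ _ (\int[mu]_(x in `]T, +oo[) G x)).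
    apply: normr_Rintegral_le => //.
    - exact: measurable_funS (integrable_measurable ik).
    - exact: integrableS iG.
    move=> x; rewrite /= in_itv/= andbT => Tx; have x0 := le_trans T0 (ltW Tx).
    rewrite normrM mulrC /G -!mulrA ler_pM// (le_trans (Hd x x0))//.
    rewrite ler_wpM2l// -expRD ler_expR.
    by rewrite !mulNr [in leLHS](splitr d) mulrDl opprD lerD2r lerN2 ler_pM2l// ltW.
  apply: (@le_trans _ _ (\int[mu]_(x in D) G x)).
    by apply: Rintegral_subset => // x; rewrite !mulr_ge0 ?expR_ge0.
  rewrite RintegralZl ?Rintegral_expR_decay//; last exact: integrable_expR_decay.
  by rewrite invf_div mulrAC.
apply/eqP; rewrite -subr_eq0 -normr_le0; apply/ler_addgt0Pl => e e0; rewrite addr0.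
have e20 : 0 < e / 2 by rewrite divr_gt0.
have [T0 HT] := HI _ e20.
pose T := Num.max T0 (Num.max 0 (K / (e / 2) / (d / 2))).
have TT0 : T0 <= T by rewrite le_max lexx.
have T00 : 0 <= T by rewrite !le_max lexx orbT.
have TK : K / (e / 2) <= d / 2 * T.
  by rewrite [leRHS]mulrC -ler_pdivrMr// !le_max lexx !orbT.
have [J [HJ JI]] := HT T TT0.
have EJ := RS_kerRe S_bv T00 HJ.
have Esplit : re_laplace g sigma t = \int[mu]_(x in `[0, T]) (damped g sigma x * k x) +
    \int[mu]_(x in `]T, +oo[) (damped g sigma x * k x).
  have E := @Rintegral_itvB _ _ _ _ T ik.
  have {}E := E (ltac:(by rewrite bnd_simp)) (ltac:(by rewrite bnd_simp)).
  by rewrite -E addrC subrK.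
have EJ' : J - re_laplace g sigma t =
    cos (t * T) * damped g sigma T - \int[mu]_(x in `]T, +oo[) (damped g sigma x * k x).
  by rewrite EJ Esplit opprD addrA addrK.
have small : K * expR (- (d / 2) * T) <= e / 2.
  rewrite mulNr expRN ler_pdivrMr ?expR_gt0//.
  have h : K <= e / 2 * (1 + d / 2 * T).
    rewrite mulrC -ler_pdivrMr// (le_trans TK)// lerDr.
    by [].
  by rewrite (le_trans h)// ler_pM2l// expR_ge1Dx.
rewrite -(subrKA J) (le_trans (ler_normD _ _))// [e]splitr lerD//.
  by rewrite distrC ltW.
by rewrite EJ' (le_trans (tail T T00)).
Qed.

End laplace_transform.

(** * The Tauberian theorem for the Lebesgue form of the transform *)

Section tauberian.
Context {R : realType}.
Notation mu := (@lebesgue_measure R).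
Notation D := (`[0, +oo[%classic : set R).
Variable S : R -> R.
Hypothesis mS : measurable_fun setT S.
Hypothesis S_exp : forall sigma, 1 < sigma ->
  exists C, forall x, 0 <= x -> `|S x| <= C * expR (sigma * x).
Hypothesis S_slow : log_linearly_slowly_decreasing S.

Variable f : R -> R.
Hypothesis f_int : forall a b, 0 < a -> a <= b ->
  mu.-integrable `[a, b] (EFin \o f).
Hypothesis f_lim : forall a b, 0 < a -> a <= b -> forall e, 0 < e ->
  exists eta, 0 < eta <= 1 /\ forall sigma, 1 < sigma < 1 + eta ->
    \int[mu]_(t in `[a, b]) `|re_laplace S sigma t - f t| <= e.
Hypothesis near0 :
  (exists b g, [/\ 0 < b, mu.-integrable `]0, b] (EFin \o g) &
    forall sigma, 1 < sigma <= 2 ->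
      {ae mu, forall t, `]0, b]%classic t -> g t <= re_laplace S sigma t}]) \/
  (exists b C, 0 < b /\ forall sigma, 1 < sigma < 2 ->
      \int[mu]_(t in `]0, b]) `|re_laplace S sigma t| <= C).

Lemma re_laplace_tauberian : exists a : R,
  ((sigma - 1) * re_laplace S sigma 0) @[sigma --> 1^'+] --> a /\
  damped S 1 x @[x --> +oo] --> a.
Proof.
have [m [m0 [_ [_ Sm _]]]] := S_bound mS S_exp S_slow f_int f_lim near0.
have [A HA] := fejer_mean_limit mS S_exp S_slow f_int f_lim near0.
pose a := A / @fejer_mass R.
have HA' M : 1 <= M -> forall e, 0 < e -> exists u0, 0 < u0 /\ forall u, u0 <= u ->
    `|\int[mu]_(x in D) (damped S 1 x * fejer M (x - u)) - a * @fejer_mass R| <= e.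
  by rewrite /a mulfVK ?gt_eqF ?fejer_mass_gt0//; exact: HA.
exists a; split; apply/cvgrPdist_le => e e0.
  (* [re_laplace_pole] returns 2 * 4 * (e/16) = e/2. The other e/2 pays for the term with [K] and
     for replacing sigma a by a, both proportional to sigma - 1. *)
  have e16 : 0 < e / 16 by rewrite divr_gt0.
  have [K [K0 HK]] := re_laplace_pole mS S_slow m0 Sm HA' e16.
  pose L := 2 * K + `|a| + 1.
  have L0 : 0 < L by rewrite ltr_wpDl// addr_ge0// mulr_ge0.
  pose eta := Num.min 1 (e / 2 / L).
  have eta0 : 0 < eta by rewrite lt_min ltr01 !divr_gt0.
  have : \forall s \near (1 : R)^'+, 1 < s < 1 + eta.
    by near=> s; apply/andP; split => //; near: s; apply: nbhs_right_lt; rewrite ltrDl.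
  apply: filterS => s /andP[s1 s2].
  move: s2; rewrite -ltrBlDl lt_min => /andP[s2 sL].
  have s12 : 1 < s <= 2 by rewrite s1/= -lerBlDr (le_trans (ltW s2))//; lra.
  have h1 := HK s s12.
  have h2 : (s - 1) * L <= e / 2 by rewrite -ler_pdivlMr// ltW.
  have h3 : (s - 1) * `|a| = `|s * a - a|.
    have d0 : 0 < s - 1 by rewrite subr_gt0.
    by rewrite -{1}(gtr0_norm d0) -normrM mulrBl mul1r.
  rewrite distrC -(subrKA (s * a)) (le_trans (ler_normD _ _))// -h3.
  move: h1 h2; rewrite /L !mulrDr.
  move: (`|_ - _|) (`|a|) => X Y; have : 0 < s - 1 by rewrite subr_gt0.
  by move: e0; lra.
have e4 : 0 < e / 4 by rewrite divr_gt0.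
have [X [X0 HX]] := damped_limit mS S_slow m0 Sm HA' e4.
near=> x; rewrite distrC (le_trans (HX x _))//.
by rewrite mulrC divfK.
Unshelve. all: by end_near. Qed.

End tauberian.

Theorem theorem1p3 (R : realType) (S : R -> R) (U : R -> R -> R) :
  log_linearly_slowly_decreasing S ->
  loc_BV_nonneg S ->
  right_continuous_nonneg S ->
  (* the Laplace-Stieltjes transform int_{0^-}^oo e^{-sx} dS(x) converges on Re s > 1 *)
  (forall sigma t : R, 1 < sigma ->
     (exists I, RS_improper (kerRe sigma t) (ext0 S) (-1) I) /\
     (exists I, RS_improper (kerIm sigma t) (ext0 S) (-1) I)) ->
  (* U (sigma, t) = Re L{dS; sigma + i t} *)
  (forall sigma t : R, 1 < sigma ->
     RS_improper (kerRe sigma t) (ext0 S) (-1) (U sigma t)) ->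
  (* L^1_loc boundary behavior on 1 + i(R \ {0}) *)
  (exists f : R -> R,
     forall a b : R, a <= b -> ~ (a <= 0 <= b) ->
       (@lebesgue_measure R).-integrable `[a, b] (EFin \o f) /\
       (fun sigma => (\int[@lebesgue_measure R]_(t in `[a, b]) (`| U sigma t - f t |)%:E)%E)
         @ 1^'+ --> 0%E) ->
  (exists lam : R, 0 < lam /\
     [\/ (* (B.1) *)
         exists c : R, 0 <= c /\
           forall t sigma : R, - lam < t < lam -> 1 < sigma <= 2 -> U sigma t >= - c,
         (* (B.2) *)
         exists M : R, forall sigma : R, 1 < sigma < 2 ->
           ((\int[@lebesgue_measure R]_(t in `](- lam)%R, lam[) (`| U sigma t |)%:E) <= M%:E)%E
       | (* (B.3) *)
         exists (g : R -> R) (k : nat),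
           [/\ (@lebesgue_measure R).-integrable `]- lam, lam[ (EFin \o g),
               {ae @lebesgue_measure R, forall t : R, t \in `]- lam, lam[ ->
                   forall sigma : R, 1 < sigma <= 2 -> U sigma t >= g t}
             & exists C : R, forall t sigma : R, - lam < t < lam -> 1 < sigma <= 2 ->
                   `| U sigma t | <= C * (sigma - 1) ^- k]]) ->
  exists a : R,
    ((sigma - 1) * U sigma 0) @[sigma --> 1^'+] --> a /\
    (S x / expR x) @[x --> +oo] --> a.
Proof.
move=> S_slow S_bv _ _ HU [f Hf] [lam [lam0 near0]].
have mg : measurable_fun setT (ext0 S) by exact: measurable_ext0.
have g_exp sigma : 1 < sigma -> exists C, forall x, 0 <= x -> `|ext0 S x| <= C * expR (sigma * x).
  by move=> s1; apply: RS_improper_exp (HU sigma 0 s1) => //; exact: lt_trans s1.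
have UE sigma t : 1 < sigma -> U sigma t = re_laplace (ext0 S) sigma t.
  by move=> s1; apply: RS_improper_re_laplace (HU _ _ s1).
have g_slow : log_linearly_slowly_decreasing (ext0 S).
  move=> e /S_slow[h [x0 [h0 x00 H]]]; exists h, x0; split => // x y xx xy yh.
  have xgt0 := lt_le_trans x00 xx; rewrite /ext0 !ltNge (ltW xgt0) (le_trans (ltW xgt0) xy)/=.
  exact: H.
have not0 (a b : R) : 0 < a -> ~ (a <= 0 <= b) by move=> a0 /andP[]; rewrite leNgt a0.
have f_int a b : 0 < a -> a <= b -> (@lebesgue_measure R).-integrable `[a, b] (EFin \o f).
  by move=> a0 ab; have [] := Hf a b ab (not0 a b a0).
have f_lim a b : 0 < a -> a <= b -> forall e, 0 < e ->
    exists eta, 0 < eta <= 1 /\ forall sigma, 1 < sigma < 1 + eta ->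
    \int[@lebesgue_measure R]_(t in `[a, b]) `|re_laplace (ext0 S) sigma t - f t| <= e.
  move=> a0 ab e e0; have [_ /fine_cvg/cvgrPdist_le/(_ e e0)] := Hf a b ab (not0 a b a0).
  move=> /right_near[eta [eta01 H]]; exists eta; split => // sigma /[dup] /andP[s1 _] /H.
  rewrite /= sub0r normrN; apply: le_trans; apply: le_trans (ler_norm _).
  rewrite le_eqVlt; apply/orP; left; apply/eqP.
  by apply: eq_Rintegral => t _; rewrite UE.
(* The hypotheses concern the open interval, while the argument works on intervals closed on the
   right; halving keeps the end point inside. *)
have lam20 : 0 < lam / 2 by rewrite divr_gt0.
have lam2 : lam / 2 < lam by rewrite ltr_pdivrMr// ltr_pMr// ltr1n.
have sub t : `]0, (lam / 2)]%classic t -> - lam < t < lam.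
  rewrite /= in_itv/= => /andP[t0 tl]; rewrite (le_lt_trans tl)// andbT.
  by rewrite (lt_trans _ t0)// oppr_lt0.
have [a [Ha Sa]] : exists a : R,
    ((sigma - 1) * re_laplace (ext0 S) sigma 0) @[sigma --> 1^'+] --> a /\
    damped (ext0 S) 1 x @[x --> +oo] --> a.
  apply: (re_laplace_tauberian mg g_exp g_slow f_int f_lim).
  case: near0 => [[c [c0 Hc]]|[M HM]|[g [k [ig Hg _]]]].
  - left; exists (lam / 2), (fun=> - c); split => //.
      by apply: integrable_oc => x; exact: cvg_cst.
    move=> sigma s12; apply: aeW => t /sub tl; rewrite -UE; last by case/andP: s12.
    exact: Hc.
  - right; exists (lam / 2), M; split => // sigma /[dup] s12 /andP[s1 _].
    have iU := integrable_norm (U_integrable mg g_exp s1 lam20).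
    have mU := re_laplace_measurable (M := lam) mg (lt_trans ltr01 s1) (integrable_damped mg g_exp s1).
    rewrite -lee_fin EFin_Rintegral//; apply: le_trans (HM sigma s12).
    under [leRHS]eq_integral do rewrite UE//.
    apply: ge0_subset_integral => //.
      apply/measurable_EFinP; apply: measurableT_comp => //.
      by apply: measurable_funS mU => //; exact: subset_itv_oo_cc.
  - left; exists (lam / 2), g; split => //.
      by apply: integrableS ig => // t /sub; rewrite /= in_itv.
    move=> sigma s12; apply: (ae_imp Hg) => t Ht /sub tl; rewrite -UE; last by case/andP: s12.
    by apply: Ht s12; rewrite in_itv.
exists a; split.
  apply: cvg_trans Ha; apply: near_eq_cvg; near=> s.
  by rewrite UE//; near: s; exact: nbhs_right_gt.
apply: cvg_trans Sa; apply: near_eq_cvg; near=> x.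
have x0 : 0 <= x by near: x; exact: nbhs_pinfty_ge.
by rewrite /damped /ext0 ltNge x0/= mulN1r expRN.
Unshelve. all: by end_near. Qed.
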